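(* Let $\alpha\in\mathbf{C}\setminus\{0\}$ and suppose that $g_2=80\alpha^2/3$ and $g_3=-80\alpha^3/3$ (so that $J=-80$); equivalently, that $e_1,e_2,e_3$ are the three roots of $3x^3-20x+20$, each multiplied by $\alpha$. Then the projective monodromy group $G(L_{1/6,-\alpha/9})$ of the algebraic-form Lamé operator with $\ell=1/6$, $B=-\alpha/9$ and these $e_1,e_2,e_3$ is icosahedral (isomorphic to $A_5$).
   Context: For $\ell,B\in\mathbf{C}$ and distinct $e_1,e_2,e_3\in\mathbf{C}$ with $e_1+e_2+e_3=0$, the algebraic-form Lamé operator on $\mathbf{P}^1(\mathbf{C})$ (coordinate $x$) is $$L_{\ell,B} = D^2 + \frac12\sum_{i=1}^3\frac{1}{x-e_i}\,D - \frac{\ell(\ell+1)x+B}{4\prod_{i=1}^3(x-e_i)},\qquad D=\frac{d}{dx}.$$ The invariants $g_2,g_3$ are defined by $4x^3-g_2x-g_3=4\prod_{i=1}^3(x-e_i)$, and $J=g_2^3/(g_2^3-27g_3^2)$. Projective monodromy group $G(L_{\ell,B})$: choose an ordinary point $P$ and two independent local solutions at $P$. Analytic continuation along loops based at $P$ in $\mathbf{P}^1(\mathbf{C})\setminus\{e_1,e_2,e_3,\infty\}$ gives a representation of the fundamental group in $GL(2,\mathbf{C})$, and $G(L_{\ell,B})$ is the image of this monodromy group in $PGL(2,\mathbf{C})$ (well defined up to isomorphism). *)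

(* Defs.v *)
From HB Require Import structures.
From mathcomp Require Import all_boot all_order all_algebra all_fingroup.
From mathcomp Require Import all_solvable generic_quotient complex ring.
From mathcomp Require Import all_classical all_reals all_analysis.
Set Implicit Arguments.
Unset Strict Implicit.
Unset Printing Implicit Defensive.
Import Order.TTheory GRing.Theory Num.Theory.
Import numFieldNormedType.Exports.
Local Open Scope classical_set_scope.
Local Open Scope complex_scope.
Local Open Scope ring_scope.
Local Open Scope quotient_scope.

(* MathComp's {'GL_n[R]} and {unit R} require a finite ring. *)
Definition GL (F : fieldType) (n : nat) := {A : 'M[F]_n | A \in unitmx}.

Section GL_group.
Variables (F : fieldType) (n : nat).

HB.instance Definition _ := SubChoice.on (GL F n).

Definition GL_one : GL F n :=
  exist (fun A : 'M[F]_n => A \in unitmx) 1%:M (unitmx1 F n).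

Lemma GL_mul_subproof (A B : GL F n) : val A *m val B \in unitmx.
Proof. by rewrite unitmx_mul (valP A) (valP B). Qed.

Definition GL_mul (A B : GL F n) : GL F n :=
  exist (fun A : 'M[F]_n => A \in unitmx) _ (GL_mul_subproof A B).

Lemma GL_inv_subproof (A : GL F n) : invmx (val A) \in unitmx.
Proof. by rewrite unitmx_inv (valP A). Qed.

Definition GL_inv (A : GL F n) : GL F n :=
  exist (fun A : 'M[F]_n => A \in unitmx) _ (GL_inv_subproof A).

Lemma GL_mulA : associative GL_mul.
Proof. by move=> A B C; apply: val_inj; rewrite /= mulmxA. Qed.

Lemma GL_mul1 : left_id GL_one GL_mul.
Proof. by move=> A; apply: val_inj; rewrite /= mul1mx. Qed.

Lemma GL_mulr1 : right_id GL_one GL_mul.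
Proof. by move=> A; apply: val_inj; rewrite /= mulmx1. Qed.

Lemma GL_mulV : left_inverse GL_one GL_inv GL_mul.
Proof. by move=> A; apply: val_inj; rewrite /= mulVmx // (valP A). Qed.

Lemma GL_mulrV : right_inverse GL_one GL_inv GL_mul.
Proof. by move=> A; apply: val_inj; rewrite /= mulmxV // (valP A). Qed.

HB.instance Definition _ := isGroup.Build (GL F n)
  GL_mulA GL_mul1 GL_mulr1 GL_mulV GL_mulrV.

Definition proportional (A B : GL F n) : bool :=
  `[< exists2 c : F, c != 0 & val A = c *: val B >].

Lemma proportional_refl : reflexive proportional.
Proof. by move=> A; apply/asboolP; exists 1; rewrite ?oner_neq0 ?scale1r. Qed.

Lemma proportional_sym : symmetric proportional.
Proof.
suff H A B : proportional A B -> proportional B A.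
  by move=> A B; apply/idP/idP; exact: H.
move=> /asboolP[c c0 E]; apply/asboolP; exists c^-1; first by rewrite invr_eq0.
by rewrite E scalerA mulVf // scale1r.
Qed.

Lemma proportional_trans : transitive proportional.
Proof.
move=> B A C /asboolP[c c0 E] /asboolP[d d0 E']; apply/asboolP.
by exists (c * d); [rewrite mulf_neq0 | rewrite E E' scalerA].
Qed.

Canonical proportional_equiv := EquivRel proportional
  proportional_refl proportional_sym proportional_trans.

Definition PGL := {eq_quot proportional}.

HB.instance Definition _ := Choice.on PGL.
HB.instance Definition _ := EqQuotient.on PGL.

End GL_group.

Arguments PGL : clear implicits.
Arguments proportional {F n}.

Section PGL_group.
Variables (F : fieldType) (n : nat).
Local Notation PGL := (PGL F n).

Definition toPGL (A : GL F n) : PGL := \pi_PGL A.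

Definition PGL_one : PGL := toPGL 1%g.
Definition PGL_mul (a b : PGL) : PGL := toPGL (repr a * repr b)%g.
Definition PGL_inv (a : PGL) : PGL := toPGL (repr a)^-1%g.

Lemma toPGL_eq (A B : GL F n) :
  toPGL A = toPGL B <-> exists2 c : F, c != 0 & val A = c *: val B.
Proof.
split=> [/eqP|H]; first by rewrite eqmodE => /asboolP.
by apply/eqP; rewrite eqmodE; apply/asboolP.
Qed.

Lemma repr_toPGL (A : GL F n) :
  exists2 c : F, c != 0 & val (repr (toPGL A)) = c *: val A.
Proof. by apply/toPGL_eq; rewrite /toPGL reprK. Qed.

Lemma toPGLM (A B : GL F n) : toPGL (A * B)%g = PGL_mul (toPGL A) (toPGL B).
Proof.
apply/esym/toPGL_eq; have [c c0 E] := repr_toPGL A.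
have [d d0 E'] := repr_toPGL B.
exists (c * d); first by rewrite mulf_neq0.
by rewrite /= E E' -scalemxAl -scalemxAr scalerA.
Qed.

Lemma toPGLV (A : GL F n) : toPGL A^-1%g = PGL_inv (toPGL A).
Proof.
apply/esym/toPGL_eq; have [c c0 E] := repr_toPGL A.
exists c^-1; first by rewrite invr_eq0.
by rewrite /= E invmxZ // -E (valP (repr (toPGL A))).
Qed.

Lemma toPGL_surj (a : PGL) : exists A, a = toPGL A.
Proof. by exists (repr a); rewrite /toPGL reprK. Qed.

Lemma PGL_mulA : associative PGL_mul.
Proof.
move=> a b c; have [A ->] := toPGL_surj a; have [B ->] := toPGL_surj b.
by have [C ->] := toPGL_surj c; rewrite -!toPGLM mulgA.
Qed.

Lemma PGL_mul1 : left_id PGL_one PGL_mul.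
Proof. by move=> a; have [A ->] := toPGL_surj a; rewrite -toPGLM mul1g. Qed.

Lemma PGL_mulr1 : right_id PGL_one PGL_mul.
Proof. by move=> a; have [A ->] := toPGL_surj a; rewrite -toPGLM mulg1. Qed.

Lemma PGL_mulV : left_inverse PGL_one PGL_inv PGL_mul.
Proof.
by move=> a; have [A ->] := toPGL_surj a; rewrite -toPGLV -toPGLM mulVg.
Qed.

Lemma PGL_mulrV : right_inverse PGL_one PGL_inv PGL_mul.
Proof.
by move=> a; have [A ->] := toPGL_surj a; rewrite -toPGLV -toPGLM mulgV.
Qed.

HB.instance Definition _ := isGroup.Build PGL
  PGL_mulA PGL_mul1 PGL_mulr1 PGL_mulV PGL_mulrV.

End PGL_group.

Definition isomorphic_to (gT : finGroupType) (H : {group gT})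
    (G : groupType) (S : set G) : Prop :=
  exists f : gT -> G,
    [/\ {in H &, {morph f : a b / (a * b)%g}},
        {in H &, injective f} & f @` [set` H] = S].

Definition icosahedral (G : groupType) (S : set G) : Prop :=
  isomorphic_to ('Alt_('I_5))%G S.

(* R[i] carries no canonical topology; packed as a numClosedFieldType it gets
   the norm topology, and derivable and derive1 are complex derivatives. *)
Definition Cplx (R : realType) : numClosedFieldType := R[i].

Section Lame.
Variable R : realType.
Local Notation C := (Cplx R).
Implicit Types (l B p z : C) (e : 'I_3 -> C) (f : C -> C).

Definition lame l B e f z : C :=
  derive1n 2 f z + 2^-1 * (\sum_i (z - e i)^-1) * derive1 f z
  - (l * (l + 1) * z + B) / (4 * \prod_i (z - e i)) * f z.

Definition local_solution l B e p f : Prop :=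
  \forall z \near p,
    [/\ derivable f z 1, derivable (derive1 f) z 1 & lame l B e f z = 0].

Definition independent_at p (y : 'I_2 -> C -> C) : Prop :=
  forall c : 'I_2 -> C,
    (\forall z \near p, \sum_j c j * y j z = 0) -> forall j, c j = 0.

Definition ordinary_point e p : Prop := forall i, p != e i.

(* A loop based at p in P^1(C) \ {e_1, e_2, e_3, oo}. *)
Definition is_loop e p (g : R -> C) : Prop :=
  [/\ {within `[0, 1], continuous g}, g 0 = p, g 1 = p
    & forall t, t \in `[0, 1] -> ordinary_point e (g t)].

(* Y t is the germ at g t of the solution continued along g. *)
Definition continuation l B e (g : R -> C) (Y : R -> C -> C) : Prop :=
  forall t, t \in `[0, 1] ->
    local_solution l B e (g t) (Y t) /\
    \forall s \near t, s \in `[0, 1] -> \forall z \near g s, Y s z = Y t z.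

Definition monodromy_group l B e p (y : 'I_2 -> C -> C) : set (GL C 2) :=
  [set M : GL C 2 | exists (g : R -> C) (Y : 'I_2 -> R -> C -> C),
    [/\ is_loop e p g,
        forall j, continuation l B e g (Y j),
        forall j, \forall z \near p, Y j 0 z = y j z
      & forall j, \forall z \near p, Y j 1 z = \sum_k val M j k * y k z]].

Definition projective_monodromy_group l B e p (y : 'I_2 -> C -> C) :
    set (PGL C 2) :=
  @toPGL C 2 @` monodromy_group l B e p y.

Definition cubic e : {poly C} := 4%:P * \prod_i ('X - (e i)%:P).

Definition g2 e : C := - (cubic e)`_1.
Definition g3 e : C := - (cubic e)`_0.

Lemma cubic_invariants e : \sum_i e i = 0 ->
  cubic e = 4%:P * 'X^3 - (g2 e)%:P * 'X - (g3 e)%:P.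
Proof.
rewrite /g2 /g3 /cubic !big_ord_recl !big_ord0 addr0 mulr1.
move: (e _) (e _) (e _) => c b a s0.
have -> : 4%:P * (('X - a%:P) * (('X - b%:P) * ('X - c%:P))) =
    4%:P * 'X^3 - (4 * (a + (b + c)))%:P * 'X^2
    + (4 * (a * b + b * c + c * a))%:P * 'X - (4 * (a * b * c))%:P :> {poly C}.
  by rewrite !(polyCM, polyCD); ring.
rewrite s0 mulr0 polyC0 mul0r subr0.
have E k : (4%:P * 'X^3 + (4 * (a * b + b * c + c * a))%:P * 'X
    - (4 * (a * b * c))%:P : {poly C})`_k =
    4 * (k == 3)%:R + (4 * (a * b + b * c + c * a)) * (k == 1)%:R
    - (4 * (a * b * c)) * (k == 0)%:R.
  by rewrite coefB coefD !coefCM coefXn coefX coefC; case: k => [|k] /=; ring.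
rewrite !E /= !polyCD !polyCN !polyCM; ring.
Qed.

Definition Jinv e : C := g2 e ^+ 3 / (g2 e ^+ 3 - 27 * g3 e ^+ 2).

End Lame.

(* Main.v *)
Require Import Defs.
From HB Require Import structures.
From mathcomp Require Import all_boot all_order all_algebra all_fingroup all_solvable.
From mathcomp Require Import generic_quotient complex ring lra zify.
From mathcomp Require Import all_classical all_reals all_analysis.
Import Order.TTheory GRing.Theory Num.Theory.
Import numFieldNormedType.Exports.
Local Open Scope classical_set_scope.
Local Open Scope ring_scope.
Set Implicit Arguments.
Unset Strict Implicit.
Unset Printing Implicit Defensive.

(* Rescaling the coordinate reduces to [alpha = 1].  Upper bound: a binary form of
   degree 12 with polynomial coefficients in [x], evaluated on the jets of the
   solutions, is constant along solutions, and in suitable solutions it is Klein's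
   icosahedral form [XY(X^10 + 11 X^5 Y^5 - Y^10)].  The monodromy preserves this form,
   whose projective symmetry group has the 60 elements [u^b d^k] and [d^j s u^b d^k] and
   is isomorphic to [A_5].
   Lower bound: transport the local monodromies at the real root (exponents 0, 1/2) and
   at infinity (exponents 1/12, -7/12) to the base point 1 along the real axis.  Complex
   conjugation acts on the 60 symmetries as conjugation by the involution [u].  The first
   monodromy is a real involution, so it commutes with [u], and it differs from [u]
   because it has real eigenvectors; the second has order 3 and is conjugate to its
   inverse by [u].  In [A_5] such a pair has a product of order 5, so the monodromy
   subgroup has order divisible by 30, hence is normal, hence everything. *)

(** The matrices connecting the local solutions at the real root and at infinity with those at the
    base point are never computed. The lower bound needs only that they are real: the cubic has a
    single real root and is positive to its right, so both local monodromies are reached along a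
    real interval free of singularities. The order 3 at infinity comes from the exponent difference
    2/3. For the upper bound, Klein's form of two suitable solutions is a constant times [x - 1], in
    agreement with the growth [x^(1/12)] at infinity. Keeping all thirteen coefficients of the form
    on jets turns conservation into finitely many polynomial identities. The point 1, a zero of the
    leading coefficient, serves as base point because there the form becomes Klein's after a linear
    change of variables with real entries. Continuation is recorded by values of jets along a path
    rather than by germs, since values can be multiplied by matrices and glued pointwise. *)

(** * Derivatives, induction on the unit interval, functions with zero derivative *)

Lemma near_normP (K : numFieldType) (x : K) (P : K -> Prop) :
  (\forall z \near x, P z) <-> exists2 r : K, 0 < r & forall z, `|z - x| < r -> P z.
Proof.
split=> [/nbhs_normP[r r0 H]|[r r0 H]].
  by exists r => // z zx; apply: H => /=; rewrite /ball_ /= distrC.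
by apply/nbhs_normP; exists r => // z /=; rewrite distrC => /H.
Qed.

(** Multiplying the difference quotient by [h] removes both the division and the puncture at 0.
    Segments, power series and complex conjugation are all handled through this form. *)
Lemma is_deriveP (K : numFieldType) (f : K -> K) (x d : K) :
  is_derive x 1 f d <->
  forall e, 0 < e -> exists2 r : K, 0 < r &
    forall h, `|h| < r -> `|f (x + h) - f x - h * d| <= e * `|h|.
Proof.
split=> [[fx <-] e e0|H].
  have /cvgrPdist_le/(_ e e0) : h^-1 *: ((f \o shift x) (h *: 1) - f x) @[h --> 0^']
      --> 'D_1 f x by exact: fx.
  rewrite near_withinE => /near_normP[r r0 Hr]; exists r => // h hr.
  have [->|h0] := eqVneq h 0.
    by rewrite addr0 subrr mul0r subrr normr0 mulr0.
  have := Hr h; rewrite subr0 => /(_ hr h0) /=.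
  rewrite /GRing.scale /= mulr1 => L.
  rewrite -ler_pdivrMr ?normr_gt0 // -normf_div; apply: le_trans L.
  rewrite distrC (_ : (_ - h * _) / h = (f (h + x) - f x) / h - 'D_1 f x).
    by rewrite mulrC.
  by rewrite (addrC x) mulrBl (mulrC h) mulfK.
have L : h^-1 *: ((f \o shift x) (h *: 1) - f x) @[h --> 0^'] --> d.
  apply/cvgrPdist_le => e e0; rewrite near_withinE; apply/near_normP.
  have [r r0 Hr] := H e e0; exists r => // h; rewrite subr0 => hr h0.
  have := Hr h hr; rewrite /= /GRing.scale /= mulr1.
  rewrite -ler_pdivrMr ?normr_gt0 // -normf_div; apply: le_trans.
  rewrite distrC (_ : (_ - h * _) / h = h^-1 * (f (h + x) - f x) - d) //.
  by rewrite (addrC x) mulrBl [in LHS](mulrC h) mulfK // mulrC.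
apply: DeriveDef; first exact: (cvgP d).
by apply: cvg_lim L; exact: norm_hausdorff.
Qed.

(** [a * b / (a + b)] lies below both, so [a] and [b] need not be compared; the order of the complex
    numbers is only partial. *)
Lemma minor2 (K : numFieldType) (a b : K) : 0 < a -> 0 < b ->
  exists2 c : K, 0 < c & (c <= a) && (c <= b).
Proof.
move=> a0 b0; have ab : 0 < a + b by rewrite addr_gt0.
exists (a * b / (a + b)); first by rewrite divr_gt0 // mulr_gt0.
rewrite !ler_pdivrMr // ler_pM2l // lerDr (ltW a0) /= mulrC ler_pM2l //.
by rewrite lerDl (ltW b0).
Qed.

Lemma is_derive_comp1 (K : numFieldType) (f g : K -> K) (x df dg : K) :
  is_derive (g x) 1 f df -> is_derive x 1 g dg ->
  is_derive x 1 (f \o g) (df * dg).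
Proof.
move=> [fx <-] [gx <-].
move/derivable1_diffP: (fx) => dfx; move/derivable1_diffP: (gx) => dgx.
have dfg : differentiable (f \o g) x by exact/differentiable_comp.
apply: DeriveDef; first exact/derivable1_diffP.
rewrite -!derive1E derive1E' // diff_comp // !derive1E' //=.
by rewrite -[X in 'd  _ _ X = _]mulr1 [LHS]linearZ mulrC.
Qed.

(** Continuous induction: the supremum of the initial segments on which [P] holds can be neither
    missed nor less than 1. It replaces the usual subdivision of a path by compactness. *)
Lemma locally_constant01 (R : realType) (P : R -> Prop) :
  (forall t : R, t \in `[0, 1]%R ->
     \forall s \near t, s \in `[0, 1]%R -> (P s <-> P t)) ->
  P 0 -> forall t : R, t \in `[0, 1]%R -> P t.
Proof.
move=> loc P0.
have [in0 in1] : (0 : R) \in `[0, 1]%R /\ (1 : R) \in `[0, 1]%R.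
  by rewrite !in_itv /= !lexx !ler01.
pose A := [set t : R | t \in `[0, 1]%R /\ forall s : R, 0 <= s <= t -> P s].
have A0 : A 0.
  by split=> // s; rewrite -eq_le => /eqP <-.
have supA : has_sup A.
  split; first by exists 0.
  by exists 1 => t [+ _]; rewrite in_itv /= => /andP[].
pose m := sup A.
have mI : m \in `[0, 1]%R.
  rewrite in_itv /=; apply/andP; split; first by apply: ub_le_sup => //; case: supA.
  by apply: ge_sup; [exists 0 | move=> t [+ _]; rewrite in_itv /= => /andP[]].
have [r r0 Hr] := iffLR (near_normP _ _) (loc m mI).
have Pm : P m.
  have [t tA mt] := sup_adherent r0 supA.
  have tm : t <= m by apply: ub_le_sup => //; case: supA.
  have [tI tP] := tA.
  apply/(Hr t _ tI); last by apply: tP; rewrite lexx andbT; move: tI; rewrite in_itv => /andP[].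
  by rewrite distrC ger0_norm ?subr_ge0 // ltrBlDr addrC -ltrBlDr.
have Plt s : 0 <= s -> s < m -> P s.
  move=> s0 sm; have [t tA st] := sup_adherent (eps := m - s) ltac:(by rewrite subr_gt0) supA.
  by apply: tA.2; rewrite s0 ltW //; move: st; rewrite opprB addrC subrK.
suff m1 : m = 1.
  move=> t; rewrite in_itv /= => /andP[t0 t1].
  have [tm|/(Plt _ t0)|<-] := ltgtP m t => //.
  by rewrite m1 in tm; move: (le_lt_trans t1 tm); rewrite ltxx.
apply/eqP; rewrite eq_le; move: (mI); rewrite in_itv /= => /andP[m0 ->] /=.
rewrite leNgt; apply/negP => m1.
have [c c0 /andP[cr c1]] := minor2 (a := r / 2) (b := 1 - m) ltac:(by rewrite divr_gt0) ltac:(by rewrite subr_gt0).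
suff : A (m + c).
  move=> /(ub_le_sup supA.2); rewrite -/m gerDl leNgt c0 //.
split.
  by rewrite in_itv /= addr_ge0 ?(ltW c0) //= -lerBrDl.
move=> s /andP[s0 smc]; have [sm|ms] := ltP s m; first exact: Plt.
apply/(Hr s) => //.
  rewrite ger0_norm ?subr_ge0 // ltrBlDl (le_lt_trans smc) // ltrD2l (le_lt_trans cr) //.
  by rewrite ltr_pdivrMr // ltr_pMr // ltr1n.
by rewrite in_itv /= s0 (le_trans smc) // -lerBrDl.
Qed.

Section Complex_analysis.
Variable R : realType.
Local Notation C := (Cplx R).
Local Notation "x %:C" := (complex.real_complex R x : C).

Lemma real_complexE' (x : C) : 0 < x -> exists2 r : R, 0 < r & x = r%:C.
Proof.
move=> x0; exists (complex.Re x); last by rewrite complex.RRe_real // gtr0_real.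
by move: x0; rewrite complex.ltcE /= => /andP[].
Qed.

Lemma normRC (x : R) : `|x%:C| = `|x|%:C.
Proof. by rewrite complex.normc_def /= expr0n /= addr0 sqrtr_sqr. Qed.

(** The real mean value theorem, applied along the segment from [x0] to [z] to the real part of
    [k * u] for constants [k]. *)
Lemma deriv0_const (u : C -> C) (x0 r : C) :
  (forall z, `|z - x0| < r -> is_derive z 1 u 0) ->
  forall z, `|z - x0| < r -> u z = u x0.
Proof.
move=> du z zr.
pose g t := x0 + t%:C * (z - x0).
have gr (t : R) : t \in `[0, 1]%R -> `|g t - x0| < r.
  rewrite in_itv /= => /andP[t0 t1]; rewrite /g addrC addKr normrM normRC.
  apply: (le_lt_trans _ zr); rewrite (ger0_norm t0) // ler_piMl //.
  by rewrite -[1]/(1%:C) complex.lecR.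
pose d : C := z - x0.
have key (k : C) : complex.Re (k * u z) = complex.Re (k * u x0).
  pose a (t : R) : R := complex.Re (k * u (g t)).
  have da (t : R) : t \in `[0, 1]%R -> is_derive t (1 : R) a 0.
    move=> tI; apply/is_deriveP => e e0.
    (* Chosen so that [(|k| + 1) * c * (|d| + 1) = e]; the added ones avoid division by zero. *)
    pose c : C := e%:C / (`|d| + 1) / (`|k| + 1).
    have d1 : 0 < `|d| + 1 by rewrite ltr_wpDl.
    have k1 : 0 < `|k| + 1 by rewrite ltr_wpDl.
    have c0 : 0 < c by rewrite !divr_gt0 // -[0]/(0%:C) complex.ltcR.
    have [q q0 Hq] := iffLR (is_deriveP _ _ _) (du _ (gr t tI)) c c0.
    have [q' q'0 qE] := real_complexE' (divr_gt0 q0 d1).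
    exists q' => // h hq'; rewrite mulr0 subr0.
    have gth : g (t + h) = g t + h%:C * d.
      by rewrite /g rmorphD /= /d mulrDl addrA.
    rewrite /a gth -complex.lecR -raddfB /= -mulrBr.
    apply: (le_trans (complex.normc_ge_Re _)).
    have := Hq (h%:C * d); rewrite mulr0 subr0 !normrM !normRC => L.
    have {}L : `|u (g t + h%:C * d) - u (g t)| <= c * (`|h|%:C * `|d|).
      apply: L; apply: (@le_lt_trans _ _ (`|h|%:C * (`|d| + 1))).
        by rewrite ler_wpM2l ?lerDl // -normRC.
      by rewrite -ltr_pdivlMr // qE complex.ltcR.
    rewrite rmorphM /=.
    apply: (@le_trans _ _ ((`|k| + 1) * (c * (`|h|%:C * (`|d| + 1))))).
      apply: ler_pM => //; first by rewrite lerDl.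
      apply: (le_trans L); rewrite ler_wpM2l ?(ltW c0) //.
      by rewrite ler_wpM2l ?lerDl // -normRC.
    rewrite le_eqVlt; apply/orP; left; apply/eqP; rewrite /c.
    by field; rewrite !gt_eqF.
  have da' (t : R) : t \in `]0, 1[%R -> is_derive t (1 : R) a ((fun=> 0) t).
    by move=> tI; apply: da; apply: subset_itv_oo_cc.
  have ca : {within `[0, 1], continuous a}.
    by apply: derivable_within_continuous => t tI; have [] := da t tI.
  have [c _] := MVT_segment ler01 da' ca.
  rewrite mul0r => /eqP; rewrite subr_eq0 /a /g rmorph1 rmorph0 mul1r mul0r addr0 => /eqP.
  by rewrite addrC subrK.
(* The values [k = 1] and [k = -i] give the real and the imaginary part. *)
have := key 1; have := key (- 'i%C); rewrite !mul1r.
case: (u z) => p q; case: (u x0) => p' q' /=.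
by rewrite !mulN1r !oppr0 !mul0r !sub0r !opprK => -> ->.
Qed.

End Complex_analysis.

(** * Power series and the method of Frobenius *)

Section Power_series.
Variable R : realType.
Local Notation C := (Cplx R).
Local Notation "x %:C" := (complex.real_complex R x : C).
Implicit Types (a b : nat -> C) (X s K M : C).

(** Convergence of partial sums as a relation, so that sums, shifts and polynomial multiples are
    treated before any value is chosen. *)
Definition psums a X (s : C) : Prop :=
  forall e : C, 0 < e -> exists N0, forall N, (N0 <= N)%N ->
    `|\sum_(n < N) a n * X ^+ n - s| <= e.

Definition geometric_bound a K M : Prop := forall n, `|a n| <= K * M ^+ n.

Lemma psums_unique a X s t : psums a X s -> psums a X t -> s = t.
Proof.
move=> hs ht; apply/eqP; rewrite -subr_eq0 -normr_le0; apply/negPn/negP => h.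
have st : 0 < `|s - t|.
  by rewrite normr_gt0; apply: contra h => /eqP ->; rewrite normr0.
have e0 : 0 < `|s - t| / 4 by rewrite divr_gt0.
have [N1 H1] := hs _ e0; have [N2 H2] := ht _ e0.
have L1 := H1 (maxn N1 N2) (leq_maxl _ _); have L2 := H2 (maxn N1 N2) (leq_maxr _ _).
set S := \sum_(n < _) _ in L1 L2.
have : `|s - t| <= `|s - t| / 4 + `|s - t| / 4.
  rewrite (_ : s - t = (S - t) - (S - s)); last by ring.
  by apply: (le_trans (ler_normB _ _)); rewrite addrC (_ : S - t - (S - s) = s - t) ?lerD //; ring.
rewrite (_ : `|s - t| / 4 + `|s - t| / 4 = `|s - t| / 2); last by field.
by rewrite ler_pdivlMr // mulr_natr mulr2n gerDl lt_geF.
Qed.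

Lemma psumsD a b X s t : psums a X s -> psums b X t ->
  psums (fun n => a n + b n) X (s + t).
Proof.
move=> hs ht e e0; have e2 : 0 < e / 2 by rewrite divr_gt0.
have [N1 H1] := hs _ e2; have [N2 H2] := ht _ e2.
exists (maxn N1 N2) => N; rewrite geq_max => /andP[/H1 L1 /H2 L2].
under eq_bigr do rewrite mulrDl.
rewrite big_split /= (_ : forall u v w z : C, u + v - (w + z) = (u - w) + (v - z)); last by move=> *; ring.
by rewrite (le_trans (ler_normD _ _)) // [leRHS](splitr e) lerD.
Qed.

Lemma psumsZ k a X s : psums a X s -> psums (fun n => k * a n) X (k * s).
Proof.
move=> hs e e0; have k1 : 0 < `|k| + 1 by rewrite ltr_wpDl.
have [N H] := hs _ (divr_gt0 e0 k1); exists N => n /H L.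
under eq_bigr do rewrite -mulrA.
rewrite -mulr_sumr -mulrBr normrM.
rewrite (@le_trans _ _ ((`|k| + 1) * (e / (`|k| + 1)))) ?ler_pM ?lerDl //.
by rewrite mulrC divfK ?gt_eqF.
Qed.

Definition shift_seq a n : C := if n is m.+1 then a m else 0.

Lemma psums_shift a X s : psums a X s -> psums (shift_seq a) X (X * s).
Proof.
move=> hs e e0; have k1 : 0 < `|X| + 1 by rewrite ltr_wpDl.
have [N H] := hs _ (divr_gt0 e0 k1); exists N.+1 => -[//|n] /H L.
rewrite big_ord_recl /= mul0r add0r.
under eq_bigr do rewrite exprS mulrCA.
rewrite -mulr_sumr -mulrBr normrM.
rewrite (@le_trans _ _ ((`|X| + 1) * (e / (`|X| + 1)))) ?ler_pM ?lerDl //.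
by rewrite mulrC divfK ?gt_eqF.
Qed.

Lemma eq_psums a b X s : a =1 b -> psums a X s -> psums b X s.
Proof.
by move=> ab h e /h[N H]; exists N => n /H; under eq_bigr do rewrite ab.
Qed.

Lemma psums0 X : psums (fun=> 0) X 0.
Proof.
by move=> e e0; exists 0%N => N _; rewrite big1 ?subrr ?normr0 ?ltW // => i; rewrite mul0r.
Qed.

Definition poly_conv (p : {poly C}) a n : C := \sum_(j < n.+1) p`_(n - j) * a j.

(** Horner's scheme: multiplication by [X] is a shift of the sequence, so induction on [p] needs no
    general Cauchy product. *)
Lemma psums_poly (p : {poly C}) a X s : psums a X s -> psums (poly_conv p a) X (p.[X] * s).
Proof.
move=> h; elim/poly_ind: p => [|p c IH].
  rewrite horner0 mul0r; apply: eq_psums (psums0 X) => n.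
  by rewrite /poly_conv big1 // => i; rewrite coef0 mul0r.
rewrite hornerMXaddC (_ : _ * s = X * (p.[X] * s) + c * s); last by ring.
apply: eq_psums (psumsD (psums_shift IH) (psumsZ c h)) => n.
rewrite /poly_conv big_ord_recr /= subnn coefD coefMX coefC eqxx add0r.
congr (_ + _); case: n => [|n] /=; first by rewrite big_ord0.
apply: eq_bigr => i _; rewrite coefD coefMX coefC subn_eq0 leqNgt ltnS.
by rewrite -ltnS ltn_ord /= addr0 subSn // -ltnS.
Qed.

(** Real and imaginary parts are each dominated by a real geometric series. *)
Lemma psums_exists a K M X : 0 <= K -> 0 <= M -> geometric_bound a K M ->
  M * `|X| < 1 -> exists s, psums a X s.
Proof.
move=> K0 M0 aKM MX1.
pose q := complex.Re (M * `|X|); pose k := complex.Re K.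
have qE : M * `|X| = q%:C by rewrite complex.RRe_real // ger0_real // mulr_ge0.
have kE : K = k%:C by rewrite complex.RRe_real // ger0_real.
have q0 : 0 <= q by rewrite -complex.lecR -qE mulr_ge0.
have q1 : `|q| < 1 by rewrite ger0_norm // -complex.ltcR -qE.
have k0 : 0 <= k by rewrite -complex.lecR -kE.
have real_cvg (F : C -> R) (Flip : forall z, `|F z|%:C <= `|z|) :
    exists l : R, forall e : R, 0 < e -> exists N0, forall N, (N0 <= N)%N ->
      `|\sum_(n < N) F (a n * X ^+ n) - l| <= e.
  pose u n := F (a n * X ^+ n).
  have cu : cvgn (series u).
    apply: normed_cvg; apply: (@series_le_cvg _ _ (geometric k q)) => [n|n|n|].
    - exact: normr_ge0.
    - by rewrite /geometric /= mulr_ge0 // exprn_ge0.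
    - rewrite /= -complex.lecR (le_trans (Flip _)) // normrM normrX /geometric /=.
      rewrite rmorphM rmorphXn /= -kE -qE exprMn mulrA ler_wpM2r // exprn_ge0 //.
    - exact: is_cvg_geometric_series.
  exists (limn (series u)) => e e0.
  have /cvgrPdist_le/(_ e e0)[N0 _ H] := cu.
  by exists N0 => N /H; rewrite /= distrC /series /= big_mkord.
have [l1 H1] := real_cvg (@complex.Re R) (fun z => complex.normc_ge_Re z).
have [|l2 H2] := real_cvg (@complex.Im R).
  move=> z; have := complex.normc_ge_Re (- 'i%C * z : C).
  rewrite normrM normrN complex.normc_def /= expr0n expr1n add0r sqrtr1 mul1r.
  by case: z => x y; rewrite /= oppr0 mul0r sub0r mulN1r opprK.
exists (l1%:C + 'i%C * l2%:C) => e e0.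
have [r r0 rE] := real_complexE' e0.
have r2 : 0 < r / 2 by rewrite divr_gt0.
have [N1 L1] := H1 _ r2; have [N2 L2] := H2 _ r2.
exists (maxn N1 N2) => N; rewrite geq_max => /andP[/L1 A1 /L2 A2].
set S := \sum_(n < N) _.
have -> : S - (l1%:C + 'i%C * l2%:C) =
    (complex.Re S - l1)%:C + 'i%C * (complex.Im S - l2)%:C.
  by rewrite [S in LHS]complex.complexE !rmorphB /=; ring.
rewrite (le_trans (ler_normD _ _)) // normrM !normRC.
rewrite complex.normc_def /= expr0n expr1n add0r sqrtr1 mul1r -rmorphD rE complex.lecR.
by rewrite [leRHS](splitr r) lerD // /S raddf_sum.
Qed.

Definition deriv_seq a n : C := n.+1%:R * a n.+1.

(** From [n + 1 <= 2 ^ n]: each termwise differentiation doubles the ratio. *)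
Lemma geometric_bound_deriv a K M : 0 <= K -> 0 <= M ->
  geometric_bound a K M -> geometric_bound (deriv_seq a) (K * M) (2 * M).
Proof.
move=> K0 M0 H n; rewrite normrM normr_nat exprMn.
rewrite (_ : K * M * _ = 2 ^+ n * (K * M ^+ n.+1)); last by rewrite exprS; ring.
by rewrite ler_pM ?ler0n // -natrX ler_nat ltn_expl.
Qed.

Lemma sum_sqr_halves N : \sum_(n < N) (n ^ 2)%:R * 2^-1 ^+ n <= 6 :> C.
Proof.
(* The infinite series sums to 6; the exact remainder makes the induction go through. *)
suff -> : \sum_(n < N) (n ^ 2)%:R * 2^-1 ^+ n =
    6 - (N ^ 2 + 2 * N + 3)%:R * 2 * 2^-1 ^+ N :> C.
  by rewrite gerBl !mulr_ge0 ?ler0n // exprn_ge0 // invr_ge0.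
elim: N => [|N IH]; first by rewrite big_ord0 expr0; ring.
by rewrite big_ord_recr /= IH exprS !natrD !natrM -!natr1; field.
Qed.

(** Second-order remainder of a monomial. The factor [r ^ 2] on the left avoids the exponent
    [n - 2], and [n ^ 2] is a crude substitute for [n (n - 1) / 2]. *)
Lemma taylor2_bound (X h r : C) n : `|X| <= r -> `|X + h| <= r ->
  r ^+ 2 * `|(X + h) ^+ n - X ^+ n - h * (n%:R * X ^+ n.-1)| <=
  (n ^ 2)%:R * r ^+ n * `|h| ^+ 2.
Proof.
move=> Xr Xhr; have r0 : 0 <= r by apply: le_trans Xr.
elim: n => [|n IH]; first by rewrite !expr0 mul0r mulr0 !subrr normr0 mulr0 !mul0r.
have -> : (X + h) ^+ n.+1 - X ^+ n.+1 - h * (n.+1%:R * X ^+ n.+1.-1) =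
    (X + h) * ((X + h) ^+ n - X ^+ n - h * (n%:R * X ^+ n.-1))
    + n%:R * h ^+ 2 * X ^+ n.-1.
  by case: n {IH} => [|n] /=; rewrite !exprS -!natr1 /=; ring.
rewrite (le_trans (ler_wpM2l _ (ler_normD _ _))) ?exprn_ge0 // mulrDr.
rewrite (@le_trans _ _ (r * ((n ^ 2)%:R * r ^+ n * `|h| ^+ 2) + n%:R * r ^+ n.+1 * `|h| ^+ 2)) //.
  rewrite lerD //.
    by rewrite normrM mulrCA ler_pM // mulr_ge0 ?exprn_ge0.
  case: n {IH} => [|n] /=; first by rewrite !mul0r normr0 mulr0.
  rewrite !normrM normr_nat !normrX.
  rewrite (_ : r ^+ n.+2 = r ^+ 2 * r ^+ n); last by rewrite -exprD.
  have -> : r ^+ 2 * (n.+1%:R * (`|h| * `|h|) * `|X| ^+ n) =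
      n.+1%:R * (r ^+ 2 * `|X| ^+ n) * `|h| ^+ 2.
    by move: (n.+1%:R) (`|X| ^+ n) => u w; rewrite expr2; ring.
  by rewrite ler_wpM2r ?exprn_ge0 // ler_wpM2l ?ler0n // ler_wpM2l ?exprn_ge0 // lerXn2r // nnegrE.
have -> : r * ((n ^ 2)%:R * r ^+ n * `|h| ^+ 2) + n%:R * r ^+ n.+1 * `|h| ^+ 2 =
    (n ^ 2 + n)%:R * r ^+ n.+1 * `|h| ^+ 2.
  by rewrite natrD (exprS r); move: ((n ^ 2)%:R) (n%:R) (r ^+ n) => u v w; ring.
rewrite ler_wpM2r ?exprn_ge0 // ler_wpM2r ?exprn_ge0 // ler_nat.
by rewrite !expnS !expn0; lia.
Qed.

(** On the disc of radius [1 / (2 M)] the second-order remainders of the terms are summable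
    uniformly, with total at most [6 K |h| ^ 2 / q ^ 2]. This is applied to finite partial sums, and
    the tails are absorbed separately. *)
Lemma psums_is_derive a K M (f f1 : C -> C) (r : C) : 0 <= K -> 0 < M ->
  geometric_bound a K M -> r <= (2 * M)^-1 ->
  (forall X, `|X| < r -> psums a X (f X)) ->
  (forall X, `|X| < r -> psums (deriv_seq a) X (f1 X)) ->
  forall X, `|X| < r -> is_derive X 1 f (f1 X).
Proof.
move=> K0 M0 aKM rM hf hf1 X Xr; apply/is_deriveP => e e0.
pose q : C := (2 * M)^-1; have q0 : 0 < q by rewrite invr_gt0 mulr_gt0.
pose c : C := 6 * K / q ^+ 2 + 1.
have c0 : 0 < c by rewrite ltr_wpDl // !mulr_ge0 // invr_ge0 exprn_ge0 // ltW.
have [d d0 /andP[d1 d2]] : exists2 d : C, 0 < d & (d <= r - `|X|) && (d <= e / 2 / c).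
  by apply: minor2; rewrite ?subr_gt0 // !divr_gt0.
exists d => // h hd; have [->|h0] := eqVneq h 0.
  by rewrite addr0 subrr mul0r subrr normr0 mulr0.
have Xhr : `|X + h| < r.
  by rewrite (le_lt_trans (ler_normD _ _)) // -ltrBrDl (lt_le_trans hd).
(* Half of [e * |h|] is left for the three tails: [(2 + |h|) / (6 (1 + |h|)) <= 1 / 2]. *)
have e3 : 0 < e * `|h| / 6 / (1 + `|h|).
  by rewrite !divr_gt0 ?mulr_gt0 ?normr_gt0 // ltr_wpDr.
have [N1 H1] := hf _ Xr _ e3; have [N2 H2] := hf _ Xhr _ e3; have [N3 H3] := hf1 _ Xr _ e3.
pose N := maxn N1 (maxn N2 N3).
have {}H1 : `|_| <= _ := H1 N.+1 (leqW (leq_maxl _ _)).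
have {}H2 : `|_| <= _ := H2 N.+1 (leqW (leq_trans (leq_maxl _ _) (leq_maxr _ _))).
have {}H3 : `|_| <= _ := H3 N (leq_trans (leq_maxr _ _) (leq_maxr _ _)).
set S1 := \sum_(n < N.+1) _ in H1; set S2 := \sum_(n < N.+1) _ in H2.
set S3 := \sum_(n < N) _ in H3.
have B : `|S2 - S1 - h * S3| <= e / 2 * `|h|.
  have -> : S2 - S1 - h * S3 =
      \sum_(n < N.+1) a n * ((X + h) ^+ n - X ^+ n - h * (n%:R * X ^+ n.-1)).
    under [RHS]eq_bigr do rewrite !mulrBr.
    rewrite !sumrB -/S1 -/S2; congr (_ - _).
    rewrite big_ord_recl /= !(mul0r, mulr0) add0r mulr_sumr.
    apply: eq_bigr => i _ /=; rewrite /deriv_seq /bump /= add0n add1n.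
    by move: (i.+1%:R) (a i.+1) (X ^+ i) => u v w; ring.
  apply: (le_trans (ler_norm_sum _ _ _)).
  apply: (@le_trans _ _ (\sum_(n < N.+1) K * (n ^ 2)%:R * 2^-1 ^+ n * `|h| ^+ 2 / q ^+ 2)).
    apply: ler_sum => n _; rewrite normrM.
    rewrite ler_pdivlMr ?exprn_gt0 //.
    have T := @taylor2_bound X h q n (ltW (lt_le_trans Xr rM)) (ltW (lt_le_trans Xhr rM)).
    have -> : 2^-1 ^+ n = M ^+ n * q ^+ n :> C.
      by rewrite -exprMn; congr (_ ^+ n); rewrite /q; field; rewrite gt_eqF.
    rewrite -mulrA (mulrC _ (q ^+ 2)).
    apply: (@le_trans _ _ ((K * M ^+ n) * ((n ^ 2)%:R * q ^+ n * `|h| ^+ 2))).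
      rewrite mulrCA; apply: ler_pM => //.
      by rewrite mulr_ge0 // exprn_ge0 // ltW.
    move: ((n ^ 2)%:R) (M ^+ n) (q ^+ n) => u v w.
    set L := (X in X <= _); set L' := (X in _ <= X).
    by have -> : L = L' by rewrite /L /L'; ring.
  rewrite (eq_bigr (fun n : 'I_N.+1 => (K * `|h| ^+ 2 / q ^+ 2) * ((n ^ 2)%:R * 2^-1 ^+ n))); last first.
    by move=> n _; move: ((n ^ 2)%:R) (2^-1 ^+ n) => u v; ring.
  rewrite -mulr_sumr.
  apply: (@le_trans _ _ (K * `|h| ^+ 2 / q ^+ 2 * 6)).
    by rewrite ler_wpM2l ?sum_sqr_halves // !mulr_ge0 ?exprn_ge0 // invr_ge0 exprn_ge0 // ltW.
  rewrite (_ : _ * 6 = 6 * K / q ^+ 2 * `|h| * `|h|); last by rewrite expr2; ring.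
  rewrite ler_wpM2r // (@le_trans _ _ (c * `|h|)) ?ler_wpM2r ?lerDl //.
  by rewrite mulrC -ler_pdivlMr // (le_trans _ d2) // ltW.
have -> : f (X + h) - f X - h * f1 X =
    (S2 - S1 - h * S3) + ((S1 - f X) - (S2 - f (X + h)) + h * (S3 - f1 X)) by ring.
apply: (le_trans (ler_normD _ _)).
rewrite (_ : e * `|h| = e / 2 * `|h| + e / 2 * `|h|); last by field.
apply: lerD => //; apply: (le_trans (ler_normD _ _)).
apply: (@le_trans _ _ (e * `|h| / 6 / (1 + `|h|) + e * `|h| / 6 / (1 + `|h|) + `|h| * (e * `|h| / 6 / (1 + `|h|)))).
  rewrite lerD //; first by rewrite (le_trans (ler_normB _ _)) // lerD.
  by rewrite normrM ler_wpM2l.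
have h1 : 0 < 1 + `|h| by rewrite ltr_wpDr.
rewrite (_ : _ + _ = e * `|h| * (2 + `|h|) / (6 * (1 + `|h|))); last first.
  by field; rewrite gt_eqF.
rewrite ler_pdivrMr ?mulr_gt0 //.
rewrite (_ : e / 2 * _ * _ = e * `|h| * (3 * (1 + `|h|))); last by field.
rewrite ler_wpM2l ?mulr_ge0 ?(ltW e0) // mulrDr mulr1 lerD ?ler_nat //.
by rewrite ler_peMl // ler1n.
Qed.
End Power_series.

Section Frobenius.
Variable R : realType.
Local Notation C := (Cplx R).
Local Notation "x %:C" := (complex.real_complex R x : C).
Implicit Types (a : nat -> C) (X K M : C) (A B D : {poly C}).

(** Course-of-values recursion: [h n] is the list of the first [n + 2] terms, and a longer list
    never changes an earlier entry. *)
Lemma recurrence_exists (w : nat -> nat -> C) (a0 a1 : C) : exists a,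
  [/\ a 0%N = a0, a 1%N = a1 &
      forall n, a n.+2 = \sum_(j < n.+2) w n.+1 j * a j].
Proof.
pose fix h (n : nat) : seq C := if n is m.+1
  then rcons (h m) (\sum_(j < m.+2) w m.+1 j * (h m)`_j) else [:: a0; a1].
have size_h n : size (h n) = n.+2 by elim: n => //= n IH; rewrite size_rcons IH.
have hS n j : (j < n.+2)%N -> (h n.+1)`_j = (h n)`_j.
  by move=> jn; rewrite /= nth_rcons size_h jn.
have hD n m j : (j < n.+2)%N -> (h (m + n)%N)`_j = (h n)`_j.
  by move=> jn; elim: m => // m IH; rewrite addSn hS // (leq_trans jn) // !ltnS leq_addl.
exists (fun n => (h n)`_n); split=> // n.
rewrite (@hS n.+1 n.+2) // [in LHS]/= nth_rcons size_h ltnn eqxx.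
apply: eq_bigr => j _; congr (_ * _).
have [jn|nj] := ltnP j n.+1.
  by have := @hD j (n - j)%N j (leqnSn _); rewrite subnK.
have -> : nat_of_ord j = n.+1 by apply/eqP; rewrite eqn_leq nj -ltnS ltn_ord.
by rewrite hS.
Qed.

(** Weight of [a j] in [a n.+1], read off from the coefficient of [X ^ n] in
    [A f'' + B f' + D f = 0] when [A] starts with [X]. The terms in [a n.+1] contribute
    [n.+1 * n + B_0 * n.+1], which is the denominator. *)
Definition frob_coef A B D n j : C :=
  - (A`_(n.+2 - j) * (j * j.-1)%:R + B`_(n.+1 - j) * j%:R + D`_(n - j))
    / (n.+1%:R * (n%:R + B`_0)).

(** The denominator dominates the factors [j (j - 1)] and [j], so each weight is at most [c] at the
    index difference. The coefficients being polynomials, the [c m] have a finite total [W], and the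
    ratio [W + 1] survives the induction. *)
Lemma frobenius_bound A B D a : 0 <= B`_0 ->
  (forall n, a n.+2 = \sum_(j < n.+2) frob_coef A B D n.+1 j * a j) ->
  exists K M, [/\ 0 <= K, 0 < M & geometric_bound a K M].
Proof.
move=> b0 aE.
pose c m : C := `|A`_m.+2| + `|B`_m.+1| + `|D`_m|.
have c0 m : 0 <= c m by rewrite !addr_ge0.
pose N := maxn (size A) (maxn (size B) (size D)).
pose W : C := \sum_(m < N) c m.
have cW k : \sum_(m < k) c m <= W.
  have W0 : 0 <= W by apply: sumr_ge0.
  have [kN|Nk] := leqP k N.
    rewrite /W (big_ord_widen_cond N (fun=> true) c kN).
    by rewrite [leRHS](bigID (fun i : 'I_N => (i < k)%N)) /= lerDl sumr_ge0.
  rewrite -(subnKC (ltnW Nk)) big_split_ord /= [X in _ + X]big1 ?addr0 // => i _.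
  rewrite /c !nth_default ?normr0 ?addr0 //.
  - by rewrite (leq_trans _ (leq_addr _ _)) // !leq_max leqnn !orbT.
  - by rewrite leqW // (leq_trans _ (leq_addr _ _)) // !leq_max leqnn !orbT.
  - by rewrite !leqW // (leq_trans _ (leq_addr _ _)) // !leq_max leqnn.
have wc n j : (j < n.+2)%N -> `|frob_coef A B D n.+1 j| <= c (n.+1 - j)%N.
  move=> jn; rewrite /frob_coef normrM normrN normfV.
  have nb : 1 <= n.+1%:R + B`_0 by rewrite ler_wpDr // ler1n.
  have d0 : 0 < n.+2%:R * (n.+1%:R + B`_0) :> C by rewrite mulr_gt0 // (lt_le_trans ltr01).
  rewrite (ger0_norm (ltW d0)) ler_pdivrMr //.
  have -> : (n.+2 - j = (n.+1 - j).+1)%N by rewrite subSn.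
  have -> : (n.+3 - j = (n.+1 - j).+2)%N by rewrite (subSn (ltnW jn)) (subSn (jn : (j <= n.+1)%N)).
  rewrite (le_trans (ler_normD _ _)) // (le_trans (lerD (ler_normD _ _) (lexx _))) //.
  have L (x : C) (m : nat) : (m <= n.+2 * n.+1)%N -> `|x| * m%:R <= `|x| * (n.+2%:R * (n.+1%:R + B`_0)).
    move=> mn; rewrite ler_wpM2l //.
    rewrite (@le_trans _ _ (n.+2 * n.+1)%:R) ?ler_nat // natrM ler_wpM2l ?ler0n // lerDl //.
  move: (n.+2%:R * _) d0 L => d d0 L.
  rewrite /c 2!mulrDl !normrM !normr_nat; apply: lerD; first apply: lerD.
  - apply: L; apply: leq_mul; first exact: ltnW.
    by case: (j) jn => // i; rewrite ltnS => /ltnW.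
  - by apply: L; rewrite (leq_trans (ltnW jn)) // leq_pmulr.
  - by have := L D`_(n.+1 - j) 1%N isT; rewrite mulr1.
pose M := W + 1; pose K : C := `|a 0%N| + `|a 1%N|.
have W0 : 0 <= W by apply: sumr_ge0.
have M1 : 1 <= M by rewrite lerDr.
have M0 : 0 < M by rewrite (lt_le_trans ltr01).
have K0 : 0 <= K by rewrite addr_ge0.
exists K, M; split=> //; elim/ltn_ind => -[|[|n]] IH.
- by rewrite expr0 mulr1 lerDl.
- by rewrite expr1 (@le_trans _ _ K) ?lerDr // ler_peMr.
rewrite aE (le_trans (ler_norm_sum _ _ _)) //.
apply: (@le_trans _ _ (\sum_(j < n.+2) c (n.+1 - j)%N * (K * M ^+ n.+1))).
  apply: ler_sum => j _; rewrite normrM ler_pM ?wc // (le_trans (IH j _)) //.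
  by rewrite ler_wpM2l // ler_weXn2l // -ltnS.
have -> : K * M ^+ n.+2 = M * (K * M ^+ n.+1) by rewrite [M ^+ n.+2]exprS mulrCA.
rewrite -mulr_suml ler_wpM2r ?mulr_ge0 ?exprn_ge0 ?(ltW M0) //.
have -> : \sum_(j < n.+2) c (n.+1 - j)%N = \sum_(j < n.+2) c j.
  rewrite (reindex_inj rev_ord_inj); apply: eq_bigr => j _; congr c.
  by rewrite /= subSS subKn // -ltnS; exact: ltn_ord.
by rewrite (le_trans (cW _)) // lerDl.
Qed.

(* Frobenius recurrence at a point with indicial roots [0] and [1 - B`_0]; for
   [B`_0 = 0] the coefficient [a1] stays free. *)
Lemma frobenius A B D (a0 a1 : C) : A`_0 = 0 -> A`_1 = 1 -> 0 <= B`_0 ->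
  B`_0 * a1 + D`_0 * a0 = 0 ->
  exists (r : R) (f f1 f2 f3 : C -> C), [/\ 0 < r, f 0 = a0, f1 0 = a1,
    forall X, `|X| < r%:C ->
      [/\ is_derive X 1 f (f1 X), is_derive X 1 f1 (f2 X),
          is_derive X 1 f2 (f3 X) & A.[X] * f2 X + B.[X] * f1 X + D.[X] * f X = 0] &
    [/\ forall i, A`_i \is Num.real, forall i, B`_i \is Num.real,
       forall i, D`_i \is Num.real & (a0 \is Num.real) && (a1 \is Num.real)] ->
     forall X, X \is Num.real -> `|X| < r%:C ->
       (f X \is Num.real) && (f1 X \is Num.real)].
Proof.
move=> A0 A1 B0 ind.
have [a [aE0 aE1 aE]] := recurrence_exists (frob_coef A B D) a0 a1.
have [K [M [K0 M0 aKM]]] := frobenius_bound B0 aE.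
have bd := geometric_bound_deriv K0 (ltW M0) aKM.
have M2 : 0 < 2 * M by rewrite mulr_gt0.
have bdd := geometric_bound_deriv (mulr_ge0 K0 (ltW M0)) (ltW M2) bd.
have bddd := geometric_bound_deriv (mulr_ge0 (mulr_ge0 K0 (ltW M0)) (ltW M2)) (ltW (mulr_gt0 (ltr0Sn _ 1) M2)) bdd.
(* Three differentiations bring the ratio to [8 M], whose inverse is also small enough to
   differentiate the second derivative termwise. *)
have rC : 0 < (2 * (2 * (2 * M)))^-1 by rewrite invr_gt0 !mulr_gt0.
have [r r0 rE] := real_complexE' rC.
(* Where a series diverges the value defaults to 0. The third derivative [f3] makes [f2]
   differentiable, which later allows a common factor [X] to be cancelled at 0. *)
pose f X : C := xget 0 (psums a X); pose f1 X : C := xget 0 (psums (deriv_seq a) X).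
pose f2 X : C := xget 0 (psums (deriv_seq (deriv_seq a)) X).
pose f3 X : C := xget 0 (psums (deriv_seq (deriv_seq (deriv_seq a))) X).
have small (L X : C) : 0 < L -> L <= 2 * (2 * (2 * M)) -> `|X| < r%:C -> L * `|X| < 1.
  move=> L0 LM; rewrite -rE => Xr.
  rewrite (@le_lt_trans _ _ (2 * (2 * (2 * M)) * `|X|)) ?ler_wpM2r //.
  by rewrite -ltr_pdivlMl ?mulr_gt0 // mulr1.
have M4 : 0 < 2 * (2 * M) by rewrite mulr_gt0.
have M8 : 0 < 2 * (2 * (2 * M)) by rewrite mulr_gt0.
have M48 : 2 * (2 * M) <= 2 * (2 * (2 * M)) by rewrite [leRHS]mulrC ler_peMr ?(ltW M4) // ler1n.
have M34 : 2 * M <= 2 * (2 * (2 * M)).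
  by rewrite (le_trans _ M48) // ler_peMl ?(ltW M2) // ler1n.
have M24 : M <= 2 * (2 * (2 * M)).
  by rewrite (le_trans _ M34) // ler_peMl ?(ltW M0) // ler1n.
have F X : `|X| < r%:C -> psums a X (f X).
  move=> Xr; have [s hs] := psums_exists K0 (ltW M0) aKM (small _ _ M0 M24 Xr).
  exact: (xgetPex (P := psums a X) 0 (ex_intro _ s hs)).
have F1 X : `|X| < r%:C -> psums (deriv_seq a) X (f1 X).
  move=> Xr; have [s hs] := psums_exists (mulr_ge0 K0 (ltW M0)) (ltW M2) bd (small _ _ M2 M34 Xr).
  exact: (xgetPex (P := psums _ X) 0 (ex_intro _ s hs)).
have F2 X : `|X| < r%:C -> psums (deriv_seq (deriv_seq a)) X (f2 X).
  move=> Xr.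
  have [s hs] := psums_exists (mulr_ge0 (mulr_ge0 K0 (ltW M0)) (ltW M2)) (ltW M4) bdd (small _ _ M4 M48 Xr).
  exact: (xgetPex (P := psums _ X) 0 (ex_intro _ s hs)).
have F3 X : `|X| < r%:C -> psums (deriv_seq (deriv_seq (deriv_seq a))) X (f3 X).
  move=> Xr.
  have [s hs] := psums_exists (mulr_ge0 (mulr_ge0 (mulr_ge0 K0 (ltW M0)) (ltW M2)) (ltW M4)) (ltW M8) bddd (small _ _ M8 (lexx _) Xr).
  exact: (xgetPex (P := psums _ X) 0 (ex_intro _ s hs)).
have r0C : `|0 : C| < r%:C by rewrite normr0 -rE.
have at0 (b : nat -> C) : psums b 0 (b 0%N).
  move=> e e0; exists 1%N => -[//|n] _.
  rewrite big_ord_recl expr0 mulr1 big1 ?addr0 ?subrr ?normr0 ?ltW // => i _.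
  by rewrite expr0n mulr0.
exists r, f, f1, f2, f3; split=> //.
- by rewrite (psums_unique (F 0 r0C) (at0 a)).
- by rewrite (psums_unique (F1 0 r0C) (at0 _)) /deriv_seq mul1r.
- move=> X Xr; split.
  + apply: (psums_is_derive K0 M0 aKM _ F F1 Xr).
    by rewrite -rE lef_pV2 ?posrE ?mulr_gt0 // ler_wpM2l.
  + apply: (psums_is_derive (mulr_ge0 K0 (ltW M0)) M2 bd _ F1 F2 Xr).
    by rewrite -rE lef_pV2 ?posrE ?mulr_gt0 // ler_wpM2l.
  + apply: (psums_is_derive (mulr_ge0 (mulr_ge0 K0 (ltW M0)) (ltW M2)) M4 bdd _ F2 F3 Xr).
    by rewrite -rE.
  have P := psumsD (psumsD (psums_poly A (F2 X Xr)) (psums_poly B (F1 X Xr))) (psums_poly D (F X Xr)).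
  apply: psums_unique P _; apply: eq_psums (psums0 X) => n /=.
  rewrite /poly_conv /deriv_seq; case: n => [|m] {F F1 F2}.
    by rewrite !big_ord1 A0 mul0r add0r aE0 aE1 mul1r ind.
  set m1 := m.+1; pose F j := A`_(m1.+2 - j) * (j * j.-1)%:R * a j.
  pose G j := B`_(m1.+1 - j) * j%:R * a j.
  have SF : \sum_(j < m1.+1) A`_(m1 - j) * (j.+1%:R * (j.+2%:R * a j.+2)) =
      \sum_(j < m1.+1) F j + m1.+1%:R * m1%:R * a m1.+1.
    (* The terms [j = 0, 1] vanish, so the index shift by two is free; the two top terms carry
       [A_0 = 0] and [A_1 = 1]. *)
    transitivity (\sum_(j < m1.+3) F j).
      have F0 : F 0%N = 0 by rewrite /F mul0n mulr0 mul0r.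
      have F1 : F 1%N = 0 by rewrite /F muln0 mulr0 mul0r.
      rewrite [RHS]big_ord_recl F0 add0r [RHS]big_ord_recl F1 add0r.
      apply: eq_bigr => j _; rewrite /F /bump /= ?add1n !subSS natrM.
      by move: (j.+1%:R) (j.+2%:R) (a _) (A`_ _) => u v w z; ring.
    by rewrite 2!big_ord_recr /= {2 3}/F subnn A0 !mul0r addr0 subSnn A1 mul1r natrM.
  have SG : \sum_(j < m1.+1) B`_(m1 - j) * (j.+1%:R * a j.+1) =
      \sum_(j < m1.+1) G j + B`_0 * m1.+1%:R * a m1.+1.
    transitivity (\sum_(j < m1.+2) G j).
      rewrite [RHS]big_ord_recl [in RHS]/G /= mulr0 mul0r add0r.
      by apply: eq_bigr => j _; rewrite /bump /= ?add1n subSS mulrA.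
    by rewrite big_ord_recr /= {2}/G subnn.
  rewrite SF SG [a m1.+1]aE.
  have nz : m1.+1%:R * (m1%:R + B`_0) != 0 :> C.
    by rewrite mulf_neq0 ?pnatr_eq0 // gt_eqF // ltr_wpDr // ltr0n.
  have -> : \sum_(j < m.+2) frob_coef A B D m.+1 j * a j =
      - (\sum_(j < m1.+1) F j + \sum_(j < m1.+1) G j + \sum_(j < m1.+1) D`_(m1 - j) * a j)
        / (m1.+1%:R * (m1%:R + B`_0)).
    rewrite -!big_split /= -sumrN mulr_suml; apply: eq_bigr => j _.
    rewrite /frob_coef /F /G -/m1; move: (_^-1) (A`_ _) (B`_ _) (D`_ _) => u v w z.
    by move: ((j * j.-1)%:R) (j%:R) => p q; ring.
  move: (\sum_(j < m1.+1) F j) (\sum_(j < m1.+1) G j) (\sum_(j < m1.+1) D`_(m1 - j) * a j) => u v w.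
  move: nz; move: (m1.+1%:R) (m1%:R) (B`_0) => p q b nz.
  by field; rewrite mulf_eq0 negb_or in nz; case/andP: nz => -> ->.
move=> [rA rB rD /andP[ra0 ra1]].
have ra n : a n \is Num.real.
  elim/ltn_ind: n => -[|[|n]] IH; rewrite ?aE0 ?aE1 // aE.
  apply: rpred_sum => j _; apply: rpredM; last by apply: IH; exact: ltn_ord.
  by rewrite /frob_coef rpredM ?rpredV ?rpredN ?rpredD ?rpredM ?rpred_nat // ?rpredD ?rpred_nat.
have realsum (b : nat -> C) X s : (forall n, b n \is Num.real) -> X \is Num.real ->
    psums b X s -> s \is Num.real.
  (* The conjugate of the sum is a limit of the same real partial sums, hence equals it. *)
  move=> rb rX hs; rewrite CrealE; apply/eqP; apply: psums_unique (hs) => e e0.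
  have [N H] := hs e e0; exists N => n /H.
  rewrite -norm_conjC rmorphB /= (CrealP _) //.
  by apply: rpred_sum => i _; rewrite rpredM // rpredX.
have rd (b : nat -> C) : (forall n, b n \is Num.real) -> forall n, deriv_seq b n \is Num.real.
  by move=> rb n; rewrite rpredM // rpred_nat.
move=> X rX Xr; apply/andP; split.
  exact: realsum ra rX (F X Xr).
exact: realsum (rd _ ra) rX (F1 X Xr).
Qed.

End Frobenius.

(** * The differential system *)

Section Derivation_rules.
Variable K : numFieldType.
Implicit Types (f g : K -> K) (z a b : K).

(** These rules are stated for explicit functions and with [*] in place of scaling, so that a
    derivative is assembled as a term and then compared by [ring] or [field]. *)
Lemma is_derD f g z a b : is_derive z 1 f a -> is_derive z 1 g b ->
  is_derive z 1 (fun w => f w + g w) (a + b).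
Proof. by move=> Hf Hg; exact: is_deriveD. Qed.

Lemma is_derN f z a : is_derive z 1 f a -> is_derive z 1 (fun w => - f w) (- a).
Proof. by move=> Hf; exact: is_deriveN. Qed.

Lemma is_derB f g z a b : is_derive z 1 f a -> is_derive z 1 g b ->
  is_derive z 1 (fun w => f w - g w) (a - b).
Proof. by move=> Hf Hg; exact: is_deriveB. Qed.

Lemma is_derM f g z a b : is_derive z 1 f a -> is_derive z 1 g b ->
  is_derive z 1 (fun w => f w * g w) (f z * b + g z * a).
Proof. by move=> Hf Hg; exact: is_deriveM. Qed.

Lemma is_derZ k f z a : is_derive z 1 f a -> is_derive z 1 (fun w => k * f w) (k * a).
Proof. by move=> Hf; exact: is_deriveZ. Qed.

Lemma is_derX n f z a : is_derive z 1 f a ->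
  is_derive z 1 (fun w => f w ^+ n.+1) (n.+1%:R * f z ^+ n * a).
Proof.
move=> Hf; elim: n => [|n IH].
  by rewrite expr0 mulr1 mul1r; under eq_fun do rewrite expr1.
rewrite (_ : (fun w => _) = (fun w => f w * f w ^+ n.+1)); last by apply/funext => w; rewrite exprS.
by apply: is_derive_eq (is_derM Hf IH) _; rewrite -[n.+2%:R]natr1 exprS; ring.
Qed.

Lemma is_derV f z a : f z != 0 -> is_derive z 1 f a ->
  is_derive z 1 (fun w => (f w)^-1) (- a / f z ^+ 2).
Proof.
move=> fz [Hf <-]; apply: DeriveDef; first exact: derivableV.
by rewrite deriveV // /GRing.scale /= !mulNr mulrC.
Qed.

Lemma is_der_cst (k z : K) : is_derive z 1 (fun _ : K => k) 0.
Proof. exact: is_derive_cst. Qed.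

Lemma is_der_id (z : K) : is_derive z 1 (fun w : K => w) 1.
Proof. exact: is_derive_id. Qed.

Lemma is_der_shift f z0 z a : is_derive (z - z0) 1 f a ->
  is_derive z 1 (fun w => f (w - z0)) a.
Proof.
move=> Hf; rewrite -[a]mulr1; apply: (is_derive_comp1 (f := f) (g := fun w => w - z0)) => //.
by apply: is_derive_eq (is_derB (is_der_id z) (is_der_cst z0 z)) _; rewrite subr0.
Qed.

Lemma is_der_near f g z a : (\forall w \near z, f w = g w) ->
  is_derive z 1 f a -> is_derive z 1 g a.
Proof. exact: near_eq_is_derive. Qed.

Lemma is_der_unique f z a b : is_derive z 1 f a -> is_derive z 1 f b -> a = b.
Proof. by case=> _ <- [_ <-]. Qed.

Lemma is_der_cont f z a : is_derive z 1 f a ->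
  forall e, 0 < e -> \forall w \near z, `|f w - f z| < e.
Proof.
case=> df _ e e0.
have /derivable1_diffP/differentiable_continuous/cvgrPdist_lt/(_ e e0) := df.
by apply: filterS => w; rewrite distrC.
Qed.

Lemma is_der_neq0 f z a : is_derive z 1 f a -> f z != 0 ->
  \forall w \near z, f w != 0.
Proof.
move=> df fz; have := is_der_cont df (e := `|f z|); rewrite normr_gt0 => /(_ fz).
by apply: filterS => w; apply: contraTneq => ->; rewrite sub0r normrN ltxx.
Qed.

(** At 0 the derivative of [X * u X] is [u 0], and this product vanishes identically on the disc. *)
Lemma mulX_eq0_near (u : K -> K) u' (r : K) : 0 < r ->
  (forall X, `|X| < r -> X * u X = 0) -> is_derive (0 : K) 1 u u' ->
  forall X, `|X| < r -> u X = 0.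
Proof.
move=> r0 H du X Xr; have [X0|X0] := eqVneq X 0; last first.
  by have /eqP := H X Xr; rewrite mulf_eq0 (negPf X0) => /eqP.
have D := is_derM (is_der_id 0) du.
have D' : is_derive (0 : K) 1 (fun w : K => w * u w) 0.
  apply: is_der_near (is_der_cst 0 0); apply/near_normP; exists r => // w.
  by rewrite subr0 => /H ->.
by have := is_der_unique D D'; rewrite mul0r add0r mulr1 X0.
Qed.

End Derivation_rules.

Section Lame_system.
Variable R : realType.
Local Notation C := (Cplx R).
Local Notation "x %:C" := (complex.real_complex R x : C).

Implicit Types z w : C.

(** The data for [alpha = 1]: the monic cubic with roots [e_i], its derivative, and
    [l (l + 1) z + B] with [l = 1/6], [B = -1/9]. *)
Definition Ef (z : C) : C := z ^+ 3 - 20 / 3 * z + 20 / 3.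
Definition dEf (z : C) : C := 3 * z ^+ 2 - 20 / 3.
Definition Qf (z : C) : C := 7 / 36 * z - 1 / 9.

(* First-order form of [L y = 0] for the roots [e_i] of [Ef], with [v = Ef y']. *)
Definition sys (f v : C -> C) (z : C) : Prop :=
  is_derive z 1 f (v z / Ef z) /\
  is_derive z 1 v (dEf z / (2 * Ef z) * v z + Qf z / 4 * f z).

Lemma is_derive_Ef (z : C) : is_derive z 1 Ef (dEf z).
Proof.
have H := is_derD (is_derB (is_derX 2 (is_der_id z)) (is_derZ (20 / 3) (is_der_id z))) (is_der_cst (20/3) z).
by apply: is_derive_eq H _; rewrite /dEf /=; ring.
Qed.

Lemma sys_linear (a b : C) f v f' v' z : sys f v z -> sys f' v' z ->
  sys (fun w => a * f w + b * f' w) (fun w => a * v w + b * v' w) z.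
Proof.
move=> [H1 H2] [H1' H2']; split.
  by apply: is_derive_eq (is_derD (is_derZ a H1) (is_derZ b H1')) _; ring.
by apply: is_derive_eq (is_derD (is_derZ a H2) (is_derZ b H2')) _; ring.
Qed.

(* Fundamental matrices have determinant proportional to a square root of [Ef]. *)
Lemma sys_wronskian f1 v1 f2 v2 (x0 r : C) :
  (forall z, `|z - x0| < r -> [/\ Ef z != 0, sys f1 v1 z & sys f2 v2 z]) ->
  f1 x0 * v2 x0 - f2 x0 * v1 x0 != 0 ->
  forall z, `|z - x0| < r -> f1 z * v2 z - f2 z * v1 z != 0.
Proof.
move=> H h0 z zr.
have r0 : 0 < r by apply: le_lt_trans zr.
pose u z := (f1 z * v2 z - f2 z * v1 z) ^+ 2 / Ef z.
have du w : `|w - x0| < r -> is_derive w 1 u 0.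
  move=> wr; have [Ew [A1 A2] [B1 B2]] := H w wr.
  have D := is_derM (is_derX 1 (is_derB (is_derM A1 B2) (is_derM B1 A2))) (is_derV (f := Ef) Ew (is_derive_Ef w)).
  by apply: is_derive_eq D _; field.
have := deriv0_const du zr; rewrite /u.
have [Ez _ _] := H z zr; have [E0 _ _] := H x0 ltac:(by rewrite subrr normr0).
move=> E; apply: contra_neq h0 => h; move: E; rewrite h expr0n mul0r => /esym/eqP.
by rewrite mulf_eq0 invr_eq0 (negPf E0) orbF expf_eq0 /= => /eqP.
Qed.

(** The coefficients given by Cramer's rule have zero derivative, hence are constant on the disc. *)
Lemma sys_local_rep f1 v1 f2 v2 f v (x0 r : C) :
  (forall z, `|z - x0| < r -> [/\ Ef z != 0, sys f1 v1 z, sys f2 v2 z, sys f v z &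
     f1 z * v2 z - f2 z * v1 z != 0]) ->
  exists a b, forall z, `|z - x0| < r ->
    f z = a * f1 z + b * f2 z /\ v z = a * v1 z + b * v2 z.
Proof.
move=> H.
pose d z := f1 z * v2 z - f2 z * v1 z.
pose a z := (f z * v2 z - v z * f2 z) / d z.
pose b z := (f1 z * v z - v1 z * f z) / d z.
exists (a x0), (b x0) => z zr.
have D w : `|w - x0| < r -> is_derive w 1 a 0 /\ is_derive w 1 b 0.
  move=> wr; have [Ew [A1 A2] [B1 B2] [F1 F2] dw] := H w wr.
  have dd := is_derV (f := d) dw (is_derB (is_derM A1 B2) (is_derM B1 A2)).
  split.
    by apply: is_derive_eq (is_derM (is_derB (is_derM F1 B2) (is_derM F2 B1)) dd) _; rewrite /d; field; rewrite dw Ew.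
  by apply: is_derive_eq (is_derM (is_derB (is_derM A1 F2) (is_derM A2 F1)) dd) _; rewrite /d; field; rewrite dw Ew.
have <- := deriv0_const (fun w wr => (D w wr).1) zr.
have <- := deriv0_const (fun w wr => (D w wr).2) zr.
have [_ _ _ _ dz] := H z zr.
by rewrite /a /b /d; split; field.
Qed.

(** The equation at an ordinary point is multiplied by [X], which puts it in the form required by
    [frobenius] with [B_0 = D_0 = 0]. Both initial coefficients are then free, and the factor [X] is
    cancelled afterwards. *)
Lemma sys_fundamental (x0 : C) : Ef x0 != 0 -> exists (r : R) f1 v1 f2 v2, 0 < r /\
  forall z, `|z - x0| < r%:C -> [/\ Ef z != 0, sys f1 v1 z, sys f2 v2 z &
     f1 z * v2 z - f2 z * v1 z != 0].
Proof.
move=> E0.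
(* Taylor expansions of [Ef], [dEf] and [Qf] at [x0]. *)
pose pE : {poly C} := 'X^3 + (3 * x0)%:P * 'X^2 + (dEf x0)%:P * 'X + (Ef x0)%:P.
pose pdE : {poly C} := 3%:P * 'X^2 + (6 * x0)%:P * 'X + (dEf x0)%:P.
pose pQ : {poly C} := (7 / 36)%:P * 'X + (Qf x0)%:P.
pose A : {poly C} := (Ef x0)^-1%:P * pE * 'X; pose B : {poly C} := (2 * Ef x0)^-1%:P * pdE * 'X.
pose D : {poly C} := (- (4 * Ef x0)^-1)%:P * pQ * 'X.
have pEE X : pE.[X] = Ef (x0 + X) by rewrite /pE !hornerE /Ef /dEf /=; ring.
have pdEE X : pdE.[X] = dEf (x0 + X) by rewrite /pdE !hornerE /dEf /=; ring.
have pQE X : pQ.[X] = Qf (x0 + X) by rewrite /pQ !hornerE /Qf /=; ring.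
have A0 : A`_0 = 0 by rewrite coefMX.
have A1 : A`_1 = 1.
  by rewrite coefMX /= coefCM -horner_coef0 pEE addr0 mulVf.
have B0 : B`_0 = 0 by rewrite coefMX.
have D0 : D`_0 = 0 by rewrite coefMX.
have AE X : A.[X] = (Ef x0)^-1 * Ef (x0 + X) * X.
  by rewrite /A !hornerM hornerC hornerX pEE.
have BE X : B.[X] = (2 * Ef x0)^-1 * dEf (x0 + X) * X.
  by rewrite /B !hornerM hornerC hornerX pdEE.
have DE X : D.[X] = - (4 * Ef x0)^-1 * Qf (x0 + X) * X.
  by rewrite /D !hornerM hornerC hornerX pQE.
clearbody A B D pE pdE pQ.
have Bge : 0 <= B`_0 by rewrite B0.
have sol (a0 a1 : C) : exists (r : R) f v, [/\ 0 < r, f x0 = a0, v x0 = Ef x0 * a1 &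
    forall z, `|z - x0| < r%:C -> Ef z != 0 -> sys f v z].
  have ind : B`_0 * a1 + D`_0 * a0 = 0 by rewrite B0 D0 !mul0r addr0.
  have [r [f [f1 [f2 [f3 [r0 fa fb H _]]]]]] := frobenius A0 A1 Bge ind.
  have ode z : `|z - x0| < r%:C -> Ef z * f2 (z - x0) + dEf z / 2 * f1 (z - x0) - Qf z / 4 * f (z - x0) = 0.
    move=> zr.
    have r0C : 0 < r%:C by rewrite -[0]/(0%:C) complex.ltcR.
    have [d1 d2 d3 _] := H 0 ltac:(by rewrite normr0).
    have dP (p : {poly C}) : exists d, is_derive (0 : C) 1 (fun X => p.[X]) d.
      elim/poly_ind: p => [|p c [d Hd]].
        by exists 0; under eq_fun do rewrite horner0; exact: is_der_cst.
      eexists; under eq_fun do rewrite hornerMXaddC.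
      exact: is_derD (is_derM Hd (is_der_id 0)) (is_der_cst c 0).
    have [e1 D1] := dP pE; have [e2 D2] := dP pdE; have [e3 D3] := dP pQ.
    have du := is_derB (is_derD (is_derM D1 d3) (is_derM (is_derZ 2^-1 D2) d2)) (is_derM (is_derZ 4^-1 D3) d1).
    have := mulX_eq0_near (K := C) (r := r%:C) r0C _ du zr; rewrite pEE pdEE pQE.
    rewrite (addrC x0) subrK (mulrC 2^-1 (dEf z)) (mulrC 4^-1 (Qf z)); apply => X Xr.
    have [_ _ _] := H X Xr; rewrite AE BE DE pEE pdEE pQE => /(congr1 ( *%R (Ef x0))).
    rewrite mulr0 => E; rewrite -[RHS]E; move: (f2 X) (f1 X) (f X) => p q s; move: E0; move: (Ef x0) (Ef (x0 + X)) (dEf (x0 + X)) (Qf (x0 + X)) => c u v w c0.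
    by field.
  exists r, (fun z => f (z - x0)), (fun z => Ef z * f1 (z - x0)); split.
  - exact: r0.
  - by rewrite subrr.
  - by rewrite subrr fb.
  move=> z zr Ez; have [d1 d2 _ _] := H _ zr; split.
    by rewrite (mulrC (Ef z)) mulfK //; exact: is_der_shift d1.
  apply: is_derive_eq (is_derM (is_derive_Ef z) (is_der_shift d2)) _.
  have /eqP := ode z zr; rewrite subr_eq0 => /eqP <-.
  by field.
have [r1 [f1 [v1 [r10 f10 v10 H1]]]] := sol 1 0.
have [r2 [f2 [v2 [r20 f20 v20 H2]]]] := sol 0 1.
have /near_normP[r3' r30' H3] := is_der_neq0 (is_derive_Ef x0) E0.
have [r3 r30 r3E] := real_complexE' r30'.
have [r [r0 l1 l2 l3]] : exists r, [/\ 0 < r, r <= r1, r <= r2 & r <= r3].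
  have [c c0 /andP[ca cb]] := minor2 r10 r20; have [c' c'0 /andP[ca' cb']] := minor2 c0 r30.
  by exists c'; split=> //; apply: (le_trans ca').
have K z : `|z - x0| < r%:C -> [/\ Ef z != 0, sys f1 v1 z & sys f2 v2 z].
  move=> zr; have Ez : Ef z != 0 by apply: H3; rewrite r3E (lt_le_trans zr) // complex.lecR.
  by split=> //; [apply: H1 | apply: H2]=> //; rewrite (lt_le_trans zr) // complex.lecR.
exists r, f1, v1, f2, v2; split=> // z zr.
have [Ez S1 S2] := K z zr; split=> //.
apply: (sys_wronskian K) zr.
by rewrite f10 v10 f20 v20 mul1r mulr1 mul0r subr0.
Qed.

(* Rows are solutions, columns are [y] and [v]. *)
Definition msys (F : C -> 'M[C]_2) z : Prop :=
  forall j, sys (fun w => F w j 0) (fun w => F w j 1) z.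

Lemma mul2E (N F : 'M[C]_2) i k : (N *m F) i k = N i 0 * F 0 k + N i 1 * F 1 k.
Proof.
rewrite mxE !big_ord_recl big_ord0 addr0; congr (_ + N i _ * F _ k); exact: val_inj.
Qed.

Lemma det2E (F : 'M[C]_2) : \det F = F 0 0 * F 1 1 - F 0 1 * F 1 0.
Proof.
rewrite (expand_det_row _ 0) !big_ord_recl big_ord0 addr0 /cofactor !det_mx11 !mxE /=.
rewrite expr0 mul1r expr1 mulN1r mulrN.
by congr (F _ _ * F _ _ - F _ _ * F _ _); exact: val_inj.
Qed.

Lemma invmx_mul2 (A B : 'M[C]_2) : A \in unitmx -> B \in unitmx ->
  invmx (A *m B) = invmx B *m invmx A.
Proof.
move=> uA uB; have uAB : A *m B \in unitmx by rewrite unitmx_mul uA.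
rewrite -[RHS]mul1mx -(mulVmx uAB) -!mulmxA (mulmxA B) mulmxV // mul1mx mulmxV //.
by rewrite mulmx1.
Qed.

Lemma eq_mx2 (F G : 'M[C]_2) : (forall j, F j 0 = G j 0 /\ F j 1 = G j 1) -> F = G.
Proof.
move=> H; apply/matrixP => i j; have [h0 h1] := H i.
case: (unliftP 0 j) => [k ->|->//]; rewrite (_ : lift 0 k = 1) //.
by apply: val_inj; rewrite [k]ord1.
Qed.

Lemma msys_mul (N : 'M[C]_2) F z : msys F z -> msys (fun w => N *m F w) z.
Proof.
move=> HF j; have := sys_linear (N j 0) (N j 1) (HF 0) (HF 1).
by under eq_fun do rewrite -mul2E; under [X in sys _ X]eq_fun do rewrite -mul2E.
Qed.

Lemma msys_disc x0 : Ef x0 != 0 -> exists (r : R) (F : C -> 'M[C]_2), 0 < r /\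
  forall z, `|z - x0| < r%:C -> [/\ Ef z != 0, F z \in unitmx & msys F z].
Proof.
move=> /sys_fundamental[r [f1 [v1 [f2 [v2 [r0 H]]]]]].
exists r, (fun z => \matrix_(i, j) if i == 0 then (if j == 0 then f1 z else v1 z)
   else (if j == 0 then f2 z else v2 z)); split=> // z /H[Ez S1 S2 d]; split=> //.
  by rewrite unitmxE unitfE det2E !mxE /= [v1 z * _]mulrC.
move=> j; under eq_fun do rewrite mxE /=; under [X in sys _ X]eq_fun do rewrite mxE /=.
by case: (j == 0).
Qed.

Lemma msys_rep (F G : C -> 'M[C]_2) (x0 r : C) :
  (forall z, `|z - x0| < r -> [/\ Ef z != 0, F z \in unitmx, msys F z & msys G z]) ->
  exists N, forall z, `|z - x0| < r -> G z = N *m F z.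
Proof.
move=> H.
have K j : exists a b, forall z, `|z - x0| < r ->
    G z j 0 = a * F z 0 0 + b * F z 1 0 /\ G z j 1 = a * F z 0 1 + b * F z 1 1.
  apply: (sys_local_rep (f1 := fun z => F z 0 0) (v1 := fun z => F z 0 1)
   (f2 := fun z => F z 1 0) (v2 := fun z => F z 1 1) (f := fun z => G z j 0) (v := fun z => G z j 1)).
  move=> z /H[Ez U SF SG]; split=> //.
  by move: U; rewrite unitmxE unitfE det2E [F z 0 1 * _]mulrC.
have [a0 [b0 H0]] := K 0; have [a1 [b1 H1]] := K 1.
exists (\matrix_(i, j) if i == 0 then (if j == 0 then a0 else b0)
   else (if j == 0 then a1 else b1)) => z zr.
apply: eq_mx2 => j; rewrite !mul2E !mxE /=.
case: (unliftP 0 j) => [k ->|->]; last exact: H0.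
rewrite (_ : lift 0 k = 1); first exact: H1.
by apply: val_inj; rewrite [k]ord1.
Qed.

Lemma msys_near_rep (F G : C -> 'M[C]_2) x0 : Ef x0 != 0 -> F x0 \in unitmx ->
  (\forall z \near x0, msys F z) -> (\forall z \near x0, msys G z) ->
  \forall z \near x0, G z = G x0 *m invmx (F x0) *m F z.
Proof.
move=> E0 U0 nF nG.
(* [F] is known to be invertible only at [x0], so [F] and [G] are both compared with a [W] that is
   invertible on a whole disc. *)
have [r0 [W [r00 HW]]] := msys_disc E0.
have r0C : 0 < r0%:C by rewrite -[0]/(0%:C) complex.ltcR.
have /near_normP[r r_gt0 H] : \forall z \near x0, [/\ Ef z != 0, W z \in unitmx, msys W z, msys F z & msys G z].
  near=> z.
  have zr : `|z - x0| < r0%:C by near: z; apply/near_normP; exists r0%:C.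
  have [? ? ?] := HW z zr; split=> //; near: z; [exact: nF | exact: nG].
have [NF HF] := msys_rep (fun z zr => let: And5 a b c d _ := H z zr in And4 a b c d).
have [NG HG] := msys_rep (fun z zr => let: And5 a b c _ d := H z zr in And4 a b c d).
apply/near_normP; exists r => // z zr.
have x0r : `|x0 - x0| < r by rewrite subrr normr0.
have [_ UW _ _ _] := H x0 x0r.
have UN : NF \in unitmx by move: U0; rewrite (HF x0 x0r) unitmx_mul => /andP[].
rewrite (HG z zr) (HG x0 x0r) (HF x0 x0r) (HF z zr).
rewrite invmx_mul2 // -!mulmxA (mulmxA (W x0)) mulmxV // mul1mx (mulmxA (invmx NF)) mulVmx //.
by rewrite mul1mx.
Unshelve. all: by end_near. Qed.

End Lame_system.

(** * Continuation along paths *)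

Section Transport.
Variable R : realType.
Local Notation C := (Cplx R).
Local Notation "x %:C" := (complex.real_complex R x : C).
Local Notation M2 := 'M[C]_2.
Implicit Types (a b c t s : R) (g : R -> C) (P : R -> M2).

Definition path_on a b g : Prop := forall t, a <= t <= b -> Ef (g t) != 0 /\
  forall e : C, 0 < e -> \forall s \near t, a <= s <= b -> `|g s - g t| < e.

(** [P t] is only the value at [g t] of the continued matrix; the germ [F] is existentially
    quantified, being determined by this value. *)
Definition arc a b g P : Prop := path_on a b g /\ forall t, a <= t <= b ->
  exists F, (\forall z \near g t, msys F z) /\
    \forall s \near t, a <= s <= b -> P s = F (g s).

Lemma path_near a b g t (A : C -> Prop) : path_on a b g -> a <= t <= b ->
  (\forall z \near g t, A z) -> \forall s \near t, a <= s <= b -> A (g s).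
Proof.
move=> pg tI /near_normP[r r0 H]; have [_ /(_ r r0)] := pg t tI.
by apply: filterS => s + sI => /(_ sI) /H.
Qed.

Lemma arc_local a b g P t W : arc a b g P -> a <= t <= b ->
  (\forall z \near g t, msys W z) -> W (g t) \in unitmx ->
  \forall s \near t, a <= s <= b -> P s = P t *m invmx (W (g t)) *m W (g s).
Proof.
move=> [pg aP] tI nW uW; have [F [nF HF]] := aP t tI; have [Et _] := pg t tI.
have -> : P t = F (g t) by exact: (nbhs_singleton HF).
have := path_near pg tI (msys_near_rep Et uW nW nF).
by apply: filterS2 HF => s H1 H2 sI; rewrite H1 // H2.
Qed.

Lemma path_sub a b a' b' g : a' <= a -> b <= b' -> path_on a' b' g -> path_on a b g.
Proof.
move=> aa bb pg t /andP[ta tb].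
have [E H] := pg t ltac:(by rewrite (le_trans aa) // (le_trans tb)).
split=> // e e0; have := H e e0; apply: filterS => s + /andP[sa sb]; apply.
by rewrite (le_trans aa) // (le_trans sb).
Qed.

Lemma arc_sub a b a' b' g P : a' <= a -> b <= b' -> arc a' b' g P -> arc a b g P.
Proof.
move=> aa bb [pg aP]; split; first exact: path_sub pg.
move=> t /andP[ta tb].
have [F [nF HF]] := aP t ltac:(by rewrite (le_trans aa) // (le_trans tb)).
exists F; split=> //; apply: filterS HF => s + /andP[sa sb]; apply.
by rewrite (le_trans aa) // (le_trans sb).
Qed.

Lemma arc_mul N a b g P : arc a b g P -> arc a b g (fun t => N *m P t).
Proof.
move=> [pg aP]; split=> // t /aP[F [nF HF]]; exists (fun z => N *m F z); split.
  by apply: filterS nF => z /(msys_mul N).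
by apply: filterS HF => s H /H ->.
Qed.

Lemma near_ltR t b : t < b -> \forall s \near t, s < b.
Proof. by move=> tb; apply: lt_nbhsl. Qed.

Lemma near_gtR t a : a < t -> \forall s \near t, a < s.
Proof. by move=> ta; apply: lt_nbhsr. Qed.

Lemma path_glue a b c g g' : path_on a b g -> path_on b c g' -> g b = g' b ->
  path_on a c (fun t => if t <= b then g t else g' t).
Proof.
move=> pg pg' gg t /andP[ta tc].
have [tb|bt|tb] := ltgtP t b.
- have [E H] := pg t ltac:(by rewrite ta ltW); split=> // e /H.
  apply: filterS2 (near_ltR tb) => s sb + /andP[sa _].
  by rewrite (ltW sb) sa; apply.
- have [E H] := pg' t ltac:(by rewrite (ltW bt)); split=> // e /H.
  apply: filterS2 (near_gtR bt) => s bs + /andP[_ sc].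
  by rewrite [s <= b]leNgt bs (ltW bs) sc; apply.
subst t; have [E H] := pg b ltac:(by rewrite ta lexx).
have [E' H'] := pg' b ltac:(by rewrite tc lexx).
split=> // e e0; apply: filterS2 (H e e0) (H' e e0) => s H1 H2 /andP[sa sc].
by have [sb|bs] := leP s b; [apply: H1; rewrite sa | rewrite gg; apply: H2; rewrite sc ltW].
Qed.

Lemma arc_glue a b c g g' P P' : arc a b g P -> arc b c g' P' -> a <= b <= c -> g b = g' b ->
  P b = P' b ->
  arc a c (fun t => if t <= b then g t else g' t) (fun t => if t <= b then P t else P' t).
Proof.
move=> [pg aP] [pg' aP'] /andP[ab bc] gg PP; split; first exact: path_glue.
move=> t /andP[ta tc]; have [tb|bt|tb] := ltgtP t b.
- have [F [nF HF]] := aP t ltac:(by rewrite ta ltW); exists F; split=> //.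
  apply: filterS2 (near_ltR tb) HF => s sb + /andP[sa _].
  by rewrite (ltW sb) sa; apply.
- have [F [nF HF]] := aP' t ltac:(by rewrite (ltW bt)); exists F; split=> //.
  apply: filterS2 (near_gtR bt) HF => s bs + /andP[_ sc].
  by rewrite [s <= b]leNgt bs (ltW bs) sc; apply.
(* At the junction the germs supplied by the two arcs are a priori different functions. Both are
   rewritten as the same constant multiple of a fundamental matrix [W]. *)
subst t; have bI : a <= b <= b by rewrite ab lexx.
have bI' : b <= b <= c by rewrite bc lexx.
have [F [nF HF]] := aP b bI; have [F' [nF' HF']] := aP' b bI'.
have [Eb _] := pg b bI.
have [r [W [r0 HW]]] := msys_disc Eb.
have r0C : 0 < r%:C by rewrite -[0]/(0%:C) complex.ltcR.
have nW : \forall z \near g b, msys W z.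
  by apply/near_normP; exists r%:C => // z /HW[].
have [_ uW _] := HW (g b) ltac:(by rewrite subrr normr0).
have nW' : \forall z \near g' b, msys W z by rewrite -gg.
have L := arc_local (conj pg aP) bI nW uW.
have L' := arc_local (conj pg' aP') bI' nW' ltac:(by rewrite -gg).
exists (fun z => P b *m invmx (W (g b)) *m W z); split.
  by apply: filterS nW => z /(msys_mul (P b *m invmx (W (g b)))).
apply: filterS2 L L' => s H1 H2 /andP[sa sc].
have [sb|bs] := leP s b; first by apply: H1; rewrite sa.
by rewrite (H2 ltac:(by rewrite (ltW bs) sc)) PP gg.
Qed.

Lemma near_affine (k l t : R) (A : R -> Prop) : (\forall s \near k * t + l, A s) ->
  \forall s \near t, A (k * s + l).
Proof.
move=> /near_normP[r r0 H].
have k1 : 0 < `|k| + 1 by rewrite ltr_wpDl.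
apply/near_normP; exists (r / (`|k| + 1)); first by rewrite divr_gt0.
move=> s; rewrite ltr_pdivlMr // => st; apply: H.
rewrite (_ : _ - _ = k * (s - t)); last by ring.
by rewrite normrM (le_lt_trans _ st) // mulrC ler_wpM2l // lerDl.
Qed.

Lemma arc_affine (k l : R) a b a' b' g P : arc a b g P ->
  (forall t, a' <= t <= b' -> a <= k * t + l <= b) ->
  arc a' b' (fun t => g (k * t + l)) (fun t => P (k * t + l)).
Proof.
move=> [pg aP] H; split.
  move=> t tI; have [E Hc] := pg _ (H t tI); split=> // e /Hc/near_affine.
  by apply: filterS => s + /H.
move=> t tI; have [F [nF HF]] := aP _ (H t tI); exists F; split=> //.
by have := near_affine HF; apply: filterS => s + /H.
Qed.

(** Near [t] both arcs are constant multiples of one fundamental matrix [W]; as [W] is invertible at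
    [g t] and [g s], equality at [t] and equality at [s] are equivalent. *)
Lemma arc_unique a b g P Q : a <= b -> arc a b g P -> arc a b g Q -> P a = Q a ->
  forall t, a <= t <= b -> P t = Q t.
Proof.
move=> ab aP aQ PQ.
have [ba|] := ltP a b; last first.
  move=> ba t /andP[ta tb]; suff -> : t = a by [].
  by apply/eqP; rewrite eq_le ta (le_trans tb).
pose k := b - a; have k0 : 0 < k by rewrite subr_gt0.
have H t : 0 <= t <= 1 -> a <= k * t + a <= b.
  move=> /andP[t0 t1]; rewrite lerDr mulr_ge0 ?(ltW k0) //= -lerBrDr.
  by rewrite -[leRHS]mulr1 ler_wpM2l // ltW.
have {aP}aP := arc_affine aP H; have {aQ}aQ := arc_affine aQ H.
suff K t : t \in `[0, 1]%R -> P (k * t + a) = Q (k * t + a).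
  move=> t /andP[ta tb]; have := K ((t - a) / k).
  rewrite mulrCA mulfV ?gt_eqF // mulr1 subrK; apply.
  by rewrite in_itv /= divr_ge0 ?subr_ge0 ?(ltW k0) //= ler_pdivrMr // mul1r lerD2r.
apply: (locally_constant01 (P := fun t => P (k * t + a) = Q (k * t + a))); last first.
  by rewrite mulr0 add0r.
move=> {}t; rewrite in_itv /= => tI.
have [pg _] := aP; have [Et _] := pg t tI.
have [r [W [r0 HW]]] := msys_disc Et.
have r0C : 0 < r%:C by rewrite -[0]/(0%:C) complex.ltcR.
have nW : \forall z \near g (k * t + a), msys W z by apply/near_normP; exists r%:C => // z /HW[].
have [_ uW _] := HW (g (k * t + a)) ltac:(by rewrite subrr normr0).
have nU : \forall z \near g (k * t + a), W z \in unitmx by apply/near_normP; exists r%:C => // z /HW[].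
apply: filterS3 (path_near pg tI nU) (arc_local aP tI nW uW) (arc_local aQ tI nW uW).
move=> s Hu H1 H2; rewrite in_itv /= => sI.
have {}Hu := Hu sI; rewrite (H1 sI) (H2 sI); split=> [|-> //].
move=> /(congr1 (fun X => X *m invmx (W (g (k * s + a))) *m W (g (k * t + a)))).
by rewrite !(mulmxK Hu) !(mulmxKV uW).
Qed.

(** Induction on the unit interval for the property that a continuation exists up to time [t]. The
    system is linear, so a local fundamental matrix carries any value across its whole disc. *)
Lemma arc_exists g (P0 : M2) : path_on 0 1 g -> exists2 P, arc 0 1 g P & P 0 = P0.
Proof.
move=> pg.
suff K t : t \in `[0, 1]%R -> exists2 P, arc 0 t g P & P 0 = P0.
  by apply: K; rewrite in_itv /= lexx ler01.
apply: (locally_constant01 (P := fun t => exists2 P, arc 0 t g P & P 0 = P0)) => {t}; last first.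
  have p0 : path_on 0 0 g by exact: path_sub pg.
  have [E0 _] := p0 0 ltac:(by rewrite lexx).
  have [r [W [r0 HW]]] := msys_disc E0.
  have r0C : 0 < r%:C by rewrite -[0]/(0%:C) complex.ltcR.
  have [_ uW _] := HW (g 0) ltac:(by rewrite subrr normr0).
  exists (fun=> P0) => //; split=> // t; rewrite -eq_le => /eqP <-.
  exists (fun z => P0 *m invmx (W (g 0)) *m W z); split.
    by apply/near_normP; exists r%:C => // z /HW[_ _]; exact: msys_mul.
  by apply: filterE => s; rewrite -eq_le => /eqP <-; rewrite mulmxKV.
move=> t; rewrite in_itv /= => tI; have [Et _] := pg t tI.
have [r [W [r0 HW]]] := msys_disc Et.
have r0C : 0 < r%:C by rewrite -[0]/(0%:C) complex.ltcR.
have nD : \forall z \near g t, `|z - g t| < r%:C by apply/near_normP; exists r%:C.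
have /near_normP[d d0 Hd] := path_near pg tI nD.
(* Symmetric in [s] and [s'], since the induction principle asks for an equivalence. Going backwards
   is restriction, going forwards is gluing. *)
have ext s s' : `|s - t| < d -> `|s' - t| < d -> 0 <= s <= 1 -> 0 <= s' <= 1 ->
    (exists2 P, arc 0 s g P & P 0 = P0) -> (exists2 P, arc 0 s' g P & P 0 = P0).
  move=> sd s'd /andP[s0 s1] /andP[s'0 s'1] [P aP PE].
  have [ss|ss] := leP s' s; first by exists P => //; exact: arc_sub aP.
  have inD u : s <= u <= s' -> `|g u - g t| < r%:C.
    move=> /andP[su us]; apply: Hd; last by rewrite (le_trans s0) // (le_trans us).
    move: sd s'd; rewrite !ltr_norml => /andP[A _] /andP[_ B].
    by rewrite (lt_le_trans A) ?lerD2r //= (le_lt_trans _ B) // lerD2r.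
  pose Q u := P s *m invmx (W (g s)) *m W (g u).
  have aQ : arc s s' g Q.
    split; first exact: path_sub pg.
    move=> u uI; exists (fun z => P s *m invmx (W (g s)) *m W z); split; last exact: filterE.
    have /near_normP[q q0 Hq] : \forall z \near g u, `|z - g t| < r%:C.
      apply/near_normP; exists (r%:C - `|g u - g t|); first by rewrite subr_gt0 inD.
      move=> z zu; rewrite (_ : z - g t = (z - g u) + (g u - g t)); last by ring.
      by rewrite (le_lt_trans (ler_normD _ _)) // -ltrBrDr.
    by apply/near_normP; exists q => // z /Hq/HW[_ _]; exact: msys_mul.
  have [_ uW _] := HW _ (inD s ltac:(by rewrite lexx ltW)).
  have := arc_glue aP aQ ltac:(by rewrite s0 ltW) erefl ltac:(by rewrite /Q mulmxKV).
  rewrite (_ : (fun u => if u <= s then g u else g u) = g); last by apply/funext => u; rewrite if_same.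
  by move=> A; exists (fun u => if u <= s then P u else Q u) => //; rewrite s0.
apply/near_normP; exists d => // s sd; rewrite in_itv /= => sI.
by split; apply: ext => //; rewrite subrr normr0.
Qed.

(** Continuation as a relation between values. It is symmetric, transitive and stable under left
    multiplication, so the matrices [M] carrying [P] to [M *m P] along loops can be composed and
    moved to another base point. *)
Definition transported (x0 : C) (P0 : M2) (x1 : C) (P1 : M2) : Prop := exists g P,
  [/\ arc 0 1 g P, g 0 = x0, g 1 = x1, P 0 = P0 & P 1 = P1].

Lemma transported_mul (N : M2) x0 (P0 : M2) x1 (P1 : M2) : transported x0 P0 x1 P1 ->
  transported x0 (N *m P0) x1 (N *m P1).
Proof.
move=> [g [P [aP g0 g1 e0 e1]]]; exists g, (fun t => N *m P t).
by split=> //; [exact: arc_mul | rewrite e0 | rewrite e1].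
Qed.

Lemma transported_sym x0 (P0 : M2) x1 (P1 : M2) : transported x0 P0 x1 P1 -> transported x1 P1 x0 P0.
Proof.
move=> [g [P [aP g0 g1 e0 e1]]].
exists (fun t => g (-1 * t + 1)), (fun t => P (-1 * t + 1)).
rewrite !mulr0 !mulr1 !add0r addNr; split=> //.
apply: arc_affine aP _ => t /andP[t0 t1].
by rewrite mulN1r addrC subr_ge0 t1 gerBl.
Qed.

Lemma transported_trans x1 (P1 : M2) x0 (P0 : M2) x2 (P2 : M2) : transported x0 P0 x1 P1 ->
  transported x1 P1 x2 P2 -> transported x0 P0 x2 P2.
Proof.
move=> [g [P [aP g0 g1 e0 e1]]] [g' [P' [aP' g0' g1' e0' e1']]].
have h0 : 0 <= 2^-1 :> R by rewrite invr_ge0.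
have h1 : 2^-1 <= 1 :> R by rewrite invf_le1 // ler1n.
have h2 : 2 * 2^-1 = 1 :> R by rewrite mulfV.
have A : arc 0 2^-1 (fun t => g (2 * t + 0)) (fun t => P (2 * t + 0)).
  apply: arc_affine aP _ => t /andP[t0 t1]; rewrite addr0 mulr_ge0 //=.
  by rewrite -[leRHS]h2 ler_wpM2l.
have A' : arc 2^-1 1 (fun t => g' (2 * t - 1)) (fun t => P' (2 * t - 1)).
  apply: arc_affine aP' _ => t /andP[t0 t1]; apply/andP; split.
    by rewrite subr_ge0 -[leLHS]h2 ler_wpM2l.
  by rewrite lerBlDr -[leRHS]/(2%:R) -[leRHS]mulr1 ler_wpM2l.
have := arc_glue A A' ltac:(by rewrite h0 h1) ltac:(by rewrite /= h2 addr0 subrr g1 g0') ltac:(by rewrite /= h2 addr0 subrr e1 e0').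
move=> G; eexists; eexists; split; first exact: G.
- by rewrite /= h0 mulr0 addr0.
- by rewrite /= leNgt invf_lt1 ?ltr1n //= mulr1 -[2]/(1 + 1) addrK.
- by rewrite /= h0 mulr0 addr0.
- by rewrite /= leNgt invf_lt1 ?ltr1n //= mulr1 -[2]/(1 + 1) addrK.
Qed.

Lemma transported_exists g (P0 : M2) : path_on 0 1 g -> exists P1 : M2, transported (g 0) P0 (g 1) P1.
Proof. by move=> /(arc_exists P0)[P aP PE]; exists (P 1), g, P. Qed.

End Transport.

Lemma ord2_cases (j : 'I_2) : j = 0 \/ j = 1.
Proof. by case: j => -[|[|//]] i; [left | right]; exact: val_inj. Qed.

(** * Monodromy of the Lame operator *)

Section Monodromy.
Variable R : realType.
Local Notation C := (Cplx R).
Local Notation "x %:C" := (complex.real_complex R x : C).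
Local Notation M2 := 'M[C]_2.
Variables (e : 'I_3 -> C).
Hypothesis eE : forall z : C, \prod_i (z - e i) = Ef z.
Implicit Types (z w p : C) (f v : C -> C) (y : 'I_2 -> C -> C).

Lemma ordinary_pointE p : ordinary_point e p <-> Ef p != 0.
Proof.
rewrite -eE; split=> [H|/prodf_neq0 H i].
  by apply/prodf_neq0 => i _; rewrite subr_eq0; exact: H.
by have := H i isT; rewrite subr_eq0.
Qed.

(** The logarithmic derivative of the product, obtained by differentiating both expressions of the
    cubic. *)
Lemma sum_inv_Ef z : Ef z != 0 -> \sum_i (z - e i)^-1 = dEf z / Ef z.
Proof.
move=> Ez.
have D : is_derive z 1 (fun w => \prod_i (w - e i)) (Ef z * \sum_i (z - e i)^-1).
  rewrite -eE !big_ord_recl !big_ord0 /=; under eq_fun do rewrite !big_ord_recl big_ord0.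
  have d i := is_derB (is_der_id z) (is_der_cst (e i) z).
  have n i : z - e i != 0 by rewrite subr_eq0; exact: (iffRL (ordinary_pointE z) Ez i).
  apply: is_derive_eq (is_derM (d _) (is_derM (d _) (is_derM (d _) (is_der_cst 1 z)))) _.
  by field; rewrite !n.
have D' : is_derive z 1 (fun w => \prod_i (w - e i)) (dEf z).
  by apply: is_der_near (is_derive_Ef z); apply: filterE => w; rewrite eE.
by rewrite -(is_der_unique D D') (mulrC (Ef z)) mulfK.
Qed.

Lemma is_derive_derive1 f z d : is_derive z 1 f d -> derive1 f z = d.
Proof. by case=> _ <-; rewrite derive1E. Qed.

Lemma derivable_is_derive f z : derivable f z 1 -> is_derive z 1 f (derive1 f z).
Proof. by move=> df; apply: (DeriveDef df); rewrite derive1E. Qed.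

Lemma lameE f z : Ef z != 0 -> lame (1 / 6) (- 1 / 9) e f z =
  derive1n 2 f z + dEf z / (2 * Ef z) * derive1 f z - Qf z / (4 * Ef z) * f z.
Proof.
move=> Ez; rewrite /lame eE sum_inv_Ef // /Qf.
by move: (derive1n 2 f z) (derive1 f z) (f z) => a b c; field.
Qed.

Lemma local_solution_sys p f : Ef p != 0 -> local_solution (1 / 6) (- 1 / 9) e p f ->
  \forall z \near p, sys f (fun w => Ef w * derive1 f w) z.
Proof.
move=> Ep; apply: filterS2 (is_der_neq0 (is_derive_Ef p) Ep) => z Ez [df ddf L].
have D1 := derivable_is_derive df.
have D2 : is_derive z 1 (derive1 f) (derive1n 2 f z) := derivable_is_derive ddf.
split; first by rewrite (mulrC (Ef z)) mulfK.
apply: is_derive_eq (is_derM (is_derive_Ef z) D2) _.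
move: L; rewrite lameE // => /eqP; rewrite subr_eq0 -(inj_eq (addIr (- (dEf z / (2 * Ef z) * derive1 f z)))) addrK => /eqP ->.
by move: (derive1 f z) (f z) => a b; field.
Qed.

Lemma sys_local_solution p f v : Ef p != 0 -> (\forall z \near p, sys f v z) ->
  local_solution (1 / 6) (- 1 / 9) e p f.
Proof.
move=> Ep H; have nE := is_der_neq0 (is_derive_Ef p) Ep.
(* The formula for the first derivative must hold on a neighbourhood of [z] before it can be
   differentiated once more. *)
have HI : \forall z \near p, \forall w \near z, Ef w != 0 /\ sys f v w.
  by apply: (nbhs_interior (A := fun w => Ef w != 0 /\ sys f v w)); exact: filterI.
apply: filterS HI => z Hz; have [Ez [D1 D2]] := nbhs_singleton Hz.
have E1 : \forall w \near z, v w / Ef w = derive1 f w.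
  by apply: filterS Hz => w [_ [[_ <-] _]]; rewrite derive1E.
have D := is_derM D2 (is_derV (f := @Ef R) Ez (is_derive_Ef z)).
have D' := is_der_near E1 D.
split; [by case: D1 | by case: D' |].
rewrite lameE // /= (is_derive_derive1 D') -(nbhs_singleton E1).
by move: (f z) (v z) => a b; field.
Qed.

Lemma derive1_near f g z : (\forall w \near z, f w = g w) -> derive1 f z = derive1 g z.
Proof. by move=> H; rewrite !derive1E; exact: near_eq_derive. Qed.

Definition jets y z : M2 := \matrix_(j, k) if k == 0 then y j z else Ef z * derive1 (y j) z.

Lemma jets0 y z j : jets y z j 0 = y j z.
Proof. by rewrite /jets mxE. Qed.

Lemma jets1 y z j : jets y z j 1 = Ef z * derive1 (y j) z.
Proof. by rewrite /jets mxE. Qed.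

Lemma mul_jets0 (N : M2) y z j : (N *m jets y z) j 0 = N j 0 * y 0 z + N j 1 * y 1 z.
Proof.
exact: (etrans (mul2E _ _ _ _) (congr2 +%R (congr1 ( *%R _) (jets0 _ _ _)) (congr1 ( *%R _) (jets0 _ _ _)))).
Qed.

Lemma mul_jets1 (N : M2) y z j : (N *m jets y z) j 1 =
  N j 0 * (Ef z * derive1 (y 0) z) + N j 1 * (Ef z * derive1 (y 1) z).
Proof.
exact: (etrans (mul2E _ _ _ _) (congr2 +%R (congr1 ( *%R _) (jets1 _ _ _)) (congr1 ( *%R _) (jets1 _ _ _)))).
Qed.

Lemma msys_jets p y : Ef p != 0 -> (forall j, local_solution (1 / 6) (- 1 / 9) e p (y j)) ->
  \forall z \near p, msys (jets y) z.
Proof.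
move=> Ep H.
apply: filterS2 (local_solution_sys Ep (H 0)) (local_solution_sys Ep (H 1)) => z S0 S1 j.
under eq_fun do rewrite jets0; under [X in sys _ X]eq_fun do rewrite jets1.
by have [->|->] := ord2_cases j; [exact: S0 | exact: S1].
Qed.

Lemma msys_eq_near (F G : C -> M2) x0 : Ef x0 != 0 -> 
  (\forall z \near x0, msys F z) -> (\forall z \near x0, msys G z) -> F x0 = G x0 ->
  \forall z \near x0, F z = G z.
Proof.
move=> E0 nF nG FG; have [r [W [r0 HW]]] := msys_disc E0.
have r0C : 0 < r%:C by rewrite -[0]/(0%:C) complex.ltcR.
have nW : \forall z \near x0, msys W z by apply/near_normP; exists r%:C => // z /HW[].
have [_ uW _] := HW x0 ltac:(by rewrite subrr normr0).
apply: filterS2 (msys_near_rep E0 uW nW nF) (msys_near_rep E0 uW nW nG) => z -> ->.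
by rewrite FG.
Qed.

(** A left kernel vector of the jets at [p] gives a combination of solutions with zero initial data,
    which vanishes near [p] by uniqueness. *)
Lemma independent_jets p y : Ef p != 0 ->
  (forall j, local_solution (1 / 6) (- 1 / 9) e p (y j)) ->
  independent_at p y -> jets y p \in unitmx.
Proof.
move=> Ep H ind; rewrite unitmxE unitfE; apply/det0P => -[c c0 cJ].
have [r [W [r0 HW]]] := msys_disc Ep.
have r0C : 0 < r%:C by rewrite -[0]/(0%:C) complex.ltcR.
have nW : \forall z \near p, msys W z by apply/near_normP; exists r%:C => // z /HW[].
have [_ uW _] := HW p ltac:(by rewrite subrr normr0).
move/negP: c0; apply; apply/eqP/rowP => j; rewrite mxE.
apply: (ind (fun j => c 0 j)) => {j}.
apply: filterS (msys_near_rep Ep uW nW (msys_jets Ep H)) => z Hz.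
have : (c *m jets y z) 0 0 = 0 by rewrite Hz !mulmxA cJ !mul0mx mxE.
by rewrite mxE => E; rewrite -[RHS]E; apply: eq_bigr => j _; rewrite jets0.
Qed.

Lemma I01E (t : R) : (t \in `[0, 1]%R) = (0 <= t <= 1).
Proof. by rewrite in_itv. Qed.

Lemma is_loopE p (g : R -> C) : is_loop e p g <-> [/\ path_on 0 1 g, g 0 = p & g 1 = p].
Proof.
split=> [[cg g0 g1 og]|[pg g0 g1]].
  split=> // t tI; split; first by apply/ordinary_pointE; apply: og; rewrite I01E.
  move=> d d0; move/subspace_continuousP: cg => /(_ t); rewrite /= I01E => /(_ tI).
  have FF : Filter (within `[0, 1]%classic (nbhs t)) by exact: within_filter.
  move=> H; have := iffLR (@cvgrPdist_lt _ _ _ _ FF g (g t)) H d d0.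
  rewrite near_withinE; apply: filterS => s + sI.
  by rewrite distrC; apply; rewrite /= I01E.
split=> //; last by move=> t; rewrite I01E => /pg[/ordinary_pointE].
apply/subspace_continuousP => t; rewrite /= I01E => tI; have [_ H] := pg t tI.
have FF : Filter (within `[0, 1]%classic (nbhs t)) by exact: within_filter.
apply: (iffRL (@cvgrPdist_lt _ _ _ _ FF g (g t))) => d d0.
rewrite near_withinE; apply: filterS (H d d0) => s + sI.
by rewrite distrC; apply; rewrite -I01E.
Qed.

(** Passes from germs to values: along the loop the arc is the matrix of jets of the continued
    germs, and equal germs have equal jets. *)
Lemma monodromy_transported p y (M : GL C 2) : Ef p != 0 ->
  (forall j, local_solution (1 / 6) (- 1 / 9) e p (y j)) ->
  monodromy_group (1 / 6) (- 1 / 9) e p y M ->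
  transported p (jets y p) p (val M *m jets y p).
Proof.
move=> Ep Hy [g [Y [lg cY Y0 Y1]]]; have /is_loopE[pg g0 g1] := lg.
have jets_near (y1 y2 : 'I_2 -> C -> C) z : (forall j, \forall w \near z, y1 j w = y2 j w) ->
    jets y1 z = jets y2 z.
  move=> H; apply: eq_mx2 => j; split.
    exact: (etrans (jets0 _ _ _) (etrans (nbhs_singleton (H j)) (esym (jets0 _ _ _)))).
  apply: (etrans (jets1 _ _ _)); apply: (etrans _ (esym (jets1 _ _ _))).
  exact: (congr1 ( *%R (Ef z)) (derive1_near (H j))).
exists g, (fun t => jets (fun j => Y j t) (g t)); split; [|exact: g0|exact: g1| |].
- split; first exact: pg.
  move=> t tI; have [Et _] := pg t tI; exists (jets (fun j => Y j t)); split.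
    apply: msys_jets; first exact: Et.
    by move=> j; have [] := cY j t; rewrite ?I01E.
  have Hn j : \forall s \near t, s \in `[0, 1]%R -> \forall z \near g s, Y j s z = Y j t z.
    by have [] := cY j t; rewrite ?I01E.
  apply: filterS2 (Hn 0) (Hn 1) => s H0 H1 sI; apply: jets_near => j.
  by have [->|->] := ord2_cases j; [apply: H0 | apply: H1]; rewrite I01E.
- by rewrite g0; apply: jets_near; exact: Y0.
rewrite g1 (jets_near _ _ _ Y1).
apply: eq_mx2 => j.
have E01 : lift ord0 ord0 = 1 :> 'I_2 by exact: val_inj.
have sumE : (fun z => \sum_k val M j k * y k z) = (fun z => val M j 0 * y 0 z + val M j 1 * y 1 z).
  by apply/funext => z; rewrite !big_ord_recl big_ord0 addr0 E01.
have D k : is_derive p 1 (y k) (derive1 (y k) p).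
  by apply: derivable_is_derive; have [] := nbhs_singleton (Hy k).
split.
  apply: (etrans (jets0 _ _ _)); apply: (etrans _ (esym (mul_jets0 _ _ _ _))).
  exact: (congr1 (fun f => f p) sumE).
apply: (etrans (jets1 _ _ _)); apply: (etrans _ (esym (mul_jets1 _ _ _ _))).
have dE := is_derive_derive1 (is_derD (is_derZ (val M j 0) (D 0)) (is_derZ (val M j 1) (D 1))).
apply: (etrans (congr1 (fun f => Ef p * derive1 f p) sumE)).
apply: (etrans (congr1 ( *%R (Ef p)) dE)).
by move: (derive1 _ _) (derive1 _ _) => u w; ring.
Qed.

(** Passes from values back to germs: a germ is chosen at each time, and germs at neighbouring times
    agree because their values agree there. *)
Lemma transported_monodromy p y (M : GL C 2) : Ef p != 0 ->
  (forall j, local_solution (1 / 6) (- 1 / 9) e p (y j)) ->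
  transported p (jets y p) p (val M *m jets y p) ->
  monodromy_group (1 / 6) (- 1 / 9) e p y M.
Proof.
move=> Ep Hy [g [P [[pg aP] g0 g1 P0 P1]]].
(* Outside the unit interval the chosen germ is the irrelevant value 0. *)
have /choice[F HF] : forall t, exists F, 0 <= t <= 1 ->
    (\forall z \near g t, msys F z) /\ \forall s \near t, 0 <= s <= 1 -> P s = F (g s).
  move=> t; have [tI|tI] := boolP (0 <= t <= 1); last by exists (fun=> 0).
  by have [F HF] := aP t tI; exists F.
have I0 : 0 <= (0 : R) <= 1 by rewrite lexx ler01.
have I1 : 0 <= (1 : R) <= 1 by rewrite lexx ler01.
have FP t : 0 <= t <= 1 -> F t (g t) = P t.
  by move=> tI; have [_ H] := HF t tI; rewrite (nbhs_singleton H).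
exists g, (fun j t z => F t z j 0); split.
- by apply: (iffRL (is_loopE p g)); split.
- move=> j t; rewrite I01E => tI; have [Et _] := pg t tI; have [nF HFt] := HF t tI.
  split.
    apply: (sys_local_solution (v := fun z => F t z j 1)); first exact: Et.
    by apply: filterS nF => z; exact.
  apply: filterS2 HFt (path_near pg tI (nbhs_interior nF)) => s H1 H2.
  rewrite I01E => sI; have [nFs _] := HF s sI; have [Es _] := pg s sI.
  have E0 : F s (g s) = F t (g s) by rewrite (FP _ sI) (H1 sI).
  by apply: filterS (msys_eq_near Es nFs (H2 sI) E0) => z E; exact: (congr1 (fun A : M2 => A j 0) E).
- move=> j; have [nF0 _] := HF 0 I0; rewrite g0 in nF0.
  have E0 : F 0 p = jets y p by rewrite -P0 -(FP 0 I0) g0.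
  apply: filterS (msys_eq_near Ep nF0 (msys_jets Ep Hy) E0) => z E.
  exact: (etrans (congr1 (fun A : M2 => A j 0) E) (jets0 _ _ _)).
move=> j; have [nF1 _] := HF 1 I1; rewrite g1 in nF1.
have nM : \forall z \near p, msys (fun z => val M *m jets y z) z.
  by apply: filterS (msys_jets Ep Hy) => z; exact: msys_mul.
have E1 : F 1 p = val M *m jets y p by rewrite -P1 -(FP 1 I1) g1.
apply: filterS (msys_eq_near Ep nF1 nM E1) => z E.
apply: (etrans (congr1 (fun A : M2 => A j 0) E)); apply: (etrans (mul_jets0 _ _ _ _)).
by rewrite !big_ord_recl big_ord0 addr0 (_ : lift ord0 ord0 = 1) //; exact: val_inj.
Qed.

End Monodromy.

(** * The conserved form *)

Section Invariant_form.
Variable R : realType.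
Local Notation C := (Cplx R).
Local Notation "x %:C" := (complex.real_complex R x : C).
Local Notation M2 := 'M[C]_2.
Implicit Types (z w x : C).

Fixpoint heval (s : seq C) x : C := if s is a :: s' then a + x * heval s' x else 0.
Fixpoint dheval (s : seq C) x : C :=
  if s is a :: s' then heval s' x + x * dheval s' x else 0.

Lemma is_der_heval s x : is_derive x 1 (heval s) (dheval s x).
Proof.
elim: s => [|a s IH] /=; first exact: is_der_cst.
apply: is_derive_eq (is_derD (is_der_cst a x) (is_derM (is_der_id x) IH)) _.
by ring.
Qed.

(* Found by solving the conservation law coefficient by coefficient:
   coefficients (lowest degree first) of [p_k], where the [k]-th coefficient of
   the degree 12 form pulled back along the jets is [Ef ^ ceil(k/2) p_k / 12 ^ k]. *)
Definition pcoef (k : nat) : seq C := match k with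
  | 0%N => [:: -1; 1]
  | 1%N => [:: 1]
  | 2%N => [:: -4; 1; 1]
  | 3%N => [:: 2; 1]
  | 4%N => [:: - 16 / 3; - 8 / 3; 3; 1]
  | 5%N => [:: 0; 4; 1]
  | 6%N => [:: 640 / 21; - 80 / 3; - 20 / 3; 5; 1]
  | 7%N => [:: - 160 / 3; - 32 / 3; 6; 1]
  | 8%N => [:: 1280 / 3; 0; - 160; - 80 / 3; 7; 1]
  | 9%N => [:: - 1280 / 3; - 896 / 3; - 128 / 3; 8; 1]
  | 10%N => [:: 256 * 100 / 9; 640 * 10 / 9; - 896 * 10 / 9; - 176 * 10 / 3; - 220 / 3; 9; 1]
  | 11%N => [:: - 128 * 100 / 3; - 896 * 10 / 3; - 960; - 320 / 3; 10; 1]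
  | 12%N => [:: 512 * 1000 / 9; 512 * 100 / 3; - 896 * 10; - 512 * 100 / 9;
              - 472 * 10 / 3; - 472 / 3; 11; 1]
  | _ => [::]
  end.

Definition rcoef k x : C := Ef x ^+ uphalf k * heval (pcoef k) x.
Definition drcoef k x : C :=
  (uphalf k)%:R * Ef x ^+ (uphalf k).-1 * dEf x * heval (pcoef k) x
  + Ef x ^+ uphalf k * dheval (pcoef k) x.

Lemma is_der_Xn n f z (a : C) : is_derive z 1 f a ->
  is_derive z 1 (fun w => f w ^+ n) (n%:R * f z ^+ n.-1 * a).
Proof.
case: n => [|n] df; last exact: is_derX.
by apply: is_derive_eq (is_der_cst 1 z) _; rewrite !mul0r.
Qed.

Lemma is_der_rcoef k x : is_derive x 1 (rcoef k) (drcoef k x).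
Proof.
apply: is_derive_eq (is_derM (is_der_Xn (uphalf k) (is_derive_Ef x)) (is_der_heval _ x)) _.
by rewrite /drcoef; move: (_%:R) (heval _ x) => a b; ring.
Qed.

(** The coefficient of [a ^ (12 - k) * (b / 12) ^ k] in the derivative of [rform] along the flow,
    divided by [bin12 k] and multiplied by [Ef]; the 3 is [12 / 4]. At [k = 0] the truncated
    predecessor has factor 0, and at [k = 12] so has [rcoef 13]. *)
Lemma rcoef_rec k x : (k < 13)%N -> Ef x * drcoef k x =
  (12 - k)%:R / 12 * rcoef k.+1 x
  + k%:R * (dEf x / 2 * rcoef k x + 3 * Qf x * Ef x * rcoef k.-1 x).
Proof.
rewrite /rcoef /drcoef; do 13?[case: k => [|k] //] => _ /=.
all: by rewrite ?subSS ?subn0 /Ef /dEf /Qf; field.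
Qed.

Definition bin12 (k : nat) : C := match k with
  | 0%N | 12%N => 1 | 1%N | 11%N => 12 | 2%N | 10%N => 66 | 3%N | 9%N => 220
  | 4%N | 8%N => 495 | 5%N | 7%N => 792 | 6%N => 924 | _ => 0
  end.

(** At [(a, b) = (1, 0)] the value is [x - 1]. The pair [(a, b)] is dual to the jets: it is the
    column to which a matrix of jets is applied. *)
Definition rform x (a b : C) : C :=
  \sum_(k < 13) bin12 k * rcoef k x * (a ^+ (12 - k) * (b / 12) ^+ k).

Lemma is_der_sum n (h : nat -> C -> C) (dh : nat -> C) z :
  (forall k, (k < n)%N -> is_derive z 1 (h k) (dh k)) ->
  is_derive z 1 (fun w => \sum_(k < n) h k w) (\sum_(k < n) dh k).
Proof.
elim: n => [|n IH] H.
  by rewrite big_ord0; under eq_fun do rewrite big_ord0; exact: is_der_cst.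
rewrite big_ord_recr; under eq_fun do rewrite big_ord_recr /=.
by apply: is_derD (IH _) (H n _) => // k kn; apply: H; rewrite ltnS ltnW.
Qed.

(* [(a, b)] moves so that the linear combination [F (a, b)^T] of jets is constant. *)
Lemma is_der_rform (a b : C -> C) z : Ef z != 0 ->
  is_derive z 1 a (- (Qf z / 4) * b z) ->
  is_derive z 1 b (- (a z + dEf z / 2 * b z) / Ef z) ->
  is_derive z 1 (fun w => rform w (a w) (b w)) 0.
Proof.
move=> Ez da db.
have H k (_ : (k < 13)%N) := is_derM (is_derZ (bin12 k) (is_der_rcoef k z))
  (is_derM (is_der_Xn (12 - k) da) (is_der_Xn k (is_derM db (is_der_cst 12^-1 z)))).
apply: is_derive_eq (is_der_sum H) _ => {H}.
have rE k : (k < 13)%N -> drcoef k z = ((12 - k)%:R / 12 * rcoef k.+1 z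
    + k%:R * (dEf z / 2 * rcoef k z + 3 * Qf z * Ef z * rcoef k.-1 z)) / Ef z.
  by move=> k13; rewrite -rcoef_rec // mulrC mulKf.
have r13 : rcoef 13 z = 0 by rewrite /rcoef /= mulr0.
rewrite !big_ord_recl big_ord0 /= /bump /= !add1n !rE // r13.
rewrite ?subSS ?subn0 ?add0n /=.
move: (rcoef 0 z) (rcoef 1 z) (rcoef 2 z) (rcoef 3 z) (rcoef 4 z) (rcoef 5 z).
move: (rcoef 6 z) (rcoef 7 z) (rcoef 8 z) (rcoef 9 z) (rcoef 10 z) (rcoef 11 z) (rcoef 12 z).
move: (a z) (b z) (dEf z) (Qf z) (Ef z) Ez => A B d q E E0.
move=> r6 r7 r8 r9 r10 r11 r12 r0 r1 r2 r3 r4 r5.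
by field.
Qed.

(* Klein's form: its roots are the vertices of an icosahedron. *)
Definition klein (X Y : C) : C := X ^+ 11 * Y + 11 * X ^+ 6 * Y ^+ 6 - X * Y ^+ 11.

Definition klein_at (P : M2) : C -> C -> C := fun a b =>
  klein (P 0 0 * a + P 0 1 * b) (P 1 0 * a + P 1 1 * b).

(** The property preserved by continuation. Invertibility is included so that it is transported as
    well. *)
Definition carries c x (P : M2) : Prop :=
  P \in unitmx /\ forall a b, klein_at P a b = c * rform x a b.

Lemma unitmx2 (P : M2) : (P \in unitmx) = (P 0 0 * P 1 1 - P 0 1 * P 1 0 != 0).
Proof. by rewrite unitmxE unitfE det2E. Qed.

(** The image [(X, Y)] of [(a, b)] under [F z] is held fixed. Its preimage [(A t, B t)] under [F t]
    then moves as [is_der_rform] requires, so the form is constant along it. *)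
Lemma carries_disc c (F : C -> M2) (x0 r : C) :
  (forall z, `|z - x0| < r -> [/\ Ef z != 0, F z \in unitmx & msys F z]) ->
  forall z w, `|z - x0| < r -> `|w - x0| < r -> carries c w (F w) -> carries c z (F z).
Proof.
move=> H z w zr wr [_ cw]; have [_ uz _] := H z zr; split=> // a b.
set X := F z 0 0 * a + F z 0 1 * b; set Y := F z 1 0 * a + F z 1 1 * b.
pose d t := F t 0 0 * F t 1 1 - F t 0 1 * F t 1 0.
pose A t := (X * F t 1 1 - Y * F t 0 1) / d t.
pose B t := (Y * F t 0 0 - X * F t 1 0) / d t.
pose u t := rform t (A t) (B t).
have du t : `|t - x0| < r -> is_derive t 1 u 0.
  move=> tr; have [Et ut S] := H t tr; have dt : d t != 0 by rewrite -unitmx2.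
  have [D00 D01] := S 0; have [D10 D11] := S 1.
  have Dd := is_derV (f := d) dt (is_derB (is_derM D00 D11) (is_derM D01 D10)).
  have dA : is_derive t 1 A (- (Qf t / 4) * B t).
    apply: is_derive_eq (is_derM (is_derB (is_derZ X D11) (is_derZ Y D01)) Dd) _.
    by rewrite /A /B /d in dt *; field; rewrite dt Et.
  have dB : is_derive t 1 B (- (A t + dEf t / 2 * B t) / Ef t).
    apply: is_derive_eq (is_derM (is_derB (is_derZ Y D00) (is_derZ X D10)) Dd) _.
    by rewrite /A /B /d in dt *; field; rewrite dt Et.
  exact: (is_der_rform Et dA dB).
have AB t : `|t - x0| < r -> F t 0 0 * A t + F t 0 1 * B t = X /\
    F t 1 0 * A t + F t 1 1 * B t = Y.
  move=> tr; have [_ ut _] := H t tr; have dt : d t != 0 by rewrite -unitmx2.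
  by rewrite /A /B /d in dt *; split; field.
have uz' : u z = rform z a b.
  have dz : d z != 0 by rewrite -unitmx2.
  by rewrite /u; congr rform; rewrite /A /B /X /Y /d in dz *; field.
have <- : u w = rform z a b by rewrite -uz' (deriv0_const du zr) (deriv0_const du wr).
have [A1 A2] := AB w wr.
by rewrite /u -cw /klein_at A1 A2.
Qed.

Lemma transported_carries c x0 (P0 : M2) x1 (P1 : M2) : transported x0 P0 x1 P1 ->
  carries c x0 P0 -> carries c x1 P1.
Proof.
move=> [g [P [[pg aP] <- <- <- <-]]] c0.
suff K t : t \in `[0, 1]%R -> carries c (g t) (P t) by apply: K; rewrite in_itv /= lexx ler01.
apply: (locally_constant01 (P := fun t => carries c (g t) (P t))) c0 t => t.
rewrite in_itv /= => tI; have [Et _] := pg t tI.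
have [r [W [r0 HW]]] := msys_disc Et.
have r0C : 0 < r%:C by rewrite -[0]/(0%:C) complex.ltcR.
have nW : \forall z \near g t, msys W z by apply/near_normP; exists r%:C => // z /HW[].
have nD : \forall z \near g t, `|z - g t| < r%:C by apply/near_normP; exists r%:C.
have tr : `|g t - g t| < r%:C by rewrite subrr normr0.
have [_ uW _] := HW (g t) tr.
apply: filterS2 (arc_local (conj pg aP) tI nW uW) (path_near pg tI nD) => s Hs gs.
rewrite in_itv /= => sI; have {}gs := gs sI; have {}Hs := Hs sI.
pose N := P t *m invmx (W (g t)).
have Pt : P t = N *m W (g t) by rewrite mulmxKV.
have Ps : P s = N *m W (g s) by [].
have uN : P s \in unitmx \/ P t \in unitmx -> N \in unitmx.
  by rewrite Ps Pt !unitmx_mul => -[/andP[]|/andP[]].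
have K : N \in unitmx -> forall z, `|z - g t| < r%:C ->
    [/\ Ef z != 0, N *m W z \in unitmx & msys (fun z => N *m W z) z].
  by move=> u z /HW[Ez uz mz]; split; [|rewrite unitmx_mul u|exact: msys_mul].
split=> H.
  rewrite Pt; have u : N \in unitmx by apply: uN; left; case: H.
  by apply: (carries_disc (K u) tr gs); rewrite -Ps.
rewrite Ps; have u : N \in unitmx by apply: uN; right; case: H.
by apply: (carries_disc (K u) gs tr); rewrite -Pt.
Qed.

Lemma carries_invariant c x (P M : M2) : carries c x P -> carries c x (M *m P) ->
  forall X Y, klein (M 0 0 * X + M 0 1 * Y) (M 1 0 * X + M 1 1 * Y) = klein X Y.
Proof.
move=> [uP cP] [_ cM] X Y; rewrite unitmx2 in uP.
set d := P 0 0 * P 1 1 - P 0 1 * P 1 0 in uP.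
pose a := (X * P 1 1 - Y * P 0 1) / d; pose b := (Y * P 0 0 - X * P 1 0) / d.
have E := etrans (cP a b) (esym (cM a b)); rewrite /klein_at !mul2E in E.
have XE : X = P 0 0 * a + P 0 1 * b by rewrite /a /b /d in uP *; field.
have YE : Y = P 1 0 * a + P 1 1 * b by rewrite /a /b /d in uP *; field.
rewrite [in RHS]XE [in RHS]YE E; congr klein; rewrite [X in _ * X]XE [Y in _ + _ * Y]YE; ring.
Qed.

(** At [x = 1] the form is, in the variables [a - b / 12] and [b / 12], Klein's form with the factor
    64 on the middle term and [64 ^ 2] on the last. Scaling the second variable by a fifth root [n]
    of 64 removes these factors. *)
Definition base_frame (n : C) : M2 := \matrix_(i, j)
  if i == 0 then (if j == 0 then 1 else - 12^-1) else (if j == 0 then 0 else n / 12).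

Lemma rcoef1 : [/\ rcoef 0 1 = 0, rcoef 1 1 = 1, rcoef 2 1 = - 2 & rcoef 3 1 = 3] /\
  [/\ rcoef 4 1 = - 4, rcoef 5 1 = 5, rcoef 6 1 = 22 / 7 & rcoef 7 1 = - 57] /\
  [/\ rcoef 8 1 = 248, rcoef 9 1 = - 759, rcoef 10 1 = 191 * 10,
      rcoef 11 1 = - (83 * 100 + 9) & rcoef 12 1 = 57 * 1000 + 588].
Proof.
have E1 : Ef 1 = 1 :> C by rewrite /Ef; field.
have r1 k : rcoef k 1 = heval (pcoef k) 1 by rewrite /rcoef E1 expr1n mul1r.
by rewrite !r1 /=; split; [split | split; split]; field.
Qed.

Lemma rform1 (a b : C) : rform 1 a b = 12 * ((a - b / 12) ^+ 11 * (b / 12)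
  + 11 * 64 * (a - b / 12) ^+ 6 * (b / 12) ^+ 6 - 64 ^+ 2 * (a - b / 12) * (b / 12) ^+ 11).
Proof.
rewrite /rform !big_ord_recl big_ord0 /= /bump /= ?add1n ?add0n.
have [[-> -> -> ->] [[-> -> -> ->] [-> -> -> -> ->]]] := rcoef1.
rewrite ?subSS ?subn0; move: (b / 12) => {}b.
by field.
Qed.

Lemma carries_base (n : C) : n ^+ 5 = 64 -> carries (n / 12) 1 (base_frame n).
Proof.
move=> n5; have n0 : n != 0.
  by apply: contra_eq_neq n5 => ->; rewrite expr0n /= eq_sym pnatr_eq0.
split; first by rewrite unitmx2 !mxE /= mul1r mulr0 subr0 mulf_neq0 ?invr_eq0 ?pnatr_eq0.
move=> a b; rewrite /klein_at !mxE rform1 /klein /=.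
have -> : (0 * a + n / 12 * b) ^+ 6 = 64 * n * (b / 12) ^+ 6 by rewrite -n5; field.
have -> : (0 * a + n / 12 * b) ^+ 11 = 64 ^+ 2 * n * (b / 12) ^+ 11 by rewrite -n5; field.
by field.
Qed.

End Invariant_form.

(** * Real structure *)

Section Real_axis.
Variable R : realType.
Local Notation C := (Cplx R).
Local Notation "x %:C" := (complex.real_complex R x : C).
Local Notation M2 := 'M[C]_2.
Implicit Types (z w x : C).

Lemma conjRC (x : R) : (x%:C)^* = x%:C.
Proof. by apply/CrealP/complex.complex_realP; exists x. Qed.

Lemma realRC (x : R) : x%:C \is Num.real.
Proof. by apply/complex.complex_realP; exists x. Qed.

(** Schwarz reflection: conjugating source and target preserves complex differentiability. *)
Lemma is_derive_conj (f : C -> C) z (d : C) : is_derive z 1 f d ->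
  is_derive (z^*) 1 (fun w => (f w^*)^*) (d^*).
Proof.
move=> /is_deriveP H; apply/is_deriveP => e e0; have [r r0 Hr] := H e e0.
exists r => // h hr; have := Hr (h^*); rewrite norm_conjC => /(_ hr).
rewrite -[X in X <= _ -> _]norm_conjC !rmorphB rmorphM /= !conjCK.
by rewrite -[X in _ -> `|(f X)^* - _ - _| <= _]/((z^* + h)^*) rmorphD /= conjCK.
Qed.

Lemma conj_Ef z : (Ef z)^* = Ef z^*.
Proof. by rewrite /Ef !(rmorph_nat, rmorphXn, rmorph1, fmorphV, rmorphB, rmorphD, rmorphM). Qed.

Lemma conj_dEf z : (dEf z)^* = dEf z^*.
Proof. by rewrite /dEf !(rmorph_nat, rmorphXn, rmorph1, fmorphV, rmorphB, rmorphD, rmorphM). Qed.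

Lemma conj_Qf z : (Qf z)^* = Qf z^*.
Proof. by rewrite /Qf !(rmorph_nat, rmorphXn, rmorph1, fmorphV, rmorphB, rmorphD, rmorphM). Qed.

Lemma sys_conj (f v : C -> C) z : sys f v z^* ->
  sys (fun w => (f w^*)^*) (fun w => (v w^*)^*) z.
Proof.
move=> [/is_derive_conj D1 /is_derive_conj D2]; rewrite conjCK in D1 D2; split.
  by apply: is_derive_eq D1 _; rewrite rmorphM fmorphV /= conj_Ef conjCK.
apply: is_derive_eq D2 _.
by rewrite rmorphD !rmorphM !fmorphV /= rmorphM /= !rmorph_nat conj_Ef conj_dEf conj_Qf conjCK.
Qed.

Definition conjmx2 (P : M2) : M2 := map_mx (fun x : C => x^*) P.

Lemma conjmx2E (P : M2) i j : conjmx2 P i j = (P i j)^*.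
Proof. by rewrite mxE. Qed.

Lemma conjmx2M (P Q : M2) : conjmx2 (P *m Q) = conjmx2 P *m conjmx2 Q.
Proof. exact: (map_mxM (Num.conj : {rmorphism C -> C})). Qed.

Lemma arc_conj (a b : R) (g : R -> C) P : (forall t, a <= t <= b -> g t \is Num.real) ->
  arc a b g P -> arc a b g (fun t => conjmx2 (P t)).
Proof.
move=> rg [pg aP]; split=> // t tI; have [F [nF HF]] := aP t tI.
exists (fun z => conjmx2 (F z^*)); split; last first.
  by apply: filterS HF => s H sI; rewrite H // (CrealP (rg s sI)).
move/near_normP: nF => [r r0 Hr]; apply/near_normP; exists r => // z zr.
have Sz : msys F z^*.
  by apply: Hr; rewrite -(CrealP (rg t tI)) -rmorphB /= norm_conjC.
move=> j; under eq_fun do rewrite conjmx2E; under [X in sys _ X]eq_fun do rewrite conjmx2E.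
exact: sys_conj (Sz j).
Qed.

(** Over a real path the conjugate arc is again a continuation, with the same initial value;
    uniqueness identifies the two. *)
Lemma arc_real (a b : R) (g : R -> C) P : a <= b ->
  (forall t, a <= t <= b -> g t \is Num.real) -> arc a b g P ->
  conjmx2 (P a) = P a -> forall t, a <= t <= b -> conjmx2 (P t) = P t.
Proof.
move=> ab rg aP Pa; apply: (arc_unique ab (arc_conj rg aP) aP Pa).
Qed.

Definition Er (x : R) : R := x ^+ 3 - 20 / 3 * x + 20 / 3.

Lemma Ef_real (x : R) : Ef x%:C = (Er x)%:C.
Proof. by rewrite /Ef /Er !(rmorph_nat, rmorphXn, rmorph1, fmorphV, rmorphB, rmorphD, rmorphM). Qed.

Lemma real_root : exists2 r : R, Er r = 0 &
  [/\ r < 0, 0 < 3 * r ^+ 2 - 20 / 3 & forall x : R, r < x -> 0 < Er x].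
Proof.
pose p : {poly R} := 'X^3 - (20 / 3)%:P * 'X + (20 / 3)%:P.
have pE (x : R) : p.[x] = Er x by rewrite /p !hornerE /=.
(* The bracket is narrow enough for [r ^ 2 > 80 / 9], that is [3/4 r ^ 2 > 20/3]. This makes the
   quadratic cofactor of [x - r] positive, so there is no other real root. *)
have [||r /andP[r1 r2] /rootP] := @poly_ivt R p (-3) (- 2982 / 1000).
- by lra.
- by rewrite !pE /Er; apply/andP; split; lra.
rewrite pE => rE; exists r => //.
have r2' : 8892 / 1000 <= r ^+ 2 by rewrite expr2; nra.
split; [by lra | by lra |] => x rx.
have -> : Er x = (x - r) * (x ^+ 2 + x * r + r ^+ 2 - 20 / 3).
  by rewrite -[LHS]subr0 -rE /Er; field.
rewrite mulr_gt0 ?subr_gt0 //; rewrite expr2 in r2' *.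
have : 0 <= (x + r / 2) ^+ 2 by rewrite sqr_ge0.
rewrite !expr2 => H; nra.
Qed.

Lemma real_segment (r x y : R) (P0 : M2) : (forall x : R, r < x -> 0 < Er x) ->
  r < x -> r < y -> conjmx2 P0 = P0 ->
  exists2 P1, conjmx2 P1 = P1 & transported x%:C P0 y%:C P1.
Proof.
move=> rE rx ry P0r; pose g (t : R) : C := (x + t * (y - x))%:C.
have pg : path_on 0 1 g.
  move=> t /andP[t0 t1]; split.
    rewrite Ef_real fmorph_eq0 gt_eqF // rE // /g.
    have -> : x + t * (y - x) = (1 - t) * x + t * y by ring.
    have [tl|tl] := ltP t 1.
      rewrite -[r]mul1r -{1}(subrK t 1) mulrDl ltr_leD //.
        by rewrite ltr_pM2l ?subr_gt0.
      by rewrite ler_wpM2l // ltW.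
    have -> : t = 1 by apply/eqP; rewrite eq_le t1.
    by rewrite subrr mul0r add0r mul1r.
  move=> e e0; have [q q0 ->] := real_complexE' e0.
  have k1 : 0 < `|y - x| + 1 by rewrite ltr_wpDl.
  apply/near_normP; exists (q / (`|y - x| + 1)); first by rewrite divr_gt0.
  move=> s; rewrite ltr_pdivlMr // => st _.
  rewrite /g -rmorphB normRC complex.ltcR (_ : _ - _ = (s - t) * (y - x)); last by ring.
  by rewrite normrM (le_lt_trans _ st) // ler_wpM2l // lerDl.
have [P aP PE] := arc_exists P0 pg.
have rg t : 0 <= t <= 1 -> g t \is Num.real by move=> _; exact: realRC.
exists (P 1).
  by apply: (arc_real ler01 rg aP); rewrite ?PE // lexx ler01.
exists g, P; split=> //; first by rewrite /g mul0r addr0.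
by rewrite /g mul1r addrC subrK.
Qed.

End Real_axis.

(** * Local monodromy *)

Section Circles.
Variable R : realType.
Local Notation C := (Cplx R).
Local Notation "x %:C" := (complex.real_complex R x : C).
Local Notation M2 := 'M[C]_2.
Implicit Types (z w x : C) (t s : R).

Definition cis t : C := (cos t)%:C + 'i%C * (sin t)%:C.

Lemma sqr_i : 'i%C * 'i%C = -1 :> C.
Proof. by rewrite -expr2 complex.sqr_i. Qed.

Lemma cis0 : cis 0 = 1.
Proof. by rewrite /cis cos0 sin0 rmorph1 rmorph0 mulr0 addr0. Qed.

Lemma cisD t s : cis (t + s) = cis t * cis s.
Proof.
rewrite /cis cosD sinD !(rmorphB, rmorphD, rmorphM) /=.
set a := (cos t)%:C; set b := (sin t)%:C; set c := (cos s)%:C; set d := (sin s)%:C.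
rewrite (_ : (a + _) * _ = a * c + ('i%C * 'i%C) * (b * d) + 'i%C * (a * d + b * c)); last by ring.
by rewrite sqr_i; ring.
Qed.

Lemma cisN t : cis (- t) * cis t = 1.
Proof. by rewrite -cisD addNr cis0. Qed.

Lemma cis_neq0 t : cis t != 0.
Proof. by apply: contra_eq_neq (cisN t) => ->; rewrite mulr0 eq_sym oner_neq0. Qed.

Lemma cisV t : (cis t)^-1 = cis (- t).
Proof. by rewrite -[RHS]mulr1 -(mulfV (cis_neq0 t)) mulrA cisN mul1r. Qed.

Lemma cisMn (n : nat) t : cis (n%:R * t) = cis t ^+ n.
Proof.
elim: n => [|n IH]; first by rewrite mul0r cis0.
by rewrite -natr1 mulrDl mul1r cisD IH exprSr.
Qed.

Lemma norm_cis t : `|cis t| = 1.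
Proof.
apply/eqP; rewrite -(@pexpr_eq1 _ _ 2) // /cis complex.normc_def /=.
by rewrite !(mul0r, mulr0, mul1r, subr0, add0r, addr0) cos2Dsin2 sqrtr1 expr1n.
Qed.

Lemma cis_pi : cis pi = -1.
Proof. by rewrite /cis cospi sinpi rmorphN rmorph1 rmorph0 mulr0 addr0. Qed.

Lemma cis_2pi : cis (2 * pi) = 1.
Proof. by rewrite mulr_natl mulr2n cisD cis_pi mulrNN mulr1. Qed.

Lemma cis_neq1 t : 0 < t < pi -> cis t != 1.
Proof.
move=> /sin_gt0_pi; apply: contraTneq => /(congr1 (@complex.Im R)).
by rewrite /cis /= mul0r mul1r !add0r => ->; rewrite ltxx.
Qed.

Lemma cis_cont (e : C) : 0 < e -> exists2 d : R, 0 < d & forall t, `|t| < d -> `|cis t - 1| < e.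
Proof.
move=> e0; have [r r0 rE] := real_complexE' (divr_gt0 e0 (ltr0Sn C 1)).
have /cvgrPdist_lt/(_ r r0)/near_normP[d1 d10 H1] := @continuous_cos R 0.
have /cvgrPdist_lt/(_ r r0)/near_normP[d2 d20 H2] := @continuous_sin R 0.
have [d d0 /andP[dd1 dd2]] := minor2 d10 d20.
exists d => // t td.
have := H1 t; have := H2 t; rewrite subr0 cos0 sin0 sub0r normrN => K2 K1.
have {}K1 : `|1 - cos t| < r by apply: K1; rewrite (lt_le_trans td).
have {}K2 : `|sin t| < r by apply: K2; rewrite (lt_le_trans td).
rewrite (_ : cis t - 1 = (cos t - 1)%:C + 'i%C * (sin t)%:C); last first.
  by rewrite /cis rmorphB rmorph1; ring.
rewrite (le_lt_trans (ler_normD _ _)) // normrM !normRC.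
rewrite complex.normc_def /= expr0n expr1n add0r sqrtr1 mul1r [e]splitr rE.
by rewrite -!rmorphD complex.ltcR ltrD // distrC.
Qed.

(** Otherwise the powers of [x] sum to 0, so [12 = |sum (1 - x ^ i)| <= 66 |x - 1| < 66 / 7]. The
    lemma identifies branches that agree up to a twelfth root of unity. *)
Lemma unity_near1 (x : C) : x ^+ 12 = 1 -> `|x - 1| < 7^-1 -> x = 1.
Proof.
move=> x12 x1; apply/eqP; rewrite -subr_eq0.
have nx : `|x| = 1.
  by apply/eqP; rewrite -(@pexpr_eq1 _ _ 12) // -normrX x12 normr1.
have /eqP : (x - 1) * \sum_(i < 12) x ^+ i = 0 by rewrite -subrX1 x12 subrr.
rewrite mulf_eq0 => /orP[//|/eqP S0].
have B i : `|1 - x ^+ i| <= i%:R * `|x - 1|.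
  elim: i => [|i IH]; first by rewrite expr0 subrr normr0 mul0r.
  rewrite exprS (_ : 1 - _ = (1 - x) + x * (1 - x ^+ i)); last by ring.
  rewrite (le_trans (ler_normD _ _)) // normrM nx mul1r -natr1 mulrDl mul1r addrC.
  by rewrite lerD // distrC.
have : 12 <= 66 * `|x - 1|.
  have <- : `|\sum_(i < 12) (1 - x ^+ i)| = 12.
    by rewrite sumrB S0 subr0 sumr_const card_ord normr_nat.
  rewrite (le_trans (ler_norm_sum _ _ _)) // (le_trans (ler_sum _ (fun (i : 'I_12) _ => B i))) //.
  rewrite -mulr_suml -natr_sum (_ : (\sum_(i < 12) i = 66)%N) //.
  by rewrite !big_ord_recl big_ord0.
move=> H; exfalso; have : 12 < 66 / 7 :> C.
  by rewrite (le_lt_trans H) // ltr_pM2l.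
by rewrite ltr_pdivlMr // -natrM ltr_nat.
Qed.

(** The function [(1 + X) ^ (m / 12)]. The relation [(1 + X) f' = q f] is differentiated once to
    reach the second-order shape of [frobenius], and is recovered from the initial values. *)
Lemma power_near1 (m : nat) : exists (r : R) (f : C -> C), [/\ 0 < r, f 0 = 1 &
  forall X, `|X| < r%:C -> [/\ 1 + X != 0,
    is_derive X 1 f (m%:R / 12 * f X / (1 + X)) & f X ^+ 12 = (1 + X) ^+ m]].
Proof.
pose q : C := m%:R / 12.
pose A : {poly C} := 'X + 'X^2; pose B : {poly C} := (1 - q)%:P * 'X.
have A0 : A`_0 = 0 by rewrite coefD coefX coefXn addr0.
have A1 : A`_1 = 1 by rewrite coefD coefX coefXn addr0.
have B0 : 0 <= B`_0 by rewrite coefMX.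
have ind : B`_0 * q + (0 : {poly C})`_0 * 1 = 0 by rewrite coefMX coef0 !mul0r addr0.
have [r0 [f [f1 [f2 [f3 [r00 fa fb H _]]]]]] := frobenius A0 A1 B0 ind.
have r00C : 0 < r0%:C by rewrite -[0]/(0%:C) complex.ltcR.
have [r r_gt0 /andP[rr0 r1]] := minor2 r00 ltr01.
have rr0C (X : C) : `|X| < r%:C -> `|X| < r0%:C by move=> Xr; rewrite (lt_le_trans Xr) // complex.lecR.
have nz (X : C) : `|X| < r%:C -> 1 + X != 0.
  move=> Xr; rewrite addrC addr_eq0; apply: contraTneq Xr => ->.
  by rewrite normrN normr1 -real_leNgt ?realRC ?real1 // -[1]/(1%:C) complex.lecR.
have ode (X : C) : `|X| < r0%:C -> (1 + X) * f2 X + (1 - q) * f1 X = 0.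
  have [d1 d2 d3 _] := H 0 ltac:(by rewrite normr0).
  have D := is_derD (is_derM (is_derD (is_der_cst 1 0) (is_der_id 0)) d3) (is_derZ (1 - q) d2).
  apply: (mulX_eq0_near (K := C) r00C _ D) => Y Yr.
  have [_ _ _] := H Y Yr; rewrite /A /B hornerD hornerX hornerXn hornerM hornerC hornerX horner0 => <-.
  by ring.
have f1E (X : C) : `|X| < r%:C -> (1 + X) * f1 X - q * f X = 0.
  move=> Xr; pose u X := (1 + X) * f1 X - q * f X.
  have du w : `|w - 0| < r%:C -> is_derive w 1 u 0.
    rewrite subr0 => wr; have [d1 d2 d3 _] := H w (rr0C _ wr).
    apply: is_derive_eq (is_derB (is_derM (is_derD (is_der_cst 1 w) (is_der_id w)) d2) (is_derZ q d1)) _.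
    by rewrite -[RHS](ode w (rr0C _ wr)); ring.
  have := deriv0_const du (z := X) ltac:(by rewrite subr0); rewrite /u => ->.
  by rewrite addr0 fa fb mul1r mulr1 subrr.
have df (X : C) : `|X| < r%:C -> is_derive X 1 f (q * f X / (1 + X)).
  move=> Xr; have [d1 _ _ _] := H X (rr0C _ Xr).
  apply: is_derive_eq d1 _; have /eqP := f1E X Xr; rewrite subr_eq0 => /eqP <-.
  by field; exact: nz.
exists r, f; split=> // X Xr; split; [exact: nz | exact: df |].
pose u X := f X ^+ 12 / (1 + X) ^+ m.
have du w : `|w - 0| < r%:C -> is_derive w 1 u 0.
  rewrite subr0 => wr; have w1 := nz w wr.
  have D1 := is_der_Xn m (is_derD (is_der_cst 1 w) (is_der_id w)).
  have w1m : (1 + w) ^+ m != 0 by rewrite expf_neq0.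
  apply: is_derive_eq (is_derM (is_derX 11 (df w wr)) (is_derV (f := fun w => (1 + w) ^+ m) w1m D1)) _.
  rewrite /q; have [->|m0] := eqVneq m 0%N; first by rewrite !(mul0r, mulr0, oppr0, add0r).
  have -> : (1 + w) ^+ m = (1 + w) ^+ m.-1 * (1 + w) by rewrite -exprSr prednK // lt0n.
  have := expf_neq0 m.-1 w1; move: ((1 + w) ^+ m.-1) (m%:R) => v k v0.
  by field; rewrite v0 w1.
have := deriv0_const du (z := X) ltac:(by rewrite subr0); rewrite /u addr0 fa !expr1n divr1.
by move=> /(congr1 ( *%R^~ ((1 + X) ^+ m))); rewrite mul1r divfK // expf_neq0 // nz.
Qed.

Definition circle e (rho : R) t : C := e + rho%:C * cis (2 * pi * t).

(** Local branches of [((z - e) / rho) ^ q] along a circle, normalised by the parameter [t] instead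
    of an argument, so that one full turn multiplies by [cis (2 pi q)]. *)
Definition has_branch (q : R) : Prop := forall e (rho : R) t0, 0 < rho -> exists b : C -> C,
  (\forall z \near circle e rho t0,
     [/\ z != e, b z != 0 & is_derive z 1 b (q%:C * b z / (z - e))]) /\
  \forall t \near t0, b (circle e rho t) = cis (q * (2 * pi * t)).

Lemma has_branch_nat (m : nat) : has_branch (m%:R / 12).
Proof.
move=> e rho t0 rho0; have [r [f [r0 f0 Hf]]] := power_near1 m.
have r0C : 0 < r%:C by rewrite -[0]/(0%:C) complex.ltcR.
have rhoC : rho%:C != 0 by rewrite fmorph_eq0 gt_eqF.
pose X0 := rho%:C * cis (2 * pi * t0).
have X00 : X0 != 0 by rewrite mulf_neq0 // cis_neq0.
pose c0 := cis (m%:R / 12 * (2 * pi * t0)).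
have c00 : c0 != 0 by exact: cis_neq0.
have fn0 (X : C) : `|X| < r%:C -> f X != 0.
  move=> Xr; have [X1 _ fE] := Hf X Xr; apply: contra_eq_neq fE => ->.
  by rewrite expr0n eq_sym expf_neq0.
exists (fun z => c0 * f ((z - e) / X0 - 1)); split.
  apply/near_normP; exists (r%:C * `|X0|); first by rewrite mulr_gt0 // normr_gt0.
  move=> z; rewrite /circle opprD addrA -/X0 => zr.
  have Xr : `|(z - e) / X0 - 1| < r%:C.
    by rewrite -[X in _ - X](mulfV X00) -mulrBl normf_div ltr_pdivrMr // normr_gt0.
  have [X1 df _] := Hf _ Xr.
  have ze : z - e != 0.
    by apply: contra_neq X1 => ->; rewrite mul0r addrC subrK.
  split; [by rewrite -subr_eq0 | by rewrite mulf_neq0 // fn0 |].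
  have D := is_derB (is_derM (is_derB (is_der_id z) (is_der_cst e z)) (is_der_cst X0^-1 z)) (is_der_cst 1 z).
  have D2 := is_derZ c0 (is_derive_comp1 (g := fun w : C => (w - e) / X0 - 1) df D).
  apply: (is_derive_eq D2).
  rewrite /= !(rmorphM, fmorphV, rmorph_nat) (_ : 1 + _ = (z - e) / X0); last by ring.
  by move: (f _) => y; field; rewrite ze X00.
(* Two quantities within 1/14 of 1 differ by less than 1/7, the threshold of [unity_near1]. *)
have e14 : 0 < 14^-1 :> C by rewrite invr_gt0.
have [_ df0 _] := Hf 0 ltac:(by rewrite normr0).
have /near_normP[r1 r10 Hc] := is_der_cont df0 e14.
have [s1 [s10 s1r s1r1]] : exists s1 : C, [/\ 0 < s1, s1 <= r%:C & s1 <= r1].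
  by have [c c0' /andP[]] := minor2 r0C r10; exists c.
have [d1 d10 H1] := cis_cont s10; have [d2 d20 H2] := cis_cont e14.
have k0 : 0 < 2 * pi + 1 :> R by rewrite ltr_wpDl // mulr_ge0 // pi_ge0.
have m0 : 0 < m%:R / 12 + 1 :> R by rewrite ltr_wpDl // mulr_ge0.
have [d d0 /andP[dd1 dd2]] : exists2 d : R, 0 < d & (d <= d1 / (2 * pi + 1)) &&
    (d <= d2 / (m%:R / 12 + 1) / (2 * pi + 1)).
  by apply: minor2; rewrite !divr_gt0.
apply/near_normP; exists d => // t td.
pose th := 2 * pi * (t - t0).
have thd : `|th| <= (2 * pi + 1) * `|t - t0|.
  rewrite /th normrM ger0_norm ?mulr_ge0 ?pi_ge0 // ler_wpM2r //.
  by rewrite lerDl.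
have th1 : `|th| < d1.
  by rewrite (le_lt_trans thd) // mulrC -ltr_pdivlMr // (lt_le_trans td).
have th2 : `|m%:R / 12 * th| < d2.
  rewrite normrM (@le_lt_trans _ _ ((m%:R / 12 + 1) * `|th|)) //.
    by rewrite ler_wpM2r // ger0_norm ?lerDl // mulr_ge0.
  rewrite mulrC -ltr_pdivlMr // (le_lt_trans thd) // mulrC -ltr_pdivlMr //.
  exact: (lt_le_trans td).
have -> : circle e rho t - e = rho%:C * cis (2 * pi * t) by rewrite /circle addrC addKr.
have -> : rho%:C * cis (2 * pi * t) / X0 = cis th.
  have -> : 2 * pi * t = th + 2 * pi * t0 by rewrite /th; ring.
  by rewrite cisD /X0; field; rewrite rhoC cis_neq0.
have C1 := H1 th th1; have C2 := H2 _ th2.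
set X := cis th - 1 in C1 *.
have [X1 _ fE] := Hf X (lt_le_trans C1 s1r).
have f1 : `|f X - 1| < 14^-1 by have := Hc X; rewrite subr0 f0; apply; exact: lt_le_trans C1 s1r1.
set y := cis (m%:R / 12 * th) in C2.
have y0 : y != 0 by exact: cis_neq0.
have y12 : y ^+ 12 = f X ^+ 12.
  rewrite fE /X addrC subrK -cisMn -cisMn; congr cis; rewrite (mulrC _ (12^-1)) !mulrA.
  by rewrite mulfV // mul1r.
(* The power series and the point [y] of the unit circle have equal twelfth powers and are both
   close to 1. *)
have -> : f X = y.
  suff /(congr1 ( *%R^~ y)) : f X / y = 1 by rewrite divfK // mul1r.
  apply: unity_near1; first by rewrite expr_div_n -y12 divff // expf_neq0.
  have -> : f X / y - 1 = (f X - y) / y by rewrite mulrBl divff.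
  rewrite normrM normfV norm_cis invr1 mulr1.
  have -> : f X - y = (f X - 1) - (y - 1) by ring.
  rewrite (le_lt_trans (ler_normB _ _)) // (_ : 7^-1 = 14^-1 + 14^-1); last by field.
  by rewrite ltrD.
by rewrite /c0 /y -cisD; congr cis; rewrite /th; ring.
Qed.

Lemma has_branch_opp (q : R) : has_branch q -> has_branch (- q).
Proof.
move=> H e rho t0 rho0; have [b [Hb bE]] := H e rho t0 rho0.
exists (fun z => (b z)^-1); split.
  apply: filterS Hb => z [ze b0 db]; split; [exact: ze | by rewrite invr_eq0 |].
  apply: is_derive_eq (is_derV b0 db) _; rewrite rmorphN /=.
  by field; rewrite b0 subr_eq0 ze.
by apply: filterS bE => t ->; rewrite cisV mulNr.
Qed.

(** With [b = (z - e) ^ q], the last hypothesis is the equation for [y = b A] divided by [b], where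
    [y' = b (A' + q A / (z - e))]. *)
Lemma sys_gauge (b A a : C -> C) (a2 q e : C) z : z != e -> Ef z != 0 ->
  is_derive z 1 b (q * b z / (z - e)) -> is_derive z 1 A (a z) -> is_derive z 1 a a2 ->
  Ef z * (a2 + 2 * q * a z / (z - e) + q * (q - 1) * A z / (z - e) ^+ 2)
    + dEf z / 2 * (a z + q * A z / (z - e)) - Qf z / 4 * A z = 0 ->
  sys (fun w => b w * A w) (fun w => Ef w * (b w * (a w + q * A w / (w - e)))) z.
Proof.
move=> ze Ez db dA da ode; have ze0 : z - e != 0 by rewrite subr_eq0.
split.
  by apply: is_derive_eq (is_derM db dA) _; field; rewrite Ez ze0.
have di := is_derV (f := fun w => w - e) ze0 (is_derB (is_der_id z) (is_der_cst e z)).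
have D := is_derM (is_derive_Ef z) (is_derM db (is_derD da (is_derM (is_derZ q dA) di))).
apply: is_derive_eq D _; move/eqP: ode; rewrite subr_eq0 => /eqP ode.
transitivity (b z * (Ef z * (a2 + 2 * q * a z / (z - e) + q * (q - 1) * A z / (z - e) ^+ 2)
    + dEf z / 2 * (a z + q * A z / (z - e))) + dEf z / 2 * b z * (a z + q * A z / (z - e))).
  by field.
by rewrite ode; field; rewrite Ez ze0.
Qed.

End Circles.

Section Local_monodromy.
Variable R : realType.
Local Notation C := (Cplx R).
Local Notation "x %:C" := (complex.real_complex R x : C).
Local Notation M2 := 'M[C]_2.
Implicit Types (z w x : C) (t s : R).

Lemma circle_dist e (rho : R) s t : 0 < rho ->
  `|circle e rho s - circle e rho t| = rho%:C * `|cis (2 * pi * (s - t)) - 1|.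
Proof.
move=> rho0; rewrite /circle; have -> : 2 * pi * s = 2 * pi * t + 2 * pi * (s - t) by ring.
rewrite cisD (_ : _ - _ = rho%:C * cis (2 * pi * t) * (cis (2 * pi * (s - t)) - 1)); last first.
  by move: (cis _) (cis _) => x y; ring.
by rewrite !normrM norm_cis mulr1 normRC (gtr0_norm rho0).
Qed.

Lemma circle_cont e (rho : R) t (d : C) : 0 < rho -> 0 < d ->
  \forall s \near t, `|circle e rho s - circle e rho t| < d.
Proof.
move=> rho0 d0; have rhoC : 0 < rho%:C by rewrite -[0]/(0%:C) complex.ltcR.
have [q q0 H] := cis_cont (divr_gt0 d0 rhoC).
have k0 : 0 < 2 * pi :> R by rewrite mulr_gt0 // pi_gt0.
apply/near_normP; exists (q / (2 * pi)); first by rewrite divr_gt0.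
move=> s st; rewrite circle_dist // mulrC -ltr_pdivlMr //; apply: H.
by rewrite normrM (gtr0_norm k0) mulrC -ltr_pdivlMr.
Qed.

Lemma near_annulus e (rho1 rho rho2 : R) t : 0 < rho -> rho1 < rho < rho2 ->
  \forall z \near circle e rho t, rho1%:C < `|z - e| < rho2%:C.
Proof.
move=> rho0 /andP[r1 r2].
have D : `|circle e rho t - e| = rho%:C.
  by rewrite /circle addrC addKr normrM norm_cis mulr1 normRC gtr0_norm.
have [d d0 /andP[d1 d2]] : exists2 d : R, 0 < d & (d <= rho - rho1) && (d <= rho2 - rho).
  by apply: minor2; rewrite subr_gt0.
apply/near_normP; exists d%:C; first by rewrite -[0]/(0%:C) complex.ltcR.
move=> z zd; apply/andP; split.
  have : rho%:C - `|z - circle e rho t| <= `|z - e|.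
    rewrite lerBlDr -D (_ : circle e rho t - e = (z - e) - (z - circle e rho t)); last by ring.
    exact: ler_normB.
  apply: lt_le_trans; rewrite ltrBrDr -ltrBrDl -rmorphB (lt_le_trans zd) //.
  by rewrite complex.lecR.
rewrite (_ : z - e = (z - circle e rho t) + (circle e rho t - e)); last by ring.
rewrite (le_lt_trans (ler_normD _ _)) // D -ltrBrDr -rmorphB (lt_le_trans zd) //.
by rewrite complex.lecR.
Qed.

Section Frame.
Variables (e : C) (q : 'I_2 -> R) (A a : 'I_2 -> C -> C).

(** Jets of the solutions [(z - e) ^ (q j) * A j], with the value of the power factored out as the
    parameter [b]: continuation around the circle affects [b] alone. *)
Definition frame (b : 'I_2 -> C) z : M2 := \matrix_(j, k)
  if k == 0 then b j * A j z else Ef z * (b j * (a j z + (q j)%:C * A j z / (z - e))).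

Lemma frame0 b z j : frame b z j 0 = b j * A j z.
Proof. by rewrite mxE. Qed.

Lemma frame1 b z j : frame b z j 1 = Ef z * (b j * (a j z + (q j)%:C * A j z / (z - e))).
Proof. by rewrite mxE. Qed.

Definition diag2 (u v : C) : M2 := \matrix_(i, j) if i == j then (if i == 0 then u else v) else 0.

Lemma diag2E u v (P : M2) k : ((diag2 u v *m P) 0 k = u * P 0 k) *
  ((diag2 u v *m P) 1 k = v * P 1 k).
Proof. by rewrite !mul2E !mxE /= !mul0r add0r addr0. Qed.

(** The functions [A j] are single-valued on the circle, so after one turn row [j] has only acquired
    the factor of its power. *)
Lemma circle_monodromy (rho : R) (a2 : 'I_2 -> C -> C) : 0 < rho ->
  (forall j, has_branch (q j)) ->
  (forall t, \forall z \near circle e rho t, Ef z != 0 /\ forall j,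
     [/\ is_derive z 1 (A j) (a j z), is_derive z 1 (a j) (a2 j z) &
      Ef z * (a2 j z + 2 * (q j)%:C * a j z / (z - e)
        + (q j)%:C * ((q j)%:C - 1) * A j z / (z - e) ^+ 2)
      + dEf z / 2 * (a j z + (q j)%:C * A j z / (z - e)) - Qf z / 4 * A j z = 0]) ->
  let P := frame (fun=> 1) (e + rho%:C) in
  transported (e + rho%:C) P (e + rho%:C)
    (diag2 (cis (q 0 * (2 * pi))) (cis (q 1 * (2 * pi))) *m P).
Proof.
move=> rho0 hb H P.
have c0 : circle e rho 0 = e + rho%:C by rewrite /circle mulr0 cis0 mulr1.
have c1 : circle e rho 1 = e + rho%:C by rewrite /circle mulr1 cis_2pi mulr1.
exists (circle e rho), (fun t => frame (fun j => cis (q j * (2 * pi * t))) (circle e rho t)).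
split; [|exact: c0|exact: c1| |].
- split=> t tI.
    split; first by have [] := nbhs_singleton (H t).
    by move=> d d0; apply: filterS (circle_cont e t rho0 d0) => s + _.
  have [b0 [B0 E0]] := hb 0 e rho t rho0; have [b1 [B1 E1]] := hb 1 e rho t rho0.
  pose b (j : 'I_2) := if j == 0 then b0 else b1.
  exists (fun z => frame (fun j => b j z) z); split; last first.
    by apply: filterS2 E0 E1 => s e0 e1 _; apply: eq_mx2 => j; rewrite !frame0 !frame1 /b;
      have [->|->] := ord2_cases j; rewrite /= ?e0 ?e1.
  apply: filterS3 B0 B1 (H t) => z [ze b0z db0] [_ b1z db1] [Ez Hz] j.
  under eq_fun do rewrite frame0; under [X in sys _ X]eq_fun do rewrite frame1.
  have [d1 d2 ode] := Hz j; apply: (sys_gauge ze Ez _ d1 d2 ode).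
  by rewrite /b; have [->|->] := ord2_cases j.
- rewrite /P c0; apply: eq_mx2 => j; rewrite !frame0 !frame1 !mulr0 cis0.
  by split.
rewrite c1 /P; apply: eq_mx2 => j; rewrite !frame0 !frame1 mulr1.
have [->|->] := ord2_cases j; rewrite !diag2E !frame0 !frame1 !mul1r; split=> //;
 by rewrite mulrCA.
Qed.

Lemma frame_real (rho : R) : e \is Num.real -> 
  (forall j, (A j (e + rho%:C) \is Num.real) && (a j (e + rho%:C) \is Num.real)) ->
  conjmx2 (frame (fun=> 1) (e + rho%:C)) = frame (fun=> 1) (e + rho%:C).
Proof.
move=> re H; apply: eq_mx2 => j; rewrite !conjmx2E !frame0 !frame1.
have /andP[/CrealP hA /CrealP ha] := H j; have /CrealP he := re.
rewrite (_ : e + rho%:C - e = rho%:C); last by rewrite addrC addKr.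
have hE : (Ef (e + rho%:C))^* = Ef (e + rho%:C) by rewrite conj_Ef rmorphD /= he conjRC.
move: (Ef _) hE => y hE; rewrite !mul1r.
by rewrite rmorphM rmorphD !rmorphM fmorphV /= !conjRC hE hA ha.
Qed.

Lemma frame_unit (rho : R) : Ef (e + rho%:C) != 0 -> rho != 0 ->
  ((q 1)%:C - (q 0)%:C) * (A 0 (e + rho%:C) * A 1 (e + rho%:C)) + rho%:C *
   (A 0 (e + rho%:C) * a 1 (e + rho%:C) - A 1 (e + rho%:C) * a 0 (e + rho%:C)) != 0 ->
  frame (fun=> 1) (e + rho%:C) \in unitmx.
Proof.
move=> E0 r0 H; have rC : rho%:C != 0 by rewrite fmorph_eq0.
rewrite unitmx2 !frame0 !frame1 !mul1r.
rewrite (_ : e + rho%:C - e = rho%:C); last by rewrite addrC addKr.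
move: H (Ef _) E0; set X := (X in X != 0 -> _) => X0 E E0.
rewrite (_ : _ - _ = E / rho%:C * X) ?mulf_neq0 ?invr_eq0 //.
by rewrite /X; field.
Qed.
End Frame.

Definition real_coefs (p : {poly C}) : Prop := forall i, p`_i \is Num.real.

Lemma real_coefsD p q : real_coefs p -> real_coefs q -> real_coefs (p + q).
Proof. by move=> hp hq i; rewrite coefD rpredD. Qed.

Lemma real_coefsN p : real_coefs p -> real_coefs (- p).
Proof. by move=> hp i; rewrite coefN rpredN. Qed.

Lemma real_coefsM p q : real_coefs p -> real_coefs q -> real_coefs (p * q).
Proof. by move=> hp hq i; rewrite coefM rpred_sum // => j _; rewrite rpredM. Qed.

Lemma real_coefsZ (c : C) p : c \is Num.real -> real_coefs p -> real_coefs (c *: p).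
Proof. by move=> hc hp i; rewrite coefZ rpredM. Qed.

Lemma real_coefsC (c : C) : c \is Num.real -> real_coefs c%:P.
Proof. by move=> hc i; rewrite coefC; case: ifP. Qed.

Lemma real_coefsXn n : real_coefs 'X^n.
Proof. by move=> i; rewrite coefXn. Qed.

Lemma real_coefsX : real_coefs 'X.
Proof. exact: real_coefsXn 1. Qed.

(** Radius, series and its two derivatives are packed into one pair, so that a single choice over
    the two exponents provides all of them. *)
Definition series_at (A B D : {poly C}) (d : R * (nat -> C -> C)) : Prop :=
  [/\ 0 < d.1, d.2 0%N 0 = 1,
    forall X : C, `|X| < d.1%:C -> [/\ is_derive X 1 (d.2 0%N) (d.2 1%N X),
      is_derive X 1 (d.2 1%N) (d.2 2%N X) &
      A.[X] * d.2 2%N X + B.[X] * d.2 1%N X + D.[X] * d.2 0%N X = 0] &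
    forall X : C, X \is Num.real -> `|X| < d.1%:C ->
      (d.2 0%N X \is Num.real) && (d.2 1%N X \is Num.real)].

Lemma series_exists (A B D : {poly C}) : A`_0 = 0 -> A`_1 = 1 -> 0 < B`_0 ->
  real_coefs A -> real_coefs B -> real_coefs D ->
  exists d, series_at A B D d.
Proof.
move=> A0 A1 B0 rA rB rD.
have ind : B`_0 * (- D`_0 / B`_0) + D`_0 * 1 = 0 by field; rewrite gt_eqF.
have [r [f [f1 [f2 [f3 [r0 fa _ H real]]]]]] := frobenius A0 A1 (ltW B0) ind.
exists (r, fun n => match n with 0 => f | 1 => f1 | _ => f2 end).
split=> [||X /H[d1 d2 _ E]|]; [exact: r0 | exact: fa | by split |].
by apply: real; split=> //; rewrite real1 rpredM ?rpredN ?rpredV.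
Qed.

Lemma is_der_horner (p : {poly C}) (z : C) : is_derive z 1 (fun x => p.[x]) p^`().[z].
Proof.
elim/poly_ind: p => [|p c IH].
  by under eq_fun do rewrite horner0; rewrite deriv0 horner0; exact: is_der_cst.
under eq_fun do rewrite hornerMXaddC.
apply: is_derive_eq (is_derD (is_derM IH (is_der_id z)) (is_der_cst c z)) _.
by rewrite derivMXaddC hornerD hornerMX; ring.
Qed.

(** At [X = 0] the expression equals [c]. With [c] the difference of the exponents, it is the
    determinant of a frame up to a nonzero factor, so frames on suitable circles are invertible. *)
Lemma series_at_unit (s : C) A B D A' B' D' d d' (c : C) : series_at A B D d ->
  series_at A' B' D' d' -> c != 0 -> \forall X \near (0 : C),
  c * (d.2 0%N X * d'.2 0%N X) +
    s * X * (d.2 0%N X * d'.2 1%N X - d'.2 0%N X * d.2 1%N X) != 0.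
Proof.
move=> [r0 u0 H _] [r0' v0 H' _] c0.
have [|D0 D1 _] := H 0; first by rewrite normr0 -[0]/(0%:C) complex.ltcR.
have [|D0' D1' _] := H' 0; first by rewrite normr0 -[0]/(0%:C) complex.ltcR.
have D2 := is_derD (is_derZ c (is_derM D0 D0')) (is_derM (is_derZ s (is_der_id 0))
  (is_derB (is_derM D0 D1') (is_derM D0' D1))).
by apply: (is_der_neq0 D2); rewrite u0 v0 mulr0 mul0r addr0 !mulr1.
Qed.

Lemma near_lt (d : R) : 0 < d -> \forall X \near (0 : C), `|X| < d%:C.
Proof.
move=> d0; apply/near_normP; exists d%:C; first by rewrite -[0]/(0%:C) complex.ltcR.
by move=> z; rewrite subr0.
Qed.

Lemma near_real_radius (Q : C -> Prop) : (\forall X \near (0 : C), Q X) ->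
  exists2 d : R, 0 < d & forall X, `|X| < d%:C -> Q X.
Proof.
move=> /near_normP[r r0 H]; have [d d0 rE] := real_complexE' r0.
by exists d => // X; rewrite -rE => Xr; apply: H; rewrite subr0.
Qed.

Definition polyE := (hornerD, hornerN, hornerM, hornerZ, hornerC, hornerX, hornerXn).

Ltac real_poly := repeat match goal with
  | |- real_coefs (_ + _) => apply: real_coefsD
  | |- real_coefs (- _) => apply: real_coefsN
  | |- real_coefs (_ *: _) => apply: real_coefsZ
  | |- real_coefs (_ * _) => apply: real_coefsM
  | |- real_coefs (_%:P) => apply: real_coefsC
  | |- real_coefs 'X => exact: real_coefsX
  | |- real_coefs 'X^_ => exact: real_coefsXn
  | |- is_true (_ + _ \in _) => apply: rpredD
  | |- is_true (- _ \in _) => rewrite rpredN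
  | |- is_true (_ * _ \in _) => apply: rpredM
  | |- is_true (_^-1 \in _) => rewrite rpredV
  | |- is_true (_ ^+ _ \in _) => apply: rpredX
  | |- is_true (1 \in _) => exact: real1
  | |- is_true (_%:R \in _) => exact: realn
  | _ => assumption
  end.

Lemma local_root (r : R) : Er r = 0 -> 0 < 3 * r ^+ 2 - 20 / 3 ->
  exists (x1 : R) (P1 : M2), [/\ r < x1, conjmx2 P1 = P1, P1 \in unitmx &
    transported x1%:C P1 x1%:C (diag2 1 (-1) *m P1)].
Proof.
move=> rE E1; pose e := r%:C; pose k := 3 * e ^+ 2 - 20 / 3.
have re : e \is Num.real by exact: realRC.
have k0 : 0 < k.
  suff -> : k = (3 * r ^+ 2 - 20 / 3)%:C by rewrite -[0]/(0%:C) complex.ltcR.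
  by rewrite !(rmorph_nat, rmorphXn, fmorphV, rmorphB, rmorphM).
have Ee : Ef e = 0 by rewrite Ef_real rE rmorph0.
(* The exponents 0 and 1/2, written as twelfths for [has_branch_nat]. *)
pose q (j : 'I_2) : R := if j == 0 then 0%:R / 12 else 6%:R / 12.
have qE j : (q j)%:C * ((q j)%:C - 1 / 2) = 0.
  rewrite /q; case: ifP => _; rewrite !(rmorph_nat, fmorphV, rmorphM) /=; by field.
have q0 j : 0 <= (q j)%:C.
  by rewrite -[0]/(0%:C) complex.lecR /q; case: ifP => _; rewrite divr_ge0.
pose G : {poly C} := k%:P + (3 * e) *: 'X + 'X^2; pose G' : {poly C} := (3 * e)%:P + 2 *: 'X.
have rk := gtr0_real k0; have rq j := ger0_real (q0 j).
have rQe : Qf e \is Num.real by rewrite /Qf; real_poly.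
have rG : real_coefs G.
  by rewrite /G; real_poly.
have rG' : real_coefs G'.
  by rewrite /G'; real_poly.
pose Q : {poly C} := (Qf e)%:P + (7 / 36) *: 'X.
have rQ : real_coefs Q.
  by rewrite /Q; real_poly.
have GE X : G.[X] = k + 3 * e * X + X ^+ 2 by rewrite /G !polyE.
have G'E X : G'.[X] = 3 * e + 2 * X by rewrite /G' !polyE.
have QE X : Q.[X] = Qf (e + X) by rewrite /Q !polyE /Qf; ring.
clearbody G G' Q.
have G0 : G.[0] = k by rewrite GE expr0n /= mulr0 !addr0.
(* The equation for the factor multiplying [X ^ q], divided by [k], where [Ef (e + X) = X * G]. The
   remaining term [q (q - 1/2) G / X] is removed by the indicial equation [qE]. *)
pose A : {poly C} := k^-1 *: ('X * G).
pose B (j : 'I_2) : {poly C} := k^-1 *: ((2 * (q j)%:C + 1 / 2) *: G + (1 / 2) *: ('X * G')).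
pose D (j : 'I_2) : {poly C} := k^-1 *: (((q j)%:C / 2) *: G' - 4^-1 *: Q).
have sol j : exists d, series_at A (B j) (D j) d.
  apply: series_exists.
  - by rewrite coefZ coefXM mulr0.
  - by rewrite coefZ coefXM -horner_coef0 G0 mulVf // gt_eqF.
  - rewrite -horner_coef0 !polyE G0 mul0r mulr0 addr0 mulrCA mulVf ?gt_eqF // mulr1.
    by rewrite ltr_wpDl // mulr_ge0.
  - by rewrite /A; real_poly.
  - by rewrite /B; real_poly.
  - by rewrite /D; real_poly.
have [d Hd] := boolp.choice sol.
pose u j n (X : C) : C := (d j).2 n X.
have [[r00 _ _ _] [r10 _ _ _]] := (Hd 0, Hd 1).
have k20 : 1 / 2 != 0 :> C by rewrite mul1r invr_eq0.
have nG : \forall X \near (0 : C), G.[X] != 0.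
  apply: (is_der_neq0 (f := fun X => G.[X]) (is_der_horner G 0)).
  by rewrite G0 gt_eqF.
have [d0 d00 near0] := near_real_radius (filterI (filterI (near_lt r00) (near_lt r10))
  (filterI nG (series_at_unit 1 (Hd 0) (Hd 1) k20))).
pose rho := d0 / 2; have rho0 : 0 < rho by rewrite divr_gt0.
have rhod : rho < d0 by rewrite /rho; lra.
have rhoC : `|rho%:C| < d0%:C by rewrite normRC gtr0_norm // complex.ltcR.
have near_j (X : C) : `|X| < d0%:C -> forall j, `|X| < (d j).1%:C.
  by move=> /near0[[l0 l1] _] j; have [->|->] := ord2_cases j.
have EX (X : C) : Ef (e + X) = X * G.[X] by rewrite GE -[LHS]subr0 -Ee /k /Ef; ring.
pose P := frame e q (fun j z => u j 0%N (z - e)) (fun j z => u j 1%N (z - e)) (fun=> 1) (e + rho%:C).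
have addK : e + rho%:C - e = rho%:C by rewrite addrC addKr.
exists (r + rho), P; rewrite rmorphD /= -/e; split.
- by rewrite ltrDl.
- apply: frame_real => // j; rewrite addK; have [_ _ _ rj] := Hd j.
  by apply: rj; [exact: realRC | exact: near_j].
- have [_ [Gn phin]] := near0 _ rhoC; apply: frame_unit.
  + by rewrite EX mulf_neq0 // fmorph_eq0 gt_eqF.
  + by rewrite gt_eqF.
  rewrite addK; move: phin; congr (_ != 0); rewrite /u /q /=.
  by rewrite !(rmorph_nat, fmorphV, rmorphM) /=; field.
have -> : diag2 1 (-1) = diag2 (cis (q 0 * (2 * pi))) (cis (q 1 * (2 * pi))).
  rewrite /q /= !mul0r cis0 (_ : 6 / 12 * (2 * pi) = pi) ?cis_pi //.
  by move: (pi : R) => x; field.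
apply: (circle_monodromy (a2 := fun j z => u j 2%N (z - e)) rho0) => [j|t].
  by rewrite /q; case: ifP => _; exact: has_branch_nat.
have : 0 < rho < d0 by rewrite rho0.
move=> /(near_annulus e t rho0); apply: filterS => z /andP[X0 Xd].
have {X0}Xn : z - e != 0 by rewrite -normr_gt0.
have Ez : Ef z = (z - e) * G.[z - e] by rewrite -EX addrC subrK.
have [_ [Gn _]] := near0 _ Xd.
split; first by rewrite Ez mulf_neq0.
move=> j; have [_ _ /(_ _ (near_j _ Xd j))[D1 D2 ode] _] := Hd j.
split; [exact: is_der_shift | exact: is_der_shift |].
have zE : z = e + (z - e) by rewrite addrC subrK.
have dE : dEf z = G.[z - e] + (z - e) * G'.[z - e].
  by rewrite GE G'E /dEf /k; ring.
have QE' : Qf z = Q.[z - e] by rewrite QE -zE.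
move: ode; rewrite /A /B /D !polyE -!/(u j _ _) Ez dE QE'.
move: (qE j) (G.[_]) (G'.[_]) (Q.[_]) (u j 0%N _) (u j 1%N _) (u j 2%N _) Xn.
move: ((q j)%:C) (z - e) => s X s0 g g' w y y1 y2 Xn ode.
transitivity (k * (k^-1 * (X * g) * y2 + k^-1 * ((2 * s + 1 / 2) * g + 1 / 2 * (X * g')) * y1 +
  k^-1 * (s / 2 * g' - 4^-1 * w) * y) + s * (s - 1 / 2) * (g * y / X)); last first.
  by rewrite s0 ode mulr0 mul0r addr0.
by field; rewrite Xn gt_eqF.
Qed.

(** A large circle around 0 is a loop around infinity, and solutions [z ^ q * u (1 / z)] are
    expanded in [1 / z]. The exponents solve [q ^ 2 + q / 2 = l (l + 1) / 4], where [l = 1/6]. *)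
Lemma local_infinity (r : R) : r < 0 -> exists (x2 : R) (P2 : M2),
  [/\ r < x2, conjmx2 P2 = P2, P2 \in unitmx & transported x2%:C P2 x2%:C
    (diag2 (cis (1%:R / 12 * (2 * pi))) (cis (- (7%:R / 12) * (2 * pi))) *m P2)].
Proof.
move=> r_lt0; pose q (j : 'I_2) : R := if j == 0 then 1%:R / 12 else - (7%:R / 12).
have qE j : (q j)%:C ^+ 2 + (q j)%:C / 2 = 7 / 144.
  rewrite /q; case: ifP => _; rewrite !(rmorph_nat, rmorphN, fmorphV, rmorphM) /=; by field.
have q0 j : 0 < 2^-1 - 2 * (q j)%:C.
  have -> : 2^-1 - 2 * (q j)%:C = (2^-1 - 2 * q j)%:C.
    by rewrite !(rmorph_nat, fmorphV, rmorphB, rmorphM).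
  by rewrite -[0]/(0%:C) complex.ltcR /q; case: ifP => _; lra.
have rq j : (q j)%:C \is Num.real by exact: realRC.
pose W : {poly C} := 1%:P + (- (20 / 3)) *: 'X^2 + (20 / 3) *: 'X^3.
pose V : {poly C} := 3%:P + (- (20 / 3)) *: 'X^2.
have rW : real_coefs W by rewrite /W; real_poly.
have rV : real_coefs V by rewrite /V; real_poly.
have WE X : W.[X] = 1 - 20 / 3 * X ^+ 2 + 20 / 3 * X ^+ 3 by rewrite /W !polyE; ring.
have VE X : V.[X] = 3 - 20 / 3 * X ^+ 2 by rewrite /V !polyE; ring.
clearbody W V.
have W0 : W.[0] = 1 by rewrite WE !expr0n /= !mulr0 subr0 addr0.
(* The equation for [u] in [X = 1 / z], where [Ef z = z ^ 3 W] and [dEf z = z ^ 2 V]; the term of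
   order [z u] is removed by [qE]. *)
pose A : {poly C} := 'X * W.
pose B (j : 'I_2) : {poly C} := (2 - 2 * (q j)%:C) *: W - 2^-1 *: V.
pose D (j : 'I_2) : {poly C} := ((q j)%:C * ((q j)%:C - 1)) *:
  ((- (20 / 3)) *: 'X + (20 / 3) *: 'X^2) + (- (10 / 3) * (q j)%:C) *: 'X + (36^-1)%:P.
have sol j : exists d, series_at A (B j) (D j) d.
  apply: series_exists.
  - by rewrite coefXM.
  - by rewrite coefXM -horner_coef0 W0.
  - rewrite -horner_coef0 !polyE W0 VE expr0n /= mulr0 subr0 mulr1.
    by rewrite (_ : _ - _ = 2^-1 - 2 * (q j)%:C) //; field.
  - by rewrite /A; real_poly.
  - by rewrite /B; real_poly.
  - by rewrite /D; real_poly.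
have [d Hd] := boolp.choice sol.
pose u j n (X : C) : C := (d j).2 n X.
have [[r00 _ _ _] [r10 _ _ _]] := (Hd 0, Hd 1).
have k20 : (q 1)%:C - (q 0)%:C != 0 :> C.
  by rewrite -rmorphB fmorph_eq0 /q /= lt_eqF //; lra.
have nW : \forall X \near (0 : C), W.[X] != 0.
  apply: (is_der_neq0 (f := fun X => W.[X]) (is_der_horner W 0)).
  by rewrite W0 oner_neq0.
have [d0 d00 near0] := near_real_radius (filterI (filterI (near_lt r00) (near_lt r10))
  (filterI nW (series_at_unit (-1) (Hd 0) (Hd 1) k20))).
pose rho := 2 / d0; have rho0 : 0 < rho by rewrite divr_gt0.
have rhod : d0^-1 < rho by rewrite /rho mulr_natl mulr2n ltrDl invr_gt0.
have rhon : rho%:C != 0 by rewrite fmorph_eq0 gt_eqF.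
have rhoC : `|rho%:C^-1| < d0%:C.
  by rewrite -fmorphV normRC gtr0_norm ?invr_gt0 // complex.ltcR -[ltRHS]invrK ltf_pV2 // posrE invr_gt0.
have near_j (X : C) : `|X| < d0%:C -> forall j, `|X| < (d j).1%:C.
  by move=> /near0[[l0 l1] _] j; have [->|->] := ord2_cases j.
have EX (z : C) : z != 0 -> Ef z = z ^+ 3 * W.[z^-1].
  by move=> z0; rewrite WE /Ef; field.
pose P := frame 0 q (fun j z => u j 0%N z^-1) (fun j z => - u j 1%N z^-1 / z ^+ 2) (fun=> 1) (0 + rho%:C).
exists rho, P; rewrite -[X in transported X]add0r -[X in transported _ _ X]add0r; split.
- exact: lt_trans rho0.
- apply: frame_real => [|j]; first exact: real0.
  rewrite add0r; have [_ _ _ rj] := Hd j.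
  have /andP[h1 h2] : (u j 0%N rho%:C^-1 \is Num.real) && (u j 1%N rho%:C^-1 \is Num.real).
    by apply: rj; [rewrite rpredV; exact: realRC | exact: near_j].
  by rewrite h1 rpredM ?rpredN // rpredV rpredX // realRC.
- have [_ [Wn phin]] := near0 _ rhoC; apply: frame_unit.
  + by rewrite add0r EX // mulf_neq0 // expf_neq0.
  + by rewrite gt_eqF.
  rewrite add0r; move: phin; congr (_ != 0); rewrite -!/(u _ _ _).
  by move: (u _ _ _) (u _ _ _) (u _ _ _) (u _ _ _) => a b a' b'; field.
apply: (circle_monodromy (a2 := fun j z => u j 2%N z^-1 / z ^+ 4 + 2 * u j 1%N z^-1 / z ^+ 3) rho0) => [j|t].
  by rewrite /q; case: ifP => _; [|apply: has_branch_opp]; exact: has_branch_nat.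
have : d0^-1 < rho < rho + 1 by rewrite rhod ltrDl ltr01.
move=> /(near_annulus 0 t rho0); apply: filterS => z; rewrite subr0 => /andP[Xd _].
have zn : z != 0.
  by rewrite -normr_gt0 (lt_trans _ Xd) // -[0]/(0%:C) complex.ltcR invr_gt0.
have {}Xd : `|z^-1| < d0%:C.
  rewrite normfV -[ltRHS]invrK ltf_pV2 ?posrE ?normr_gt0 //.
    by rewrite -fmorphV.
  by rewrite invr_gt0 -[0]/(0%:C) complex.ltcR.
have Ez := EX z zn; have [_ [Wn _]] := near0 _ Xd.
split; first by rewrite Ez mulf_neq0 // expf_neq0.
move=> j; have [_ _ /(_ _ (near_j _ Xd j))[D1 D2 ode] _] := Hd j.
have dV := is_derV (f := fun w : C => w) zn (is_der_id z).
have D3 := is_derive_comp1 (g := fun w : C => w^-1) D1 dV.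
have D4 := is_derive_comp1 (g := fun w : C => w^-1) D2 dV.
have z2 : z ^+ 2 != 0 by rewrite expf_neq0.
have D5 := is_derV (f := fun w : C => w ^+ 2) z2 (is_derX 1 (is_der_id z)).
split.
- by apply: is_derive_eq D3 _; rewrite -/(u j 1%N _); field.
- by apply: is_derive_eq (is_derM (is_derN D4) D5) _; rewrite /= /u;
  move: ((d j).2 1%N _) ((d j).2 2%N _) => y1 y2; field.
move: ode; rewrite /A /B /D !polyE -!/(u j _ _) Ez VE WE /dEf /Qf.
move: (qE j) (u j 0%N _) (u j 1%N _) (u j 2%N _).
move: ((q j)%:C) => s sE y y1 y2 ode.
rewrite -[RHS]ode; apply/eqP; rewrite -subr_eq0; apply/eqP.
transitivity ((s ^+ 2 + s / 2 - 7 / 144) * y * z).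
  by field.
by rewrite sE subrr !mul0r.
Qed.

End Local_monodromy.

(** * Normal forms in the icosahedral group *)

Section Codes.
Variable G : groupType.
Variables d u s : G.
Local Open Scope group_scope.

(** Rewriting rules: [u] moves past [d] and [s], and each [s * d ^ i * s] is replaced by a word
    containing [s] once. They suffice to multiply normal forms. *)
Definition icosahedral_relations : Prop :=
  [/\ d ^+ 5 = 1, u * u = 1, s * s = 1, u * s = s * u & u * d = d ^+ 4 * u] /\
  [/\ s * d * s = d ^+ 4 * s * d ^+ 4, s * d ^+ 2 * s = d ^+ 2 * (s * u) * d ^+ 2,
      s * d ^+ 3 * s = d ^+ 3 * (s * u) * d ^+ 3 & s * d ^+ 4 * s = d * s * d].

(** With exponents below 5 there are 10 words without [s] and 50 with it. Multiplication of codes is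
    computable, so statements about the group become finite checks. *)
Definition code : Type := (bool * option nat * nat)%type.

Definition code_val (c : code) : G := let: (b, o, k) := c in
  (if o is Some j then d ^+ j * s else 1) * (if b then u else 1) * d ^+ k.

(** Moving [d ^ m] past [u] inverts it; modulo 5 the factor 4 stands for -1. *)
Definition twist (b : bool) (m : nat) : nat := if b then (4 * m)%N else m.

Definition step_d (c : code) : code := let: (b, o, k) := c in
  if o is Some j then (b, Some (j.+1 %% 5)%N, k) else (b, None, ((twist b 1 + k) %% 5)%N).

Definition step_u (c : code) : code := let: (b, o, k) := c in
  (~~ b, if o is Some j then Some ((4 * j) %% 5)%N else None, k).

Definition step_s (c : code) : code := let: (b, o, k) := c in
  if o is Some j then match (j %% 5)%N with
    | 0 => (b, None, k)
    | 1 => (b, Some 4%N, ((twist b 4 + k) %% 5)%N)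
    | 2 => (~~ b, Some 2%N, ((twist b 2 + k) %% 5)%N)
    | 3 => (~~ b, Some 3%N, ((twist b 3 + k) %% 5)%N)
    | _ => (b, Some 1%N, ((twist b 1 + k) %% 5)%N)
    end else (b, Some 0%N, k).

Definition code_mul (c c' : code) : code := let: (b, o, k) := c in
  let c1 := iter k step_d c' in
  let c2 := if b then step_u c1 else c1 in
  if o is Some j then iter j step_d (step_s c2) else c2.

Hypothesis rel : icosahedral_relations.

Lemma expd_mod n : d ^+ (n %% 5) = d ^+ n.
Proof.
case: rel => [[d5 _ _ _ _] _].
by rewrite [in RHS](divn_eq n 5) expgD mulnC expgM d5 expg1n mul1g.
Qed.

Lemma u_expd n : u * d ^+ n = d ^+ (4 * n) * u.
Proof.
case: rel => [[_ _ _ _ ud] _]; elim: n => [|n IH]; first by rewrite muln0 !expg0 mul1g mulg1.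
by rewrite expgSr mulgA IH -mulgA ud mulgA -expgD mulnS addnC.
Qed.

Lemma expd_twist b n : d ^+ n * (if b then u else 1) = (if b then u else 1) * d ^+ twist b n.
Proof.
case: b => /=; last by rewrite mulg1 mul1g.
rewrite u_expd mulnA -expd_mod -[in RHS]expd_mod; congr (d ^+ _ * u).
by rewrite -[in RHS]modnMml mul1n.
Qed.

Lemma u_negb b : u * (if b then u else 1) = if ~~ b then u else 1.
Proof. by case: rel => [[_ uu _ _ _] _]; case: b; rewrite ?mulg1. Qed.

Lemma step_dP c : code_val (step_d c) = d * code_val c.
Proof.
case: c => [[b [j|] k]] /=; first by rewrite expd_mod expgS !mulgA.
by rewrite mul1g expd_mod expgD !mulgA -expd_twist expg1.
Qed.

Lemma step_uP c : code_val (step_u c) = u * code_val c.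
Proof.
case: rel => [[_ uu _ us _] _]; case: c => [[b [j|] k]] /=; last by rewrite !mul1g -u_negb mulgA.
by rewrite expd_mod !mulgA u_expd -u_negb !mulgA -(mulgA _ s u) -us !mulgA.
Qed.

Lemma step_sP c : code_val (step_s c) = s * code_val c.
Proof.
case: rel => [[_ uu ss us _] [s1 s2 s3 s4]]; case: c => [[b [j|] k]] /=; last first.
  by rewrite expg0 !mul1g !mulgA.
have E m v : d ^+ m * (if b then u else 1) * v = (if b then u else 1) * d ^+ twist b m * v.
  by rewrite expd_twist.
rewrite !mulgA -(expd_mod j).
have : (j %% 5 < 5)%N by rewrite ltn_mod.
case: (j %% 5)%N => [|[|[|[|[|//]]]]] _ /=.
- by rewrite expg0 mulg1 ss !mul1g.
- rewrite expg1 s1 expd_mod (expgD d (twist _ _)) ; have := E 4%N (d ^+ k).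
  move: (d ^+ 4) (d ^+ twist b 4) (d ^+ k) => x y z e.
  by rewrite -!mulgA in e *; rewrite -e.
- rewrite s2 expd_mod (expgD d (twist _ _)) -u_negb ; have := E 2%N (d ^+ k).
  move: (d ^+ 2) (d ^+ twist b 2) (d ^+ k) => x y z e.
  by rewrite -!mulgA in e *; rewrite -e.
- rewrite s3 expd_mod (expgD d (twist _ _)) -u_negb ; have := E 3%N (d ^+ k).
  move: (d ^+ 3) (d ^+ twist b 3) (d ^+ k) => x y z e.
  by rewrite -!mulgA in e *; rewrite -e.
rewrite s4 expd_mod (expgD d (twist _ _)) ; have := E 1%N (d ^+ k).
  rewrite expg1; move: (d ^+ 1) (d ^+ twist b 1) (d ^+ k) => x y z e.
  by rewrite -!mulgA in e *; rewrite -e.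
Qed.

Lemma iter_step_d n c : code_val (iter n step_d c) = d ^+ n * code_val c.
Proof.
by elim: n => [|n IH]; rewrite ?expg0 ?mul1g // iterS step_dP IH mulgA expgS.
Qed.

Lemma code_mulP c c' : code_val (code_mul c c') = code_val c * code_val c'.
Proof.
case: c => [[b o] k]; rewrite [code_val (b, o, k)]/code_val /code_mul.
have E : code_val (if b then step_u (iter k step_d c') else iter k step_d c') =
    (if b then u else 1) * d ^+ k * code_val c'.
  by case: b; rewrite ?step_uP iter_step_d ?mul1g ?mulgA.
case: o => [j|]; last by rewrite E mul1g.
by rewrite iter_step_d step_sP E !mulgA.
Qed.

End Codes.

(** * Permutation model on five points and a generation criterion in the alternating group *)

Section Perm.
Local Open Scope group_scope.
Import GroupScope.

(** On the residues modulo 5: the translation by 1, negation, and the double transposition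
    [(1 2)(3 4)]. As functions on [nat] they can be evaluated by computation, unlike
    permutations. *)
Definition rot_nat (n : nat) : nat := (n.+1 %% 5)%N.
Definition neg_nat (n : nat) : nat := ((5 - n) %% 5)%N.
Definition swap_nat (n : nat) : nat := nth 0%N [:: 0; 2; 1; 4; 3]%N n.

Definition code_act (c : code) (n : nat) : nat := let: (b, o, k) := c in
  let n1 := if o is Some j then swap_nat (iter j rot_nat n) else n in
  iter k rot_nat (if b then neg_nat n1 else n1).

Definition codes : seq code := [seq (bo, k) | bo <- [seq (b, o) | b <- [:: false; true],
  o <- None :: [seq Some j | j <- iota 0 5]], k <- iota 0 5].

Lemma inord_inj5 (f g : nat -> nat) :
  all (fun n => (f n < 5)%N && (g (f n) == n)) (iota 0 5) ->
  injective (fun x : 'I_5 => inord (f x) : 'I_5).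
Proof.
move=> /allP H x y /(congr1 val); have /andP[fx gx] := H x ltac:(by rewrite mem_iota ltn_ord).
have /andP[fy gy] := H y ltac:(by rewrite mem_iota ltn_ord).
rewrite /= !inordK // => E; by apply: val_inj; rewrite /= -(eqP gx) -(eqP gy) E.
Qed.

Definition rot5 : {perm 'I_5} := perm (@inord_inj5 rot_nat (iter 4 rot_nat) isT).
Definition neg5 : {perm 'I_5} := perm (@inord_inj5 neg_nat neg_nat isT).
Definition swap5 : {perm 'I_5} := perm (@inord_inj5 swap_nat swap_nat isT).

Lemma rot5E (x : 'I_5) : rot5 x = rot_nat x :> nat.
Proof. by rewrite permE inordK // ltn_mod. Qed.

Lemma neg5E (x : 'I_5) : neg5 x = neg_nat x :> nat.
Proof. by rewrite permE inordK // ltn_mod. Qed.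

Lemma swap5E (x : 'I_5) : swap5 x = swap_nat x :> nat.
Proof. by rewrite permE inordK //; case: x => [[|[|[|[|[|]]]]]]. Qed.

Lemma rot5XE n (x : 'I_5) : (rot5 ^+ n) x = iter n rot_nat x :> nat.
Proof. by rewrite permX; elim: n => //= n <-; rewrite rot5E. Qed.

Lemma perm5_relations : icosahedral_relations rot5 neg5 swap5.
Proof.
split; split; apply/permP=> x; apply: val_inj => /=;
  rewrite ?(permM, perm1, rot5E, neg5E, swap5E, rot5XE);
  by case: x => [[|[|[|[|[|]]]]]].
Qed.

Definition code_perm : code -> {perm 'I_5} := code_val rot5 neg5 swap5.

Lemma code_permE c (x : 'I_5) : code_perm c x = code_act c x :> nat.
Proof.
case: c => [[b [j|]] k]; rewrite /code_perm /code_val ?permM /= rot5XE;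
  congr (iter k rot_nat _); case: b;
  by rewrite ?(perm1, neg5E, permM) ?swap5E ?rot5XE.
Qed.

Lemma code_perm_inj : {in codes &, injective code_perm}.
Proof.
have /allP H : all (fun c => all (fun c' =>
    (map (code_act c) (iota 0 5) == map (code_act c') (iota 0 5)) ==> (c == c')) codes) codes.
  by vm_compute.
move=> c c' /H /allP Hc /Hc /implyP {}Hc E; apply/eqP/Hc/eqP/eq_in_map => n.
rewrite mem_iota => n5; have := congr1 (fun p : {perm 'I_5} => val (p (Ordinal n5))) E.
by rewrite /= !code_permE.
Qed.

(** The relations force the parities: [d ^ 5 = 1] that of [d], the rule for [s * d * s] that of [s],
    the rule for [s * d ^ 2 * s] that of [u]. *)
Lemma code_perm_even c : code_perm c \in 'Alt_('I_5).
Proof.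
rewrite Alt_even; have [[d5 uu ss us ud] [s1 s2 s3 s4]] := perm5_relations.
have od : odd_perm rot5 = false.
  by have := congr1 (@odd_perm _) d5; rewrite !expgS expg0 !odd_permM odd_perm1 /=; case: odd_perm.
have odX n : odd_perm (rot5 ^+ n) = false by elim: n => [|n IH]; rewrite ?expg0 ?odd_perm1 // expgS odd_permM od.
have os : odd_perm swap5 = false.
  by have := congr1 (@odd_perm _) s1; rewrite !(odX, od, odd_permM) /=; case: odd_perm.
have ou : odd_perm neg5 = false.
  by have := congr1 (@odd_perm _) s2; rewrite !(odX, os, odd_permM) /=; case: odd_perm.
by case: c => [[[] [j|]] k]; rewrite /code_perm /code_val !(odX, os, ou, odd_permM, odd_perm1).
Qed.

Lemma code_perm_onto p : p \in 'Alt_('I_5) -> exists2 c, c \in codes & p = code_perm c.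
Proof.
move=> pA; have uc : uniq (map code_perm codes).
  by rewrite map_inj_in_uniq //; exact: code_perm_inj.
pose K : {set {perm 'I_5}} := finset (fun q => q \in map code_perm codes).
have sub : K \subset 'Alt_('I_5).
  by apply/fintype.subsetP => q; rewrite inE => /mapP[c _ ->]; exact: code_perm_even.
have : p \in K.
  have /eqP -> // : K == 'Alt_('I_5)%g :> {set {perm 'I_5}}.
  rewrite eqEcard sub (_ : #|K| = 60%N); last first.
    rewrite /K cardsE (_ : 60%N = size (map code_perm codes)) ?size_map //.
    exact/card_uniqP.
  by rewrite -(leq_pmul2l (ltn0Sn 1)) card_Alt card_ord.
by rewrite inE => /mapP[c cc ->]; exists c.
Qed.

Lemma code_mul_codes : {in codes &, forall c c', code_mul c c' \in codes}.
Proof.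
have /allP H : all (fun c => all (fun c' => code_mul c c' \in codes) codes) codes by vm_compute.
by move=> c c' /H /allP Hc /Hc.
Qed.

Lemma subgroup_Alt5 (H : {group {perm 'I_5}}) (a b : {perm 'I_5}) : H \subset 'Alt_('I_5) ->
  a \in H -> b \in H -> a * a = 1 -> a != 1 -> a != neg5 -> neg5 * a = a * neg5 ->
  b ^+ 3 = 1 -> b != 1 -> neg5 * b * neg5 * b = 1 -> H = 'Alt_('I_5) :> {set _}.
Proof.
move=> HA aH bH a2 a1 au ua b3 b1 ub.
have H0 x : x \in H -> x \in 'Alt_('I_5) by exact: (fintype.subsetP HA).
have [ca cac aE] := code_perm_onto (H0 a aH).
have [cb cbc bE] := code_perm_onto (H0 b bH).
pose c1 : code := (false, None, 0%N); pose cu : code := (true, None, 0%N).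
have v1 : code_perm c1 = 1 by rewrite /code_perm /= !mul1g.
have vu : code_perm cu = neg5 by rewrite /code_perm /= mulg1 mul1g.
have vM c c' : code_perm (code_mul c c') = code_perm c * code_perm c'.
  exact: (code_mulP perm5_relations).
have cuc : cu \in codes by [].
have c1c : c1 \in codes by [].
have inj c c' : c \in codes -> c' \in codes -> (c == c') = (code_perm c == code_perm c').
  by move=> cc cc'; apply/eqP/eqP => [->//|]; exact: code_perm_inj.
(* Exhaustive verification over all pairs of codes: the relations assumed for [a] and [b] imply that
   [a * b] has order 5. *)
have /allP check : all (fun ca => all (fun cb => [&& code_mul ca ca == c1, ca != c1, ca != cu,
    code_mul cu ca == code_mul ca cu, code_mul cb (code_mul cb cb) == c1, cb != c1 &
    code_mul cu (code_mul cb (code_mul cu cb)) == c1] ==>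
    (code_mul (code_mul ca cb) (code_mul (code_mul ca cb) (code_mul (code_mul ca cb)
      (code_mul (code_mul ca cb) (code_mul ca cb)))) == c1) && (code_mul ca cb != c1)) codes) codes.
  by vm_compute.
have mc := code_mul_codes.
have /allP/(_ cb cbc)/implyP := check ca cac.
rewrite !inj ?mc // ?vM ?v1 ?vu -?aE -?bE => K.
have {K} := K ltac:(by rewrite a2 a1 au ua -expg2 -expgS b3 b1 !mulgA ub !eqxx).
rewrite -expg2 -!expgS => /andP[/eqP ab5 ab1].
have o2 : #[a] = 2%N by apply: nt_prime_order; rewrite ?expg2.
have o3 : #[b] = 3%N by apply: nt_prime_order.
have o5 : #[a * b] = 5%N by apply: nt_prime_order.
have d2 : (2 %| #|H|)%N by have := order_dvdG aH; rewrite o2.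
have d3 : (3 %| #|H|)%N by have := order_dvdG bH; rewrite o3.
have d5 : (5 %| #|H|)%N by have := order_dvdG (groupM aH bH); rewrite o5.
have d30 : (30 %| #|H|)%N.
  by rewrite (@Gauss_dvd 6 5) // d5 (@Gauss_dvd 2 3) // d2 d3.
have cA : #|'Alt_('I_5)| = 60%N.
  by apply/eqP; rewrite -(eqn_pmul2l (ltn0Sn 1)) card_Alt card_ord.
have iH : (30 * #|'Alt_('I_5) : H| %| 60)%N.
  by rewrite -cA -(Lagrange HA) dvdn_pmul2r.
have [_ S] := simpleP _ (@simple_Alt5 'I_5 ltac:(by rewrite card_ord)).
have nH : fingroup.normal H 'Alt_('I_5).
  have : (#|'Alt_('I_5) : H| %| 2)%N by rewrite -(@dvdn_pmul2l 30).
  rewrite dvdn_divisors // !inE => /orP[/eqP i1|/eqP i2]; last exact: index2_normal.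
  by rewrite (index1g HA i1) normal_refl.
have [H1|//] := S H nH.
by move: a1; move: aH; rewrite H1 inE => /eqP ->; rewrite eqxx.
Qed.

End Perm.

(** * Projective symmetries of Klein's form *)

Section Kleinian.
Variable R : realType.
Local Notation C := (Cplx R).
Local Notation M2 := 'M[C]_2.
Implicit Types (x y z X Y : C).

Lemma cyclotomic5_root : exists z : C, 1 + z + z ^+ 2 + z ^+ 3 + z ^+ 4 = 0.
Proof.
pose p : {poly C} := Poly [:: 1; 1; 1; 1; 1].
have sp : size p = 5%N by rewrite (PolyK (c := 0)) //= oner_neq0.
have [|z /rootP pz] := closed_rootP p _; first by rewrite sp.
exists z; rewrite -pz /p horner_Poly /=; ring.
Qed.

Definition mat2 (a b c d : C) : M2 := \matrix_(i, j)
  if i == 0 then (if j == 0 then a else b) else (if j == 0 then c else d).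

Lemma mat2E a b c d : ((mat2 a b c d 0 0 = a) * (mat2 a b c d 0 1 = b)) *
  ((mat2 a b c d 1 0 = c) * (mat2 a b c d 1 1 = d)).
Proof. by rewrite !mxE. Qed.

Lemma mat2_eta (P : M2) : P = mat2 (P 0 0) (P 0 1) (P 1 0) (P 1 1).
Proof. by apply: eq_mx2 => j; have [->|->] := ord2_cases j; rewrite !mat2E. Qed.

Lemma mat2M a b c d a' b' c' d' : mat2 a b c d *m mat2 a' b' c' d' =
  mat2 (a * a' + b * c') (a * b' + b * d') (c * a' + d * c') (c * b' + d * d').
Proof. by apply: eq_mx2 => j; have [->|->] := ord2_cases j; rewrite !mul2E !mat2E. Qed.

Lemma mat2Z k a b c d : k *: mat2 a b c d = mat2 (k * a) (k * b) (k * c) (k * d).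
Proof. by apply: eq_mx2 => j; have [->|->] := ord2_cases j; rewrite !mxE. Qed.

Lemma mat2_1 : 1%:M = mat2 1 0 0 1 :> M2.
Proof. by apply: eq_mx2 => j; have [->|->] := ord2_cases j; rewrite !mxE. Qed.

Lemma mat2_unit a b c d : (mat2 a b c d \in unitmx) = (a * d - b * c != 0).
Proof. by rewrite unitmx2 !mat2E. Qed.

Variable e : C.
Hypothesis cyc : 1 + e + e ^+ 2 + e ^+ 3 + e ^+ 4 = 0.

(* The cofactors [q] were found by polynomial division. *)
Lemma eq_mod_cyc (q x y : C) : x = y + (1 + e + e ^+ 2 + e ^+ 3 + e ^+ 4) * q -> x = y.
Proof. by rewrite cyc mul0r addr0. Qed.

Lemma e5 : e ^+ 5 = 1.
Proof. by apply: (eq_mod_cyc (q := e - 1)); ring. Qed.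

Lemma e_neq0 : e != 0.
Proof. by apply: contra_eq_neq e5 => ->; rewrite expr0n eq_sym oner_neq0. Qed.

Lemma e_neq1 : e != 1.
Proof.
apply: contra_eq_neq cyc => ->; rewrite !expr1n.
by rewrite (_ : 1 + 1 + 1 + 1 + 1 = 5%:R) ?pnatr_eq0 //; ring.
Qed.

Lemma fifth_root x y : x ^+ 5 = y ^+ 5 -> exists2 j, (j < 5)%N & e ^+ j * x = y.
Proof.
move=> xy.
have : (x - y) * ((e * x - y) * ((e ^+ 2 * x - y) * ((e ^+ 3 * x - y) * (e ^+ 4 * x - y)))) = 0.
  rewrite -[RHS](subrr (y ^+ 5)) -{1}xy.
  apply: (eq_mod_cyc (q := x * y ^+ 4 - x ^+ 5 - e * x ^+ 2 * y ^+ 3 + e * x ^+ 5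
    - e ^+ 3 * x ^+ 2 * y ^+ 3 + e ^+ 3 * x ^+ 3 * y ^+ 2 + e ^+ 5 * x ^+ 3 * y ^+ 2
    - e ^+ 5 * x ^+ 5 - e ^+ 6 * x ^+ 4 * y + e ^+ 6 * x ^+ 5)).
  by ring.
move/eqP; rewrite !mulf_eq0 !subr_eq0.
case/orP=> [/eqP E|]; first by exists 0%N; rewrite // expr0 mul1r.
case/orP=> [/eqP E|]; first by exists 1%N; rewrite // expr1.
case/orP=> [/eqP E|]; first by exists 2%N.
by case/orP=> /eqP E; [exists 3%N | exists 4%N].
Qed.

(** A root of [A ^ 2 + A - 1], whose other root is [-1 - A]. Which of the two it is depends on the
    fifth root [e], and this choice is left open. *)
Definition golden : C := e ^+ 2 + e ^+ 3.
Local Notation A := golden.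

Lemma goldenE : A ^+ 2 = 1 - A.
Proof. by apply: (eq_mod_cyc (q := e ^+ 2 + e - 1)); rewrite /golden; ring. Qed.

Lemma eq_mod_golden (q x y : C) : x = y + (A ^+ 2 + A - 1) * q -> x = y.
Proof. by rewrite goldenE subrK subrr mul0r addr0. Qed.

Lemma golden_neq0 : A != 0.
Proof. by apply: contra_eq_neq goldenE => ->; rewrite expr0n /= subr0 eq_sym oner_neq0. Qed.

Lemma golden_neq2 : A - 2 != 0.
Proof.
apply: contra_eq_neq goldenE => /eqP; rewrite subr_eq0 => /eqP ->.
by rewrite -subr_eq0 (_ : _ - _ = 5%:R) ?pnatr_eq0 //; ring.
Qed.

Lemma rotM_unit n : mat2 1 0 0 (e ^+ n) \in unitmx.
Proof. by rewrite mat2_unit mul1r mul0r subr0 expf_neq0 // e_neq0. Qed.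

Lemma negM_unit : mat2 0 (-1) 1 0 \in unitmx.
Proof. by rewrite mat2_unit mul0r mulr1 sub0r opprK oner_neq0. Qed.

Lemma swapM_unit : mat2 A 1 1 (- A) \in unitmx.
Proof.
rewrite mat2_unit (_ : _ - _ = A - 2) ?golden_neq2 //.
by apply: (eq_mod_golden (q := -1)); ring.
Qed.

Definition toGL (P : M2) (uP : P \in unitmx) : GL C 2 :=
  exist (fun P : M2 => P \in unitmx) P uP.

Definition rotG n : GL C 2 := toGL (rotM_unit n).
Definition negG : GL C 2 := toGL negM_unit.
Definition swapG : GL C 2 := toGL swapM_unit.

Local Notation d := (toPGL (rotG 1)).
Local Notation u := (toPGL negG).
Local Notation s := (toPGL swapG).

Lemma toPGLMg (M N : GL C 2) : toPGL (M * N)%g = (toPGL M * toPGL N)%g.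
Proof. exact: toPGLM. Qed.

Lemma toPGL1 : toPGL (1%g : GL C 2) = 1%g.
Proof. by []. Qed.

Lemma toPGL_rotX n : (d ^+ n)%g = toPGL (rotG n).
Proof.
elim: n => [|n IH].
  rewrite expg0 -toPGL1; congr toPGL; apply: val_inj => /=.
  by rewrite mat2_1 expr0.
rewrite expgS IH -toPGLMg; congr toPGL; apply: val_inj => /=.
by rewrite mat2M !(mul0r, mulr0, addr0, add0r) mul1r expr1 -exprS.
Qed.

Lemma toPGL_eq2 k (M N : GL C 2) : k != 0 -> val M = k *: val N -> toPGL M = toPGL N.
Proof. by move=> k0 E; apply/toPGL_eq; exists k. Qed.

(** The product of [1 - e ^ i] over [i = 1, 2, 3, 4] is the value 5 of the cyclotomic polynomial at
    1. *)
Lemma e2_neq1 : 1 - e ^+ 2 != 0.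
Proof.
have H : (1 - e ^+ 2) * ((1 - e) * (1 - e ^+ 3) * (1 - e ^+ 4)) = 5%:R.
  by apply: (eq_mod_cyc (q := - 4 + 3 * e + e ^+ 3 - 2 * e ^+ 5 + e ^+ 6)); ring.
by apply: contra_eq_neq H => ->; rewrite mul0r eq_sym pnatr_eq0.
Qed.

Lemma e3_neq1 : 1 - e ^+ 3 != 0.
Proof.
have H : (1 - e ^+ 3) * ((1 - e) * (1 - e ^+ 2) * (1 - e ^+ 4)) = 5%:R.
  by apply: (eq_mod_cyc (q := - 4 + 3 * e + e ^+ 3 - 2 * e ^+ 5 + e ^+ 6)); ring.
by apply: contra_eq_neq H => ->; rewrite mul0r eq_sym pnatr_eq0.
Qed.

(** Each relation holds for the matrices up to the displayed scalar [k], entry by entry modulo the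
    equation of [e] or of [golden]. *)
Lemma PGL_relations : icosahedral_relations d u s.
Proof.
have n2 := e2_neq1; have n3 := e3_neq1.
have M3 (M N P : GL C 2) : toPGL (M * N * P)%g = (toPGL M * toPGL N * toPGL P)%g.
  by rewrite !toPGLMg.
have M4 (M N P Q : GL C 2) :
    toPGL (M * (N * P) * Q)%g = (toPGL M * (toPGL N * toPGL P) * toPGL Q)%g.
  by rewrite !toPGLMg.
split; split; rewrite ?toPGL_rotX -?toPGL1.
- by congr toPGL; apply: val_inj; rewrite /= e5 mat2_1.
- rewrite -toPGLMg; apply: (toPGL_eq2 (k := -1)); first by rewrite oppr_eq0 oner_neq0.
  by rewrite /= mat2M mat2_1 mat2Z; congr mat2; ring.
- rewrite -toPGLMg; apply: (toPGL_eq2 (k := 2 - A)); first by rewrite -opprB oppr_eq0 golden_neq2.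
  by rewrite /= mat2M mat2_1 mat2Z; congr mat2;
    [apply: (eq_mod_golden (q := 1)) | | | apply: (eq_mod_golden (q := 1))]; ring.
- rewrite -!toPGLMg; apply: (toPGL_eq2 (k := -1)); first by rewrite oppr_eq0 oner_neq0.
  by rewrite /= !mat2M mat2Z; congr mat2; ring.
- rewrite -!toPGLMg; apply: (toPGL_eq2 (k := e)); first exact: e_neq0.
  by rewrite /= !mat2M mat2Z; congr mat2; [ring | ring | apply: (eq_mod_cyc (q := 1 - e)); ring | ring].
- rewrite -!M3; apply: (toPGL_eq2 (k := - 1 + e ^+ 3)).
    by rewrite -oppr_eq0 opprD opprK.
  rewrite /= !mat2M mat2Z /golden; congr mat2.
  + by apply: (eq_mod_cyc (q := e)); ring.
  + by apply: (eq_mod_cyc (q := e ^+ 2 - e ^+ 3)); ring.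
  + by apply: (eq_mod_cyc (q := e ^+ 2 - e ^+ 3)); ring.
  by apply: (eq_mod_cyc (q := 1 - e + 2 * e ^+ 5 - e ^+ 7 - e ^+ 8 + e ^+ 10)); ring.
- rewrite -M3 -M4; apply: (toPGL_eq2 (k := 1 - e ^+ 3)).
    by [].
  rewrite /= !mat2M mat2Z /golden; congr mat2.
  + by apply: (eq_mod_cyc (q := - 1 + e + e ^+ 2)); ring.
  + by apply: (eq_mod_cyc (q := e ^+ 2 - e ^+ 4)); ring.
  + by apply: (eq_mod_cyc (q := e ^+ 2 - e ^+ 4)); ring.
  by apply: (eq_mod_cyc (q := 1 - e + e ^+ 4)); ring.
- rewrite -M3 -M4; apply: (toPGL_eq2 (k := 1 - e ^+ 2)).
    by [].
  rewrite /= !mat2M mat2Z /golden; congr mat2.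
  + by apply: (eq_mod_cyc (q := - 1 + e + e ^+ 2)); ring.
  + by apply: (eq_mod_cyc (q := e ^+ 2 - e ^+ 4)); ring.
  + by apply: (eq_mod_cyc (q := e ^+ 2 - e ^+ 4)); ring.
  by apply: (eq_mod_cyc (q := 1 - e + e ^+ 5)); ring.
- rewrite -!M3; apply: (toPGL_eq2 (k := - 1 + e ^+ 2)).
    by rewrite -oppr_eq0 opprD opprK.
  rewrite /= !mat2M mat2Z /golden; congr mat2.
  + by apply: (eq_mod_cyc (q := e ^+ 2)); ring.
  + by apply: (eq_mod_cyc (q := e - e ^+ 3)); ring.
  + by apply: (eq_mod_cyc (q := e - e ^+ 3)); ring.
  by apply: (eq_mod_cyc (q := 1 - e - e ^+ 4 + e ^+ 5 + e ^+ 6)); ring.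
Qed.

(** Invariance up to a scalar, which is the notion that depends only on the class in the projective
    group; the matrix [swapG] does not preserve the form exactly. *)
Definition klein_inv (P : M2) : Prop := exists2 c : C, c != 0 & forall X Y,
  klein (P 0 0 * X + P 0 1 * Y) (P 1 0 * X + P 1 1 * Y) = c * klein X Y.

(** Expression through [X ^ 2 - Y ^ 2] and [X * Y], on which the swap acts by a simple linear
    map. *)
Lemma kleinE X Y : klein X Y = (X * Y) * ((X ^+ 2 - Y ^+ 2) ^+ 5 +
  5 * (X ^+ 2 - Y ^+ 2) ^+ 3 * (X * Y) ^+ 2 + 5 * (X ^+ 2 - Y ^+ 2) * (X * Y) ^+ 4 +
  11 * (X * Y) ^+ 5).
Proof. by rewrite /klein; ring. Qed.

Lemma klein_rot n : klein_inv (mat2 1 0 0 (e ^+ n)).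
Proof.
exists (e ^+ n) => [|X Y]; first by rewrite expf_neq0 // e_neq0.
have x5 : (e ^+ n) ^+ 5 = 1 by rewrite exprAC e5 expr1n.
rewrite !mat2E !(mul0r, add0r, addr0, mul1r) /klein; move: (e ^+ n) x5 => x x5.
have x6 : x ^+ 6 = x by rewrite exprSr x5 mul1r.
have x11 : x ^+ 11 = x by rewrite (exprD x 5 6) x5 x6 mul1r.
by rewrite !exprMn x6 x11; ring.
Qed.

Lemma klein_neg : klein_inv (mat2 0 (-1) 1 0).
Proof.
by exists 1 => [|X Y]; rewrite ?oner_neq0 // !mat2E /klein; ring.
Qed.

(* With [v = X^2 - Y^2] and [w = X Y], the swap acts on [(v, w)] as [A] times the
   map [(v, w) |-> (4 w - v, v + w)]. *)
Lemma klein_swap : klein_inv (mat2 A 1 1 (- A)).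
Proof.
exists (125 * A ^+ 6) => [|X Y].
  by rewrite mulf_neq0 ?pnatr_eq0 // expf_neq0 // golden_neq0.
rewrite !mat2E [LHS]kleinE.
have -> : (A * X + 1 * Y) * (1 * X + - A * Y) = A * (X ^+ 2 - Y ^+ 2 + X * Y).
  by apply: (eq_mod_golden (q := - (X * Y))); ring.
have -> : (A * X + 1 * Y) ^+ 2 - (1 * X + - A * Y) ^+ 2 = A * (4 * (X * Y) - (X ^+ 2 - Y ^+ 2)).
  by apply: (eq_mod_golden (q := X ^+ 2 - Y ^+ 2)); ring.
by rewrite /klein; ring.
Qed.

Lemma klein_invM (P Q : M2) : klein_inv P -> klein_inv Q -> klein_inv (P *m Q).
Proof.
move=> [c c0 H] [k k0 K]; exists (c * k) => [|X Y]; first by rewrite mulf_neq0.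
rewrite -mulrA -K -H !mul2E; congr klein; by ring.
Qed.

Lemma poly_fun_eq0 (p : {poly C}) : (forall x, p.[x] = 0) -> p = 0.
Proof.
move=> H; apply/eqP; apply: contraT => p0.
have := max_poly_roots p0 (rs := [seq i%:R | i <- iota 0 (size p)]).
rewrite size_map size_iota ltnn; apply; first by apply/allP => x _; apply/rootP.
by rewrite map_inj_uniq ?iota_uniq // => i j /eqP; rewrite eqr_nat => /eqP.
Qed.

(** Comparing coefficients in [x]: degree 10 forces [b = 0], degree 11 gives [k = a ^ 11 z], and
    then degree 6 gives [a ^ 5 = z ^ 5]. *)
Lemma klein_tri (a b z k : C) : a != 0 -> z != 0 ->
  (forall x, klein (a * x + b) z = k * klein x 1) -> b = 0 /\ a ^+ 5 = z ^+ 5.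
Proof.
move=> a0 z0 H; pose cs := [:: b ^+ 11 * z + 11 * b ^+ 6 * z ^+ 6 - b * z ^+ 11;
    11 * a * b ^+ 10 * z + 66 * a * b ^+ 5 * z ^+ 6 - a * z ^+ 11 + k;
    55 * a ^+ 2 * b ^+ 9 * z + 165 * a ^+ 2 * b ^+ 4 * z ^+ 6;
    165 * a ^+ 3 * b ^+ 8 * z + 220 * a ^+ 3 * b ^+ 3 * z ^+ 6;
    330 * a ^+ 4 * b ^+ 7 * z + 165 * a ^+ 4 * b ^+ 2 * z ^+ 6;
    462 * a ^+ 5 * b ^+ 6 * z + 66 * a ^+ 5 * b * z ^+ 6;
    462 * a ^+ 6 * b ^+ 5 * z + 11 * a ^+ 6 * z ^+ 6 - 11 * k;
    330 * a ^+ 7 * b ^+ 4 * z;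
    165 * a ^+ 8 * b ^+ 3 * z;
    55 * a ^+ 9 * b ^+ 2 * z;
    11 * a ^+ 10 * b * z;
    a ^+ 11 * z - k].
have cs0 i : cs`_i = 0.
  rewrite -coef_Poly (@poly_fun_eq0 (Poly cs)) ?coef0 // => x.
  transitivity (klein (a * x + b) z - k * klein x 1); last by rewrite H subrr.
  by rewrite horner_Poly /cs /klein /=; ring.
have b0 : b = 0.
  apply/eqP; apply: contraT => b0; have n11 : 11 != 0 :> C by rewrite pnatr_eq0.
  have := mulf_neq0 (mulf_neq0 (mulf_neq0 n11 (expf_neq0 10 a0)) b0) z0.
  by have := cs0 10%N; rewrite /= => ->; rewrite eqxx.
split=> //.
have /eqP := cs0 11%N; rewrite /= subr_eq0 => /eqP kE.
have /eqP := cs0 6%N; rewrite /= -kE b0 expr0n /= mulr0 mul0r add0r subr_eq0.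
rewrite -mulrA => /eqP /(mulfI (_ : 11 != 0 :> C)); rewrite pnatr_eq0 => /(_ isT) E.
apply: (mulfI (expf_neq0 6 a0)); apply: (mulIf z0).
by rewrite -exprD -[RHS]mulrA -exprSr.
Qed.

Lemma klein_inv_upper (N : GL C 2) : klein_inv (val N) -> val N 1 0 = 0 ->
  exists2 j, (j < 5)%N & toPGL N = (d ^+ j)%g.
Proof.
move=> [c c0 H] N10; have := valP N; rewrite /= unitmx2 N10 mulr0 subr0 mulf_eq0 => /norP[n0 n1].
have [|b0 /fifth_root[j j5 jE]] := klein_tri n0 n1 (b := val N 0 1) (k := c).
  by move=> x; rewrite -H N10 !mulr1 mul0r add0r.
exists j => //; rewrite toPGL_rotX; apply: (toPGL_eq2 n0) => /=.
by rewrite [LHS]mat2_eta mat2Z N10 b0 -jE !mulr0 mulr1 mulrC.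
Qed.

(** If [M] and [g] send the vertex [(1 : 0)] to the same point, then [g^-1 * M] is upper triangular,
    and such symmetries are rotations. *)
Lemma klein_reduce (M g : GL C 2) : klein_inv (val M) -> klein_inv (val g) ->
  val M 0 0 * val g 1 0 = val M 1 0 * val g 0 0 ->
  exists2 j, (j < 5)%N & toPGL M = (toPGL g * d ^+ j)%g.
Proof.
move=> [c c0 cM] [k k0 kg] E; set N := (g^-1 * M)%g.
have gN : val M = val g *m val N by rewrite -[in LHS](mulVKg g M).
have M00 : val M 0 0 = val g 0 0 * val N 0 0 + val g 0 1 * val N 1 0 by rewrite gN mul2E.
have M10 : val M 1 0 = val g 1 0 * val N 0 0 + val g 1 1 * val N 1 0 by rewrite gN mul2E.
have N10 : val N 1 0 = 0.
  have /eqP : val N 1 0 * (val g 0 0 * val g 1 1 - val g 0 1 * val g 1 0) = 0.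
    by rewrite -[RHS](subrr (val M 1 0 * val g 0 0)) -{2}E M00 M10; ring.
  have := valP g; rewrite /= unitmx2 mulf_eq0 => /negbTE -> /orP[/eqP|] //.
have [|j j5 jE] := klein_inv_upper _ N10; last first.
  by exists j => //; rewrite -jE -toPGLMg mulVKg.
exists (c / k) => [|X Y]; first by rewrite mulf_neq0 // invr_eq0.
apply: (mulfI k0); rewrite -kg mulrA [k * _]mulrC divfK // -cM gN !mul2E.
by congr klein; ring.
Qed.

(** A symmetry sends the vertex [(1 : 0)] to one of the 12 zeros of the form. For each zero one of
    the words [1], [u], [d^j s], [d^j s u] has the same image, and [klein_reduce] supplies the final
    rotation. *)
Lemma klein_inv_code (M : GL C 2) : klein_inv (val M) ->
  exists2 c, c \in codes & toPGL M = code_val d u s c.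
Proof.
move=> MK; have [k k0 /(_ 1 0)] := MK.
have -> : klein 1 0 = 0 :> C by rewrite /klein; ring.
rewrite !mulr0 !addr0 !mulr1; set x := val M 0 0; set y := val M 1 0 => xy.
have mem b o j : (j < 5)%N -> (if o is Some i then i < 5 else true)%N -> (b, o, j) \in codes.
  case: o => [i|] + +; do 5?[case: j => [|j] //]; try do 5?[case: i => [|i] //]; by case: b.
have reduce (g : GL C 2) b o : (if o is Some i then i < 5 else true)%N ->
    toPGL g = code_val d u s (b, o, 0%N) -> klein_inv (val g) ->
    x * val g 1 0 = y * val g 0 0 -> exists2 c, c \in codes & toPGL M = code_val d u s c.
  move=> o5 gE gK E; have [j j5 jE] := klein_reduce MK gK E.
  by exists (b, o, j); [exact: mem | rewrite jE gE /code_val expg0 mulg1].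
have [y0|y0] := eqVneq y 0.
  apply: (reduce (rotG 0) false None) => //; [|exact: klein_rot|].
    by rewrite /code_val toPGL_rotX !mul1g.
  by rewrite /= !mat2E y0 mulr0 mul0r.
have [x0|x0] := eqVneq x 0.
  apply: (reduce negG true None) => //; [|exact: klein_neg|].
    by rewrite /code_val expg0 mul1g mulg1.
  by rewrite /= !mat2E x0 mulr0 mul0r.
(* [x^10 + 11 x^5 y^5 - y^10] splits because the fifth powers of [A] and [-1 - A] have sum -11 and
   product -1. *)
have : (x * y) * ((x ^+ 5 - (A * y) ^+ 5) * (x ^+ 5 - ((-1 - A) * y) ^+ 5)) = 0.
  rewrite -xy /klein; apply: (eq_mod_golden (q := (x * y) * (- y ^+ 10 + 10 * x ^+ 5 * y ^+ 5 - A * y ^+ 10 + 5 * A * x ^+ 5 * y ^+ 5 - 2 * A ^+ 2 * y ^+ 10 + 5 * A ^+ 2 * x ^+ 5 * y ^+ 5 - 3 * A ^+ 3 * y ^+ 10 - 5 * A ^+ 4 * y ^+ 10 - 7 * A ^+ 5 * y ^+ 10 - 7 * A ^+ 6 * y ^+ 10 - 4 * A ^+ 7 * y ^+ 10 - A ^+ 8 * y ^+ 10))); ring.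
move/eqP; rewrite !mulf_eq0 (negbTE x0) (negbTE y0) !subr_eq0 /= => /orP[/eqP E|/eqP E].
  have [j j5 jE] := fifth_root E.
  apply: (reduce (rotG j * swapG)%g false (Some j)) => //.
  - by rewrite /code_val toPGL_rotX expg0 !mulg1 toPGLMg.
  - exact: klein_invM (klein_rot j) klein_swap.
  by rewrite /= mat2M !mat2E !mul1r !mul0r mulr1 addr0 add0r mulrC jE mulrC.
have [j j5 jE] := fifth_root E.
apply: (reduce (rotG j * swapG * negG)%g true (Some j)) => //.
- by rewrite /code_val toPGL_rotX expg0 !mulg1 !toPGLMg.
- exact: klein_invM (klein_invM (klein_rot j) klein_swap) klein_neg.
rewrite /= !mat2M !mat2E.
transitivity (- A * (e ^+ j * x)); first by ring.
by rewrite jE; apply: (eq_mod_golden (q := y)); ring.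
Qed.

End Kleinian.

(** * Complex conjugation on the icosahedral group, and the image of a monodromy group *)

Section Image.
Variable R : realType.
Local Notation C := (Cplx R).
Local Notation M2 := 'M[C]_2.
Local Notation u := (toPGL (negG R)).

Lemma conjmx2_unit (P : M2) : (conjmx2 P \in unitmx) = (P \in unitmx).
Proof. by rewrite !unitmx2 !conjmx2E -!rmorphM -rmorphB fmorph_eq0. Qed.

Lemma conjG_subproof (M : GL C 2) : conjmx2 (val M) \in unitmx.
Proof. by rewrite conjmx2_unit (valP M). Qed.

Definition conjG (M : GL C 2) : GL C 2 := toGL (conjG_subproof M).

Lemma conjGM (M N : GL C 2) : conjG (M * N)%g = (conjG M * conjG N)%g.
Proof. by apply: val_inj; rewrite /= conjmx2M. Qed.

Lemma conjGZ k (M N : GL C 2) : val M = k *: val N -> val (conjG M) = k^* *: val (conjG N).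
Proof.
by move=> E; apply: eq_mx2 => j; rewrite /= E !mxE !rmorphM.
Qed.

Definition conjPGL (x : PGL C 2) : PGL C 2 := toPGL (conjG (repr x)).

Lemma conjPGLE (M : GL C 2) : conjPGL (toPGL M) = toPGL (conjG M).
Proof.
have [k k0 E] := repr_toPGL M; apply: (toPGL_eq2 (k := k^*)); first by rewrite fmorph_eq0.
exact: conjGZ.
Qed.

Lemma conjPGLM (x y : PGL C 2) : conjPGL (x * y)%g = (conjPGL x * conjPGL y)%g.
Proof.
have [M ->] := toPGL_surj x; have [N ->] := toPGL_surj y.
by rewrite -toPGLMg !conjPGLE conjGM toPGLMg.
Qed.

Lemma conjPGLX (x : PGL C 2) n : conjPGL (x ^+ n)%g = (conjPGL x ^+ n)%g.
Proof.
elim: n => [|n IH]; last by rewrite !expgS conjPGLM IH.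
rewrite !expg0 -toPGL1 conjPGLE; congr toPGL; apply: val_inj; apply: eq_mx2 => j.
by rewrite !mxE; case: (_ == _); case: (_ == _); rewrite ?rmorph0 ?rmorph1.
Qed.

Variable e : C.
Hypothesis cyc : 1 + e + e ^+ 2 + e ^+ 3 + e ^+ 4 = 0.
Local Notation d := (toPGL (rotG cyc 1)).
Local Notation s := (toPGL (swapG cyc)).
Local Notation code_pgl := (code_val d u s).

Lemma conj_e : e^* = e ^+ 4.
Proof.
have n1 : `|e| = 1.
  by apply/eqP; rewrite -(@pexpr_eq1 _ _ 5) // -normrX (e5 cyc) normr1.
apply: (mulfI (e_neq0 cyc)); by rewrite -normCK n1 expr1n -exprS (e5 cyc).
Qed.

Lemma conj_golden : (golden e)^* = golden e.
Proof.
rewrite /golden rmorphD !rmorphXn /= conj_e -!exprM.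
by rewrite (exprD e 5 3) (exprD e 10 2) (exprD e 5 5) (e5 cyc) !mul1r addrC.
Qed.

(** It suffices to check the generators: [u] is real and commutes with [s], [s] is real because
    [golden] is, and conjugation inverts [e], as [u] does with [d]. *)
Lemma conj_code c : (conjPGL (code_pgl c) * u = u * code_pgl c)%g.
Proof.
have [[d5 uu ss us ud] _] := PGL_relations cyc.
have K1 : (conjPGL 1 * u = u * 1)%g.
  by rewrite -(expg0 u) conjPGLX !expg0 mul1g mulg1.
have KM x y : (conjPGL x * u = u * x -> conjPGL y * u = u * y ->
    conjPGL (x * y) * u = u * (x * y))%g.
  by move=> Kx Ky; rewrite conjPGLM -mulgA Ky mulgA Kx mulgA.
have KX x n : (conjPGL x * u = u * x -> conjPGL (x ^+ n) * u = u * x ^+ n)%g.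
  by move=> Kx; elim: n => [|n IH]; rewrite ?expg0 // expgS; exact: KM.
have Ku : (conjPGL u * u = u * u)%g.
  rewrite conjPGLE; congr (toPGL _ * _)%g; apply: val_inj; apply: eq_mx2 => j.
  by have [->|->] := ord2_cases j; rewrite !conjmx2E !mat2E ?rmorph0 ?rmorphN ?rmorph1.
have Kd : (conjPGL d * u = u * d)%g.
  rewrite ud toPGL_rotX conjPGLE; congr (toPGL _ * _)%g; apply: val_inj; apply: eq_mx2 => j.
  by have [->|->] := ord2_cases j; rewrite !conjmx2E !mat2E ?rmorph0 ?rmorph1 ?rmorphXn /= ?conj_e.
have Ks : (conjPGL s * u = u * s)%g.
  rewrite us conjPGLE; congr (toPGL _ * _)%g; apply: val_inj; apply: eq_mx2 => j.
  by have [->|->] := ord2_cases j; rewrite !conjmx2E !mat2E ?rmorphN ?rmorph1 /= ?conj_golden.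
case: c => [[b o] k]; rewrite /code_val; apply: (KM); last exact: KX.
by apply: (KM); [case: o => [j|//]; apply: (KM) => //; exact: KX | case: b].
Qed.

Local Notation A5 := ('Alt_('I_5))%g.

Definition code_of (p : {perm 'I_5}) : code :=
  nth (false, None, 0%N) codes (index p (map code_perm codes)).

Lemma code_ofK c : c \in codes -> code_of (code_perm c) = c.
Proof.
move=> cc; have pc : code_perm c \in map code_perm codes by exact: map_f.
have i5 : (index (code_perm c) (map code_perm codes) < size codes)%N.
  by rewrite -(size_map code_perm) index_mem.
apply: code_perm_inj => //; first exact: mem_nth.
by rewrite /code_of -(nth_map _ 1%g) // nth_index.
Qed.

Definition alt_pgl (p : {perm 'I_5}) : PGL C 2 := code_pgl (code_of p).

Lemma alt_pglE c : c \in codes -> alt_pgl (code_perm c) = code_pgl c.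
Proof. by move=> cc; rewrite /alt_pgl code_ofK. Qed.

Lemma alt_pglM : {in A5 &, {morph alt_pgl : p q / (p * q)%g}}.
Proof.
move=> p q /code_perm_onto[c cc ->] /code_perm_onto[c' cc' ->].
rewrite -(code_mulP perm5_relations) !alt_pglE ?code_mul_codes //.
exact: (code_mulP (PGL_relations cyc)).
Qed.

Lemma alt_pgl1 : alt_pgl 1 = 1%g.
Proof.
have c1 : (false, None, 0%N) \in codes by [].
have := alt_pglE c1; rewrite /code_perm /code_val !expg0 !mul1g => ->; first by [].
Qed.

Lemma toPGL_scalar (M : GL C 2) : toPGL M = 1%g -> exists k, val M = k%:M.
Proof. by rewrite -toPGL1 => /toPGL_eq[k _ E]; exists k; rewrite E /= scalemx1. Qed.

(** The kernel is normal in a simple group and does not contain the 5-cycle, whose image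
    [diag (1, e)] is not scalar. *)
Lemma alt_pgl_inj : {in A5 &, injective alt_pgl}.
Proof.
pose K : {set {perm 'I_5}} := finset (fun p => (p \in A5) && (alt_pgl p == 1%g)).
have inK p : (p \in K) = (p \in A5) && (alt_pgl p == 1%g) by rewrite inE.
have gK : group_set K.
  apply/group_setP; split=> [|p q]; first by rewrite inK group1 alt_pgl1 eqxx.
  rewrite !inK => /andP[pA /eqP p1] /andP[qA /eqP q1].
  by rewrite groupM // alt_pglM // p1 q1 mulg1 eqxx.
have nK : fingroup.normal (Group gK) A5.
  apply/andP; split; first by apply/fintype.subsetP => p; rewrite inK => /andP[].
  apply/fintype.subsetP => q qA; rewrite inE; apply/fintype.subsetP => p /imsetP[r].
  rewrite inK => /andP[rA /eqP r1] ->; rewrite inK groupJ //=.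
  by rewrite conjgE !alt_pglM ?groupM ?groupV // r1 mul1g -alt_pglM ?groupV // mulVg alt_pgl1.
have [_ S] := simpleP _ (@simple_Alt5 'I_5 ltac:(by rewrite card_ord)).
have K1 : K = [set 1%g]%SET.
  have [//|KA] := S (Group gK) nK.
  have c1 : (false, None, 1%N) \in codes by [].
  have : code_perm (false, None, 1%N) \in K by rewrite -[K]/(gval (Group gK)) KA code_perm_even.
  rewrite inK alt_pglE // /code_val !mul1g expg1 => /andP[_ /eqP /toPGL_scalar[k kE]].
  have E0 := congr1 (fun P : M2 => P 0 0) kE; have E1 := congr1 (fun P : M2 => P 1 1) kE.
  move: E0 E1 (e_neq1 cyc); rewrite /= !mat2E !mxE /= mulr1n expr1 => <- ->.
  by rewrite eqxx.
move=> p q pA qA pq; apply/eqP; rewrite -(inj_eq (mulgI p^-1%g)) mulVg eq_sym.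
have : (p^-1 * q)%g \in K.
  have pV : (p^-1)%g \in A5 by rewrite groupV.
  rewrite inK (groupM pV qA) (alt_pglM pV qA) -pq -(alt_pglM pV pA) mulVg alt_pgl1.
  exact: eqxx.
by rewrite K1 inE.
Qed.

Lemma icosahedral_image (G : set (GL C 2)) (S T : GL C 2) :
  (forall M, G M -> klein_inv (val M)) -> G 1%g -> (forall M N, G M -> G N -> G (M * N)%g) ->
  G S -> conjG S = S -> (toPGL S * toPGL S)%g = 1%g -> toPGL S != 1%g -> toPGL S != u ->
  G T -> toPGL (conjG T) = (toPGL T)^-1%g -> (toPGL T ^+ 3)%g = 1%g -> toPGL T != 1%g ->
  icosahedral (@toPGL C 2 @` G).
Proof.
move=> GK G1 GM GS cS S2 S1 Su GT cT T3 T1.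
have lift M : G M -> exists2 p, p \in A5 & alt_pgl p = toPGL M.
  move=> /GK /(klein_inv_code cyc)[c cc ->].
  by exists (code_perm c); [exact: code_perm_even | exact: alt_pglE].
pose H : {set {perm 'I_5}} :=
  finset (fun p => (p \in A5) && `[< exists2 M, G M & toPGL M = alt_pgl p >]).
have inH p : reflect (p \in A5 /\ exists2 M, G M & toPGL M = alt_pgl p) (p \in H).
  have -> : (p \in H) = (p \in A5) && `[< exists2 M, G M & toPGL M = alt_pgl p >] by rewrite inE.
  apply: (iffP andP); first by move=> [pA /asboolP ex].
  by move=> [pA ex]; split=> //; apply/asboolP.
(* In a finite group closure under products is enough, so [G] need not be known to be closed under
   inverses. *)
have gH : group_set H.
  apply/group_setP; split=> [|p q]; first by apply/inH; split; [exact: group1 | exists 1%g; rewrite ?alt_pgl1].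
  move=> /inH[pA [M GM' ME]] /inH[qA [N GN NE]]; apply/inH; split; first exact: groupM.
  by exists (M * N)%g; [exact: GM | rewrite alt_pglM // -ME -NE toPGLMg].
have [a aA aE] := lift S GS; have [b bA bE] := lift T GT.
have c1 : (true, None, 0%N) \in codes by [].
have cu : code_perm (true, None, 0%N) = neg5 by rewrite /code_perm /code_val mul1g expg0 mulg1.
have nA : neg5 \in A5 by rewrite -cu code_perm_even.
have nE : alt_pgl neg5 = u by rewrite -cu alt_pglE // /code_val mul1g expg0 mulg1.
have uu : (u * u = 1)%g by have [[]] := PGL_relations cyc.
have inj := alt_pgl_inj.
have conj_u M : G M -> (toPGL (conjG M) * u = u * toPGL M)%g.
  by move=> /GK /(klein_inv_code cyc)[c cc E]; rewrite -conjPGLE E conj_code.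
have HA : H = A5 :> {set {perm 'I_5}}.
  apply: (@subgroup_Alt5 (Group gH) a b).
  - by apply/fintype.subsetP => p /inH[].
  - by apply/inH; split=> //; exists S.
  - by apply/inH; split=> //; exists T.
  - apply: inj; [exact: groupM | exact: group1 |].
    by rewrite (alt_pglM aA aA) aE alt_pgl1.
  - by apply: contra_neq S1 => a1; rewrite -aE a1 alt_pgl1.
  - by apply: contra_neq Su => a1; rewrite -aE a1 nE.
  - apply: inj; [exact: groupM | exact: groupM |].
    by rewrite (alt_pglM nA aA) (alt_pglM aA nA) aE nE -(conj_u S GS) cS.
  - have bbA : (b * b)%g \in A5 by exact: groupM.
    apply: inj; [exact: groupX | exact: group1 |].
    rewrite (expgS b) (expg2 b) (alt_pglM bA bbA) (alt_pglM bA bA) bE alt_pgl1 -T3.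
    by rewrite (expgS _ 2) expg2.
  - by apply: contra_neq T1 => b1; rewrite -bE b1 alt_pgl1.
  have nb : (neg5 * b)%g \in A5 by exact: groupM.
  have nbn : (neg5 * b * neg5)%g \in A5 by exact: groupM.
  apply: inj; [exact: groupM | exact: group1 |].
  rewrite (alt_pglM nbn bA) (alt_pglM nb nA) (alt_pglM nA bA) bE nE alt_pgl1.
  by rewrite -(conj_u T GT) cT -(mulgA _ u u) uu mulg1 mulVg.
exists alt_pgl; split; [exact: alt_pglM | exact: alt_pgl_inj |].
apply/seteqP; split=> [x [p pA <-]|x [M GM' <-]].
  by move: pA; rewrite /= -HA => /inH[_ [M GM' ME]]; exists M.
by have [p pA pE] := lift M GM'; exists p.
Qed.

End Image.

(** * The monodromy group *)

Section Base_point.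
Variable R : realType.
Local Notation C := (Cplx R).
Local Notation "x %:C" := (complex.real_complex R x : C).
Local Notation M2 := 'M[C]_2.

Definition loop_matrices (x : C) (P : M2) : set (GL C 2) :=
  [set M | transported x P x (val M *m P)].

Lemma loop_matricesM x P M N : loop_matrices x P M -> loop_matrices x P N ->
  loop_matrices x P (M * N)%g.
Proof.
move=> HM HN; apply: transported_trans HM _.
by have := transported_mul (val M) HN; rewrite mulmxA.
Qed.

Lemma loop_matrices_mul (A : GL C 2) x P M : loop_matrices x P M ->
  loop_matrices x (val A *m P) (A * M * A^-1)%g.
Proof.
move=> /(transported_mul (val A)); rewrite /loop_matrices /= -!mulmxA.
by rewrite [invmx _ *m _]mulmxA mulVmx ?mul1mx // (valP A).
Qed.

Lemma loop_matrices_transport x P x' P' M : transported x P x' P' -> loop_matrices x P M ->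
  loop_matrices x' P' M.
Proof.
move=> T HM; apply: transported_trans (transported_sym T) _.
by apply: transported_trans HM _; exact: transported_mul T.
Qed.

Lemma conjmx2V (P : M2) : conjmx2 (invmx P) = invmx (conjmx2 P).
Proof. exact: (map_invmx (Num.conj : {rmorphism C -> C})). Qed.

Lemma toPGLX (M : GL C 2) n : toPGL (M ^+ n)%g = (toPGL M ^+ n)%g.
Proof. by elim: n => [|n IH]; rewrite ?expg0 ?toPGL1 // !expgS toPGLMg IH. Qed.

Lemma diag2_unit (a b : C) : a != 0 -> b != 0 -> diag2 a b \in unitmx.
Proof. by move=> a0 b0; rewrite unitmx2 !mxE /= mulr0 subr0 mulf_neq0. Qed.

Lemma diag2M (a b a' b' : C) : diag2 a b *m diag2 a' b' = diag2 (a * a') (b * b').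
Proof.
by apply: eq_mx2 => j; have [->|->] := ord2_cases j;
  rewrite !diag2E !mxE /= ?mulr0.
Qed.

Lemma diag2_1 : diag2 1 1 = 1%:M :> M2.
Proof. by apply: eq_mx2 => j; have [->|->] := ord2_cases j; rewrite !mxE. Qed.

Lemma conj_diag2 (a b : C) : conjmx2 (diag2 a b) = diag2 a^* b^*.
Proof.
by apply: eq_mx2 => j; have [->|->] := ord2_cases j; rewrite !mxE /= ?rmorph0.
Qed.

Lemma conj_cis (t : R) : (cis t)^* = (cis t)^-1.
Proof.
by apply: (mulfI (cis_neq0 t)); rewrite -normCK norm_cis expr1n divff // cis_neq0.
Qed.

Lemma conj_eq1 (n D : GL C 2) : toPGL D = 1%g -> toPGL (n * D * n^-1)%g = 1%g.
Proof.
move=> H; rewrite toPGLMg (toPGLMg n) H mulg1.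
by transitivity (toPGL (n * n^-1)%g); [exact: esym (toPGLMg _ _) | rewrite mulgV].
Qed.

Lemma conj_neq1 (n D : GL C 2) a b : val D = diag2 a b -> a != b ->
  toPGL (n * D * n^-1)%g != 1%g.
Proof.
move=> DE; apply: contra_neq; rewrite !toPGLMg => H.
have {}H : toPGL D = 1%g.
  have nn : (toPGL n^-1 * toPGL n = 1)%g by rewrite -toPGLMg mulVg.
  rewrite -[toPGL D]mulg1 -nn !mulgA -[toPGL D]mul1g -{1}nn -!mulgA.
  by rewrite (mulgA (toPGL n)) (mulgA (toPGL n * _)%g) H mul1g nn.
have [k kE] := toPGL_scalar H; rewrite DE in kE.
have := congr1 (fun P : M2 => P 0 0) kE; have := congr1 (fun P : M2 => P 1 1) kE.
by rewrite !mxE /= !mulr1n => -> ->.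
Qed.

(* The eigenvectors of the quarter turn [negG] are not real. *)
Lemma real_involution_neq (n D : GL C 2) : conjG n = n -> val D = diag2 1 (-1) ->
  toPGL (n * D * n^-1)%g != toPGL (negG R).
Proof.
move=> rn DE; apply/eqP => /toPGL_eq[k k0 E].
have F : val n *m diag2 1 (-1) = k *: (mat2 0 (-1) 1 0 *m val n).
  by rewrite scalemxAl -[k *: _]E /= DE -mulmxA mulVmx ?mulmx1 // (valP n).
have F0 := congr1 (fun P : M2 => P 0 0) F; have F1 := congr1 (fun P : M2 => P 1 0) F.
move: F0 F1; rewrite [X in _ = X -> _]mxE [X in _ -> _ = X -> _]mxE !mul2E !mat2E !mxE /=.
rewrite !mulr1 !mulr0 !addr0 !mul0r add0r addr0 mul1r => F0 F1.
have rn' i j : (val n i j)^* = val n i j by rewrite -{2}rn /= mxE.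
have : `|val n 0 0| ^+ 2 + `|val n 1 0| ^+ 2 = 0.
  by rewrite !normCK !rn' {2}F0 {2}F1; ring.
move/eqP; rewrite paddr_eq0 ?exprn_ge0 // !expf_eq0 /= !normr_eq0 => /andP[/eqP n0 /eqP n1].
by have := valP n; rewrite /= unitmx2 n0 n1 mulr0 mul0r subrr eqxx.
Qed.

Lemma base_scale : exists2 n : R, 0 < n & n ^+ 5 = 64.
Proof.
pose p : {poly R} := 'X^5 - 64%:P.
have pE (x : R) : p.[x] = x ^+ 5 - 64 by rewrite /p !hornerE /=.
have [||n /andP[n1 n2] /rootP] := @poly_ivt R p 1 4.
- by lra.
- by rewrite !pE; apply/andP; split; lra.
by rewrite pE => /eqP; rewrite subr_eq0 => /eqP E; exists n => //; lra.
Qed.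

Lemma base_icosahedral : exists c (P : M2), carries c 1 P /\
  icosahedral (@toPGL C 2 @` loop_matrices 1 P).
Proof.
have [n n0 n5] := base_scale; have [r rE [r_lt0 E1 Er_gt0]] := real_root R.
pose P := base_frame n%:C.
have cP : carries (n%:C / 12) 1 P.
  by apply: carries_base; rewrite -rmorphXn n5 /= rmorph_nat.
have realP : conjmx2 P = P.
  apply: eq_mx2 => j; rewrite !mxE; have [->|->] := ord2_cases j => /=;
  by rewrite ?rmorph1 ?rmorph0 ?rmorphN ?rmorphM ?fmorphV ?rmorph_nat /= ?conjRC.
exists (n%:C / 12), P; split=> //.
have r1 : r < 1 by exact: lt_trans r_lt0 ltr01.
have seg x : r < x -> exists2 Q, conjmx2 Q = Q & transported 1 P x%:C Q.
  by move=> rx; have := real_segment Er_gt0 r1 rx realP; rewrite rmorph1.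
(* [N] is the connection matrix from the local frame to the frame [P]. All that is retained of it is
   that it is real. *)
have loop x Q (uQ : Q \in unitmx) (D : GL C 2) : r < x -> conjmx2 Q = Q ->
    transported x%:C Q x%:C (val D *m Q) -> exists2 N : GL C 2, conjG N = N &
    loop_matrices 1 P (N * D * N^-1)%g.
  move=> rx rQ HD; have [Q' rQ' T] := seg x rx.
  have [uQ' _] := transported_carries T cP.
  have uN : Q' *m invmx Q \in unitmx by rewrite unitmx_mul uQ' unitmx_inv uQ.
  have NQ : Q' *m invmx Q *m Q = Q' by rewrite -mulmxA mulVmx // mulmx1.
  exists (toGL uN); first by apply: val_inj; rewrite /= conjmx2M conjmx2V rQ rQ'.
  apply: (loop_matrices_transport (transported_sym T)); rewrite -[Q' in loop_matrices _ Q']NQ.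
  exact: (loop_matrices_mul (toGL uN) HD).
have d10 : diag2 (1 : C) (-1) \in unitmx by rewrite diag2_unit ?oppr_eq0 // oner_neq0.
pose z := cis (1%:R / 12 * (2 * pi) : R); pose w := cis (- (7%:R / 12) * (2 * pi) : R).
have zw0 : diag2 z w \in unitmx by rewrite diag2_unit // cis_neq0.
(* The exponents differ by 8/12, so the eigenvalue ratio is the square of the cube root of unity
   [cis (2 pi / 3)]; this gives projective order 3. *)
have zw : z = cis (2 / 3 * pi : R) ^+ 2 * w.
  rewrite -cisMn -cisD; congr cis; by move: (pi : R) => x; field.
have om3 : cis (2 / 3 * pi : R) ^+ 3 = 1.
  by rewrite -cisMn -(cis_2pi R); congr cis; move: (pi : R) => x; field.
have om1 : cis (2 / 3 * pi : R) != 1.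
  by apply: cis_neq1; rewrite mulr_gt0 ?pi_gt0 //= gtr_pMl ?pi_gt0 //; lra.
have zw3 : z ^+ 3 = w ^+ 3.
  by rewrite zw exprMn -exprM mulnC exprM om3 expr1n mul1r.
have zw1 : z != w.
  rewrite zw -subr_eq0 -{2}[w]mul1r -mulrBl mulf_neq0 ?cis_neq0 // subr_eq0.
  apply: contra_neq om1 => om2; by rewrite -om3 exprS om2 mulr1.
have [x1 [P1 [rx1 rP1 uP1 T1]]] := local_root rE E1.
have [x2 [P2 [rx2 rP2 uP2 T2]]] := local_infinity r_lt0.
have [n1 rn1 S] := loop x1 P1 uP1 (toGL d10) rx1 rP1 T1.
have [n2 rn2 T] := loop x2 P2 uP2 (toGL zw0) rx2 rP2 T2.
have [e cyc] := cyclotomic5_root R.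
have conjGV (M : GL C 2) : conjG M^-1%g = (conjG M)^-1%g.
  by apply: val_inj; rewrite /= conjmx2V.
apply: (icosahedral_image cyc (S := (n1 * toGL d10 * n1^-1)%g) (T := (n2 * toGL zw0 * n2^-1)%g)).
- move=> M HM; exists 1 => [|X Y]; first exact: oner_neq0.
  rewrite mul1r; exact: (carries_invariant cP (transported_carries HM cP)).
- have [Q _ TQ] := seg 1 r1; rewrite /loop_matrices /= mul1mx.
  exact: transported_trans TQ (transported_sym TQ).
- by move=> M N; exact: loop_matricesM.
- exact: S.
- rewrite !conjGM conjGV rn1; congr (_ * _ * _)%g; apply: val_inj.
  by rewrite /= conj_diag2 rmorphN /= !rmorph1.
- rewrite -toPGLMg -toPGL1 -(mulg1 (n1 * _ * _)%g); congr toPGL.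
  rewrite mulg1 !mulgA mulgKV -(mulgA n1) (_ : (toGL d10 * toGL d10 = 1)%g) ?mulg1 ?mulgV //.
  by apply: val_inj; rewrite /= diag2M mulr1 mulrNN mulr1 diag2_1.
- apply: (@conj_neq1 n1 (toGL d10) 1 (-1) erefl); by rewrite -subr_eq0 opprK -mulr2n pnatr_eq0.
- exact: (@real_involution_neq n1 (toGL d10) rn1 erefl).
- exact: T.
(* The connection matrix is real and the eigenvalues lie on the unit circle, so conjugation inverts
   the second monodromy. *)
- transitivity (toPGL (n2 * toGL zw0 * n2^-1)^-1%g); last exact: toPGLV.
  congr toPGL; rewrite !conjGM conjGV rn2 !invMg invgK mulgA.
  congr (_ * _ * _)%g; apply: (mulgI (toGL zw0)); rewrite mulgV; apply: val_inj.
  by rewrite /= conj_diag2 diag2M !conj_cis !divff ?cis_neq0 // diag2_1.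
- rewrite -toPGLX -toPGL1.
  have -> : ((n2 * toGL zw0 * n2^-1) ^+ 3 = n2 * (toGL zw0 ^+ 3) * n2^-1)%g.
    by rewrite !expgS expg0 !mulg1 !mulgA !mulgKV.
  apply: conj_eq1; rewrite -toPGL1; apply/toPGL_eq; exists (z ^+ 3); first by rewrite expf_neq0 // cis_neq0.
  rewrite !expgS expg0 mulg1 /= !diag2M -diag2_1.
  apply: eq_mx2 => j; have [->|->] := ord2_cases j; rewrite !mxE /= ?mulr0 ?mulr1;
  by rewrite -?exprS -?zw3.
exact: (@conj_neq1 n2 (toGL zw0) z w erefl).
Qed.

End Base_point.

(** * Arbitrary base point and basis of solutions *)

Section Any_point.
Variable R : realType.
Local Notation C := (Cplx R).
Local Notation "x %:C" := (complex.real_complex R x : C).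
Local Notation M2 := 'M[C]_2.
Variables (e : 'I_3 -> C).
Hypothesis eE : forall z : C, \prod_i (z - e i) = Ef z.

Lemma Ef1 : Ef (1 : C) != 0.
Proof. by rewrite /Ef !expr1n mulr1 subrK oner_neq0. Qed.

Lemma real_imag_inj (a b a' b' : R) : a%:C + 'i%C * b%:C = a'%:C + 'i%C * b'%:C ->
  a = a' /\ b = b'.
Proof.
move=> E; have := congr1 (@complex.Re R) E; have := congr1 (@complex.Im R) E.
by rewrite /= !(mul0r, mul1r, mulr0, add0r, addr0, subr0, oppr0) => -> ->.
Qed.

(* The arcs [bow k] from 1 to [p] meet only at their endpoints, hence one of four
   of them avoids the three roots of [Ef]. *)
Definition bow (p : C) (k : nat) (t : R) : C :=
  1 + (p - 1) * (t%:C + 'i%C * (k%:R * (t * (1 - t)))%:C).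

Lemma path_to (p : C) : Ef p != 0 -> exists2 g, path_on 0 1 g & g 0 = 1 /\ g 1 = p.
Proof.
move=> Ep; have [->|p1] := eqVneq p 1.
  exists (fun=> 1); last by split.
  move=> t _; split; first exact: Ef1.
  by move=> d d0; apply: filterE => s _; rewrite subrr normr0.
have b0 k : bow p k 0 = 1 by rewrite /bow mul0r mulr0 rmorph0 mulr0 addr0 mulr0 addr0.
have b1 k : bow p k 1 = p.
  by rewrite /bow subrr !mulr0 rmorph1 addr0 mulr1 addrC subrK.
suff [k Hk] : exists k : nat, forall t, 0 <= t <= 1 -> Ef (bow p k t) != 0.
  exists (bow p k) => [t tI|]; last by split.
  split=> [|d d0]; first exact: Hk.
  pose K := `|p - 1| * (1 + k%:R).
  have K0 : 0 < K by rewrite mulr_gt0 ?normr_gt0 ?subr_eq0 // ltr_pwDl.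
  have [q q0 qE] := real_complexE' (divr_gt0 d0 K0).
  apply/near_normP; exists q => // s st sI.
  have -> : bow p k s - bow p k t = (p - 1) * ((s - t)%:C * (1 + 'i%C * (k%:R * (1 - s - t))%:C)).
    rewrite /bow !(rmorphM, rmorphB, rmorph1, rmorph_nat) /=; ring.
  rewrite !normrM normRC.
  have H : `|1 + 'i%C * (k%:R * (1 - s - t))%:C| <= 1 + k%:R.
    rewrite (le_trans (ler_normD _ _)) // normr1 lerD2l normrM normRC.
    rewrite complex.normc_def /= expr0n expr1n add0r sqrtr1 mul1r -[k%:R]/(k%:R) -(rmorph_nat (complex.real_complex R)).
    rewrite complex.lecR normrM normr_nat ler_piMr // ler_norml.
    by case/andP: sI tI => s0 s1 /andP[t0 t1]; lra.
  rewrite (@le_lt_trans _ _ (K * `|s - t|%:C)) //; last first.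
    by rewrite mulrC -ltr_pdivlMr // qE complex.ltcR.
  rewrite /K -mulrA ler_wpM2l // mulrC ler_wpM2r //.
  by rewrite -[0]/(0%:C) complex.lecR.
apply: contrapT => H.
have {}H (k : 'I_4) : exists jt : 'I_3 * R, 0 <= jt.2 <= 1 /\ bow p k jt.2 = e jt.1.
  apply: contrapT => Hk; apply: H; exists (k : nat) => t tI.
  apply/negP => Et; apply: Hk.
  move: Et; rewrite -eE => /prodf_eq0[j _]; rewrite subr_eq0 => /eqP E.
  by exists (j, t).
have [f Hf] := boolp.choice H.
have /leq_card : injective (fun k => (f k).1); last by rewrite !card_ord.
move=> k k' /= E; have [tI Hk] := Hf k; have [_ Hk'] := Hf k'.
have : bow p k (f k).2 = bow p k' (f k').2 by rewrite Hk Hk' E.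
have n0 : (f k).2 != 0.
  have : Ef (e (f k).1) = 0.
    by apply/eqP; rewrite -eE; apply/prodf_eq0; exists (f k).1; rewrite ?subrr.
  by apply: contra_eq_neq => t0; rewrite -Hk t0 b0 Ef1.
have n1 : (f k).2 != 1.
  have : Ef (e (f k).1) = 0.
    by apply/eqP; rewrite -eE; apply/prodf_eq0; exists (f k).1; rewrite ?subrr.
  by apply: contra_eq_neq => t0; rewrite -Hk t0 b1.
move/addrI/mulfI; rewrite subr_eq0 => /(_ p1) /real_imag_inj[tE].
rewrite -tE => /mulIf; rewrite mulf_neq0 ?subr_eq0 // 1?eq_sym // => /(_ isT) /eqP.
by rewrite eqr_nat => /eqP kk; apply: val_inj.
Qed.

Lemma icosahedral_conj (A : PGL C 2) (S : set (PGL C 2)) : icosahedral S ->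
  icosahedral [set (A * x * A^-1)%g | x in S].
Proof.
move=> [f [fM finj <-]]; exists (fun q => A * f q * A^-1)%g; split.
- by move=> a b aA bA; rewrite fM // !mulgA mulgKV.
- by move=> a b aA bA /mulIg /mulgI; exact: finj.
apply/seteqP; split=> [_ [q qA <-]|_ [_ [q qA <-] <-]]; last by exists q.
by exists (f q) => //; exists q.
Qed.

(** Continuation along a path from 1 to [p] followed by a change of basis conjugates the projective
    group by [A], which does not affect its isomorphism type. *)
Lemma icosahedral_at p (y : 'I_2 -> C -> C) : ordinary_point e p ->
  (forall j, local_solution (1 / 6) (- 1 / 9) e p (y j)) -> independent_at p y ->
  icosahedral (projective_monodromy_group (1 / 6) (- 1 / 9) e p y).
Proof.
move=> /(ordinary_pointE eE) Ep Hy ind.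
have uJ := independent_jets eE Ep Hy ind.
have [c [P [cP ico]]] := base_icosahedral R.
have [g pg [g0 g1]] := path_to Ep.
have [Q] := transported_exists P pg; rewrite g0 g1 => T.
have [uQ _] := transported_carries T cP.
have uA : jets y p *m invmx Q \in unitmx by rewrite unitmx_mul uJ unitmx_inv uQ.
pose A := toGL uA.
have AQ : val A *m Q = jets y p by rewrite /= -mulmxA mulVmx // mulmx1.
have AJ : val A^-1%g *m jets y p = Q by rewrite -AQ /= mulmxA mulVmx ?mul1mx.
suff -> : projective_monodromy_group (1 / 6) (- 1 / 9) e p y =
    [set (toPGL A * x * (toPGL A)^-1)%g | x in @toPGL C 2 @` loop_matrices 1 P].
  exact: icosahedral_conj.
have VE : ((toPGL A)^-1 = toPGL A^-1)%g by exact: esym (toPGLV _).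
apply/seteqP; split=> [_ [M /(monodromy_transported eE Ep Hy) HM <-]|_ [_ [M HM <-] <-]].
  exists (toPGL (A^-1 * M * A)%g).
    exists (A^-1 * M * A)%g => //; apply: (loop_matrices_transport (transported_sym T)).
    have := loop_matrices_mul A^-1%g (M := M) HM.
    by rewrite AJ invgK.
  by rewrite VE -!toPGLMg !mulgA mulgV mul1g -mulgA mulgV mulg1.
exists (A * M * A^-1)%g; last by rewrite VE !toPGLMg.
apply: (transported_monodromy eE Ep Hy); rewrite -AQ.
exact: (loop_matrices_mul A (loop_matrices_transport T HM)).
Qed.

End Any_point.

(** * Scaling *)

Section Scaling.
Variable R : realType.
Local Notation C := (Cplx R).
Implicit Types (l B p : C) (e : 'I_3 -> C) (f : C -> C).

Lemma near_scale (a p : C) (Q : C -> Prop) : a != 0 -> (\forall z \near a * p, Q z) ->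
  \forall z \near p, Q (a * z).
Proof.
move=> a0 /near_normP[r r0 H]; apply/near_normP; exists (r / `|a|).
  by rewrite divr_gt0 // normr_gt0.
move=> z; rewrite ltr_pdivlMr ?normr_gt0 // => zp; apply: H.
by rewrite -mulrBr normrM mulrC.
Qed.

Lemma is_der_scale (a : C) f z (d : C) : is_derive (a * z) 1 f d ->
  is_derive z 1 (fun w => f (a * w)) (a * d).
Proof.
move=> D; have D' := is_derM (is_der_cst a z) (is_der_id z).
apply: is_derive_eq (is_derive_comp1 (g := fun w : C => a * w) D D') _.
by ring.
Qed.

(** The operator is homogeneous: under [z -> a z], with the roots and [B] multiplied by [a], it is
    multiplied by [a ^ 2]. *)
Lemma local_solution_scale (a : C) l B e p f : a != 0 ->
  local_solution l (a * B) (fun i => a * e i) (a * p) f ->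
  local_solution l B e p (fun z => f (a * z)).
Proof.
move=> a0 /(nbhs_interior (A := fun z => [/\ _, _ & _ = 0])) H.
have := near_scale a0 H; apply: filterS => z Hz.
have N := near_scale a0 Hz.
have [df ddf L] := nbhs_singleton Hz.
have D1 : \forall w \near z, a * derive1 f (a * w) = derive1 (fun z => f (a * z)) w.
  apply: filterS N => w [dw _ _].
  by rewrite (is_derive_derive1 (is_der_scale (derivable_is_derive dw))).
have D2 := is_der_near D1 (is_derZ a (is_der_scale (derivable_is_derive ddf))).
have D1' := is_der_scale (derivable_is_derive df).
split; [by case: D1' | by case: D2 |].
have E1 := is_derive_derive1 D1'.
have E2 : derive1n 2 (fun z => f (a * z)) z = a * (a * derive1n 2 f (a * z)) := is_derive_derive1 D2.
transitivity (a ^+ 2 * lame l (a * B) (fun i => a * e i) f (a * z)); last by rewrite L mulr0.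
rewrite /lame E1 E2.
have -> : \sum_i (a * z - a * e i)^-1 = a^-1 * \sum_i (z - e i)^-1.
  by rewrite mulr_sumr; apply: eq_bigr => i _; rewrite -mulrBr invfM.
have -> : \prod_i (a * z - a * e i) = a ^+ 3 * \prod_i (z - e i).
  by rewrite !big_ord_recl !big_ord0; ring.
rewrite !invfM.
move: (derive1n 2 f _) (derive1 f _) (f _) (\sum_i _) ((\prod_i _)^-1) => y2 y1 y S P.
by field.
Qed.

Lemma monodromy_group_scale (a : C) l B e p y (M : GL C 2) : a != 0 ->
  monodromy_group l (a * B) (fun i => a * e i) (a * p) y M ->
  monodromy_group l B e p (fun j z => y j (a * z)) M.
Proof.
move=> a0 [g [Y [[cg g0 g1 og] cY Y0 Y1]]].
have gK t : a * (a^-1 * g t) = g t by rewrite mulVKf.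
exists (fun t => a^-1 * g t), (fun j t z => Y j t (a * z)); split.
- split; [|by rewrite g0 mulKf|by rewrite g1 mulKf|].
    move/subspace_continuousP: cg => cg; apply/subspace_continuousP => t tI.
    by apply: cvgM; [exact: cvg_cst | exact: cg].
  by move=> t /og H i; apply: contra_neq (H i) => E; rewrite -E gK.
- move=> j t /(cY j t)[S H]; split.
    by apply: local_solution_scale; rewrite ?gK.
  apply: filterS H => s H sI; apply: (near_scale (Q := fun z => Y j s z = Y j t z) a0).
  by rewrite gK; exact: H.
- by move=> j; exact: (near_scale (Q := fun z => Y j 0 z = y j z) a0 (Y0 j)).
- by move=> j; exact: (near_scale (Q := fun z => Y j 1 z = \sum_k val M j k * y k z) a0 (Y1 j)).
Qed.

Lemma independent_at_scale (a : C) p (y : 'I_2 -> C -> C) : a != 0 ->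
  independent_at (a * p) y -> independent_at p (fun j z => y j (a * z)).
Proof.
move=> a0 ind c H; apply: ind.
have aV : a^-1 != 0 by rewrite invr_eq0.
rewrite -(mulKf a0 p) in H.
have := near_scale aV H; apply: filterS => z.
by under eq_bigr do rewrite mulVKf //.
Qed.

Lemma monodromy_group_scaleE (a : C) l B e p y : a != 0 ->
  monodromy_group l (a * B) (fun i => a * e i) (a * p) y =
  monodromy_group l B e p (fun j z => y j (a * z)).
Proof.
move=> a0; apply/seteqP; split=> M; first exact: monodromy_group_scale.
have aV : a^-1 != 0 by rewrite invr_eq0.
have := @monodromy_group_scale a^-1 l (a * B) (fun i => a * e i) (a * p) (fun j z => y j (a * z)) M aV.
rewrite !mulKf // (_ : (fun i => a^-1 * (a * e i)) = e); last by apply/funext => i; rewrite mulKf.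
rewrite (_ : (fun (j : 'I_2) z => y j (a * (a^-1 * z))) = y) //.
by apply/funext => j; apply/funext => z; rewrite mulVKf.
Qed.

End Scaling.

(** * The invariants of the cubic and its normalised roots *)

Section Invariants.
Variable R : realType.
Local Notation C := (Cplx R).
Variables (alpha : C) (e : 'I_3 -> C).
Hypotheses (alpha_neq0 : alpha != 0) (e_distinct : injective e) (e_sum : \sum_i e i = 0).

Lemma cubic_eval z : 4 * \prod_i (z - e i) = 4 * z ^+ 3 - g2 e * z - g3 e.
Proof.
have := congr1 (fun p : {poly C} => p.[z]) (cubic_invariants e_sum).
rewrite /cubic hornerM hornerC horner_prod => E.
transitivity (4 * \prod_i ('X - (e i)%:P).[z]).
  by congr (_ * _); apply: eq_bigr => i _; rewrite hornerXsubC.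
by rewrite E !polyE.
Qed.

Lemma cubic_root i : 4 * e i ^+ 3 - g2 e * e i - g3 e = 0.
Proof.
rewrite -cubic_eval (_ : \prod_j _ = 0) ?mulr0 //; apply/eqP/prodf_eq0.
by exists i; rewrite ?subrr.
Qed.

Lemma normalized_roots : g2 e = 80 * alpha ^+ 2 / 3 -> g3 e = - (80 * alpha ^+ 3) / 3 ->
  forall z, \prod_i (z - alpha^-1 * e i) = Ef z.
Proof.
move=> G2 G3 z; apply: (mulfI (_ : 4 * alpha ^+ 3 != 0)).
  by rewrite mulf_neq0 ?pnatr_eq0 // expf_neq0.
transitivity (4 * \prod_i (alpha * z - e i)).
  have E i : e i = alpha * (alpha^-1 * e i) by rewrite mulVKf.
  rewrite !big_ord_recl !big_ord0 [in RHS](E ord0) [in RHS](E (lift _ _)) [in RHS](E (lift _ (lift _ _))).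
  by move: (alpha^-1 * _) (alpha^-1 * _) (alpha^-1 * _) => x y w; ring.
by rewrite cubic_eval G2 G3 /Ef; field.
Qed.

Lemma invariants_roots : (g2 e = 80 * alpha ^+ 2 / 3 /\ g3 e = - (80 * alpha ^+ 3) / 3) <->
   (exists r : 'I_3 -> C,
      [/\ injective r,
          forall i, root (3%:P * 'X^3 - 20%:P * 'X + 20%:P) (r i)
        & forall i, e i = alpha * r i]).
Proof.
have rE x : (3%:P * 'X^3 - 20%:P * 'X + 20%:P : {poly C}).[x] = 3 * x ^+ 3 - 20 * x + 20.
  by rewrite !polyE.
split=> [[G2 G3]|[r [ir rr er]]].
  exists (fun i => alpha^-1 * e i); split=> [i j|i|i]; last by rewrite mulVKf.
    by move/(mulfI (_ : alpha^-1 != 0)); rewrite invr_eq0 => /(_ alpha_neq0) /e_distinct.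
  apply/rootP; rewrite rE; have := cubic_root i; rewrite G2 G3.
  rewrite -{1 2}(mulVKf alpha_neq0 (e i)); move: (alpha^-1 * _) => x H.
  apply: (mulfI (_ : 4 * alpha ^+ 3 / 3 != 0)).
    by rewrite mulf_neq0 ?invr_eq0 ?pnatr_eq0 // mulf_neq0 ?pnatr_eq0 // expf_neq0.
  by rewrite mulr0 -[RHS]H; field.
(* Both cubics vanish at [e i] and have the same leading and quadratic coefficients, so their
   difference is affine. Two distinct roots then force it to be zero. *)
have E i : (g2 e - 80 * alpha ^+ 2 / 3) * e i + (g3 e + 80 * alpha ^+ 3 / 3) = 0.
  have /rootP := rr i; rewrite rE => H; have := cubic_root i; rewrite er => K.
  transitivity (4 * alpha ^+ 3 / 3 * (3 * r i ^+ 3 - 20 * r i + 20) -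
    (4 * (alpha * r i) ^+ 3 - g2 e * (alpha * r i) - g3 e)); last by rewrite H K; ring.
  by field.
have e01 : e 0 - e 1 != 0 by rewrite subr_eq0; apply/eqP => /e_distinct.
have G2 : g2 e - 80 * alpha ^+ 2 / 3 = 0.
  apply: (mulIf e01); rewrite mul0r -[RHS](subrr 0) -{1}(E 0) -(E 1); ring.
have := E 0; rewrite G2 mul0r add0r => G3; split; apply/eqP.
  by rewrite -subr_eq0 G2.
by rewrite mulNr -addr_eq0 G3.
Qed.

Lemma Jinv_value : g2 e = 80 * alpha ^+ 2 / 3 -> g3 e = - (80 * alpha ^+ 3) / 3 -> Jinv e = - 80.
Proof.
move=> G2 G3; rewrite /Jinv G2 G3.
have -> : (80 * alpha ^+ 2 / 3) ^+ 3 - 27 * (- (80 * alpha ^+ 3) / 3) ^+ 2 =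
    - (80 ^+ 2 * alpha ^+ 6 / 27) by field.
by field; rewrite alpha_neq0.
Qed.

End Invariants.

Unset Implicit Arguments.

Theorem proposition3p5 (R : realType) (alpha : Cplx R) (e : 'I_3 -> Cplx R)
    (alpha_neq0 : alpha != 0) (e_distinct : injective e)
    (e_sum : \sum_i e i = 0) :
  ((g2 e = 80 * alpha ^+ 2 / 3 /\ g3 e = - (80 * alpha ^+ 3) / 3) <->
   (exists r : 'I_3 -> Cplx R,
      [/\ injective r,
          forall i, root (3%:P * 'X^3 - 20%:P * 'X + 20%:P) (r i)
        & forall i, e i = alpha * r i])) /\
  (g2 e = 80 * alpha ^+ 2 / 3 -> g3 e = - (80 * alpha ^+ 3) / 3 ->
   Jinv e = - 80 /\
   forall (p : Cplx R) (y : 'I_2 -> Cplx R -> Cplx R),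
     ordinary_point e p ->
     (forall j, local_solution (1 / 6) (- alpha / 9) e p (y j)) ->
     independent_at p y ->
     icosahedral (projective_monodromy_group (1 / 6) (- alpha / 9) e p y)).
Proof.
split=> [|G2 G3]; first exact: invariants_roots.
split=> [|p y]; first exact: Jinv_value G2 G3.
(* Division by [alpha] brings the roots to those of [Ef], and [B] to -1/9. *)
pose r i := alpha^-1 * e i.
have eE : e = fun i => alpha * r i by apply/funext => i; rewrite /r mulVKf.
have BE : - alpha / 9 = alpha * (- 1 / 9) by field.
rewrite BE -(mulVKf alpha_neq0 p) eE; move: (alpha^-1 * p) => q Oq Sq Iq.
rewrite /projective_monodromy_group monodromy_group_scaleE //.
apply: (icosahedral_at (normalized_roots alpha_neq0 e_sum G2 G3)).
- by move=> i; apply: contra_neq (Oq i) => ->.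
- by move=> j; exact: (local_solution_scale alpha_neq0 (Sq j)).
exact: independent_at_scale.
Qed.
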